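(* Let $\mathcal{K}$ be a class of finitely generated $\mathcal{L}$-structures. Then the following are equivalent: (1) The class $\mathcal{K}$ is a Fraïssé class. (2) The class $\mathcal{K}$ is the age of a separable approximately ultra-homogeneous structure $\mathfrak{M}$. Moreover, such a structure $\mathfrak{M}$ is necessarily a limit of $\mathcal{K}$, and thus it is unique up to isomorphism and universal for separable $\mathcal{K}$-structures (every separable $\mathcal{K}$-structure embeds in $\mathfrak{M}$).
   Context: **Approximate isometries.** Let $X,Y,Z$ be metric spaces. A function $\psi\colon X\to[0,\infty]$ is Katětov if $\psi(x)\le d(x,y)+\psi(y)$ and $d(x,y)\le\psi(x)+\psi(y)$ for all $x,y\in X$. An approximate isometry $\psi\colon X\rightsquigarrow Y$ is a function $\psi\colon X\times Y\to[0,\infty]$ that is separately Katětov in each argument. For $\psi\colon X\times Y\to[0,\infty]$ and $\varphi\colon Y\times Z\to[0,\infty]$ put $\varphi\psi(x,z)=\inf_{y\in Y}\psi(x,y)+\varphi(y,z)$ and $\psi^*(y,x)=\psi(x,y)$ (with $\inf\emptyset=\infty$). A partial isometry $f\colon X\dashrightarrow Y$ is identified with the approximate isometry $\psi_f(x,y)=\inf_{z\in\mathrm{dom} f}d(x,z)+d(fz,y)$. If $X\subseteq X'$, $Y\subseteq Y'$, then $\psi\colon X\rightsquigarrow Y$ is identified with its trivial extension $(x',y')\mapsto\inf_{x\in X,y\in Y}d(x',x)+\psi(x,y)+d(y,y')$, an approximate isometry $X'\rightsquigarrow Y'$. $\mathrm{Apx}(X,Y)$ is the set of approximate isometries $X\rightsquigarrow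 Y$ with the topology induced from $[0,\infty]^{X\times Y}$, ordered pointwise. $\mathrm{Apx}^{\le\psi}(X,Y)=\{\varphi:\varphi\le\psi\}$; $\mathrm{Apx}^{<\psi}(X,Y)$ is its interior in $\mathrm{Apx}(X,Y)$, and $\varphi<\psi$ means $\varphi\in\mathrm{Apx}^{<\psi}(X,Y)$. For $\mathcal{A}\subseteq\mathrm{Apx}(X,Y)$, $\mathcal{A}^\uparrow=\{\psi:\exists\varphi\in\mathcal{A},\ \psi\ge\varphi\}$. For $X_0\subseteq X$ and $r>0$, $\psi\colon X\rightsquigarrow Y$ is $r$-total on $X_0$ if for all $x\in X_0$ and $s>r$ there is $y\in Y$ with $\psi(x,y)<s$. **Structures.** $\mathcal{L}$ is a collection of predicate and function symbols, each with an arity in $\mathbb{N}$. An $\mathcal{L}$-structure $\mathfrak{A}$ is a complete metric space $A$ (possibly empty) with a continuous interpretation $R^{\mathfrak{A}}\colon A^n\to\mathbb{R}$ of each $n$-ary predicate symbol and a continuous interpretation $f^{\mathfrak{A}}\colon A^n\to A$ of each $n$-ary function symbol; the distance is counted among the predicates. $\langle A_0\rangle$ is the smallest substructure containing $A_0\subseteq A$ (the metric closure of the closure of $A_0$ under function symbols). An embedding is a map commuting with all interpretations of symbols (in particular it is isometric). A partial isomorphism $\varphi\colon\mathfrak{A}\dashrightarrow\mathfrak{B}$ is a map $A_0\to B$, $A_0\subseteq A$, that extends to an embedding $\langle A_0\rangle\to\mathfrak{B}$; it is finite if $A_0$ is finite. $\mathrm{Age}(\mathfrak{A})$ is the class of finitely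 generated structures which embed in $\mathfrak{A}$. A separable structure $\mathfrak{M}$ is approximately ultra-homogeneous if for every finite partial isomorphism $\varphi\colon\mathfrak{M}\dashrightarrow\mathfrak{M}$ and every $\varepsilon>0$ there is $f\in\mathrm{Aut}(\mathfrak{M})$ with $d(\varphi a,fa)<\varepsilon$ for all $a\in\mathrm{dom}\,\varphi$. **Classes.** Let $\mathcal{K}$ be a class of finitely generated structures. A $\mathcal{K}$-structure is a structure $\mathfrak{A}$ with $\mathrm{Age}(\mathfrak{A})\subseteq\mathcal{K}$. HP: every member of $\mathcal{K}$ is a $\mathcal{K}$-structure. JEP: every two members of $\mathcal{K}$ embed in a third one. NAP (for $\mathcal{K}$ with HP): for all $\mathfrak{A},\mathfrak{B}\in\mathcal{K}$, finite partial isomorphism $f\colon\mathfrak{A}\dashrightarrow\mathfrak{B}$ and $\varepsilon>0$ there are $\mathfrak{C}\in\mathcal{K}$ and embeddings $g\colon\mathfrak{A}\to\mathfrak{C}$, $h\colon\mathfrak{B}\to\mathfrak{C}$ with $d(ga,hfa)\le\varepsilon$ for all $a\in\mathrm{dom} f$. **Approximate isomorphisms.** Let $\mathcal{K}$ have HP and let $\mathfrak{A},\mathfrak{B}$ be $\mathcal{K}$-structures. $\mathrm{Apx}_1(\mathfrak{A},\mathfrak{B})$ is the set of finite partial isomorphisms $\mathfrak{A}\dashrightarrow\mathfrak{B}$; $\mathrm{Apx}_2(\mathfrak{A},\mathfrak{B})=\{fg: g\in\mathrm{Apx}_1(\mathfrak{A},\mathfrak{C}),\ f\in\mathrm{Apx}_1(\mathfrak{C},\mathfrak{B})\text{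 for some }\mathfrak{C}\in\mathcal{K}\}$ (composition as approximate isometries); $\mathrm{Apx}(\mathfrak{A},\mathfrak{B})=\overline{\mathrm{Apx}_2(\mathfrak{A},\mathfrak{B})^\uparrow}\subseteq\mathrm{Apx}(A,B)$ (the approximate isomorphisms). $\mathrm{Stx}(\mathfrak{A},\mathfrak{B})$ (strictly approximate isomorphisms) is the set of $\psi\in\mathrm{Apx}(\mathfrak{A},\mathfrak{B})$ such that there is $\varphi\in\mathrm{Apx}(\mathfrak{A},\mathfrak{B})$ with $\varphi<\psi$ in $\mathrm{Apx}(A,B)$. **Fraïssé classes.** $\mathcal{K}_n$ is the class of pairs $(\bar a,\mathfrak{A})$, with $\mathfrak{A}\in\mathcal{K}$ and $\bar a\in A^n$ generating $\mathfrak{A}$; one writes $\bar a$ for the pair and $\langle\bar a\rangle$ for $\mathfrak{A}$. If $\mathcal{K}$ has HP and NAP, $\mathcal{K}_n$ carries the pseudo-distance $d^{\mathcal{K}}(\bar a,\bar b)=\inf\{\max_i\psi(a_i,b_i):\psi\in\mathrm{Apx}(\langle\bar a\rangle,\langle\bar b\rangle)\}$ (equivalently, the infimum of $\max_i d(a_i,b_i)$ over all embeddings of $\langle\bar a\rangle,\langle\bar b\rangle$ into a common $\mathfrak{C}\in\mathcal{K}$). $\mathcal{K}$ is a Fraïssé class if it has HP, JEP, NAP and - PP: $d^{\mathcal{K}}$ is separable and complete on $\mathcal{K}_n$ for each $n$; - CP: for every $n$-ary predicate symbol $P$ the map $\mathcal{K}_n\to\mathbb{R}$, $\bar a\mapsto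 P^{\langle\bar a\rangle}(\bar a)$ is continuous, and for every $n$-ary function symbol $f$ and every $m$ the map $\mathcal{K}_{n+m}\to\mathcal{K}_{n+m+1}$, $(\bar a,\bar b)\mapsto(\bar a,\bar b,f^{\langle\bar a,\bar b\rangle}(\bar a))$ is continuous. **Limit.** A limit of a Fraïssé class $\mathcal{K}$ is a separable $\mathcal{K}$-structure $\mathfrak{M}$ such that for every $\mathcal{K}$-structure $\mathfrak{A}$, finite $A_0\subseteq A$, $\psi\in\mathrm{Stx}(\mathfrak{A},\mathfrak{M})$ and $\varepsilon>0$ there is $\varphi\in\mathrm{Stx}(\mathfrak{A},\mathfrak{M})$ with $\varphi<\psi$ which is $\varepsilon$-total on $A_0$.
   Formalization: The class K is assumed to be nonempty: the empty class satisfies HP, JEP, NAP, PP and CP vacuously but is not the age of any structure, since every age contains the structure generated by the empty set. *)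

(* Defs.v *)
From HB Require Import structures.
From mathcomp Require Import all_boot all_order all_algebra.
From mathcomp Require Import all_classical all_reals all_analysis.

Set Implicit Arguments.
Unset Strict Implicit.
Unset Printing Implicit Defensive.

Import Order.TTheory GRing.Theory Num.Theory.
Import numFieldNormedType.Exports.

Local Open Scope classical_set_scope.
Local Open Scope ring_scope.

(* The library's completeType is pointed, hence excludes the empty space. *)
Definition complete_metric (R : realType) (X : metricType R) : Prop :=
  forall u : nat -> X, cauchy (u @ \oo) -> exists l : X, u @ \oo --> l.

Definition separable_space (X : topologicalType) : Prop :=
  exists S : set X, countable S /\ dense S.

Section ApproximateIsometries.
Context {R : realType}.
Implicit Types X Y Z : metricType R.

(* [0,oo] is represented inside \bar R; it carries the induced topology. *)
Definition katetov X (psi : X -> \bar R) : Prop :=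
  [/\ forall x, (0 <= psi x)%E,
      forall x y, (psi x <= (mdist x y)%:E + psi y)%E
    & forall x y, ((mdist x y)%:E <= psi x + psi y)%E].

Definition Apx X Y : set {ptws X * Y -> \bar R} :=
  [set psi | (forall y, katetov (fun x => psi (x, y))) /\
             (forall x, katetov (fun y => psi (x, y)))].

Definition apx_le X Y (phi psi : {ptws X * Y -> \bar R}) : Prop :=
  forall z, (phi z <= psi z)%E.

Definition Apx_le X Y (psi : {ptws X * Y -> \bar R}) :
    set {ptws X * Y -> \bar R} :=
  [set phi | Apx phi /\ apx_le phi psi].

(* The interior of [Apx_le psi] in the subspace [Apx X Y]. *)
Definition Apx_lt X Y (psi : {ptws X * Y -> \bar R}) :
    set {ptws X * Y -> \bar R} :=
  [set phi | Apx phi /\ exists U : set {ptws X * Y -> \bar R},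
     [/\ open U, U phi & U `&` @Apx X Y `<=` Apx_le psi]].

Definition apx_up X Y (F : set {ptws X * Y -> \bar R}) :
    set {ptws X * Y -> \bar R} :=
  [set psi | Apx psi /\ exists2 phi, F phi & apx_le phi psi].

(* [apx_comp phi psi] is written phi psi: first psi, then phi. *)
Definition apx_comp X Y Z (phi : {ptws Y * Z -> \bar R})
    (psi : {ptws X * Y -> \bar R}) : {ptws X * Z -> \bar R} :=
  fun z => ereal_inf (range (fun y : Y => psi (z.1, y) + phi (y, z.2))%E).

Definition apx_of_map X Y (D : set X) (f : D -> Y) : {ptws X * Y -> \bar R} :=
  fun z => ereal_inf
    (range (fun a : D => (mdist z.1 (val a) + mdist (f a) z.2)%:E)).

Definition r_total X Y (r : R) (X0 : set X) (psi : {ptws X * Y -> \bar R}) :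
    Prop :=
  forall x, X0 x -> forall s : R, r < s -> exists y : Y, (psi (x, y) < s%:E)%E.

End ApproximateIsometries.

Record language := Language {
  pred_symb : Type;
  fun_symb : Type;
  pred_arity : pred_symb -> nat;
  fun_arity : fun_symb -> nat }.

(* The distance is a predicate of every language; it is not listed in
   [pred_symb] but supplied by [carrier], and is treated along with the
   predicate symbols in [embedding] and [CP]. *)
Record structure (R : realType) (L : language) := Structure {
  carrier :> metricType R;
  carrier_complete : complete_metric carrier;
  pred_int : forall P : pred_symb L, {ptws 'I_(pred_arity P) -> carrier} -> R;
  pred_int_continuous : forall P, continuous (pred_int (P := P));
  fun_int :
    forall F : fun_symb L, {ptws 'I_(fun_arity F) -> carrier} -> carrier;
  fun_int_continuous : forall F, continuous (fun_int (F := F)) }.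

Arguments pred_int {R L} s P _.
Arguments fun_int {R L} s F _.

Section Structures.
Context {R : realType} {L : language}.
Implicit Types A B C M : structure R L.

Definition separable_structure A : Prop := separable_space A.

Record embedding A B (f : A -> B) : Prop := Embedding {
  embedding_dist : forall x y : A, mdist (f x) (f y) = mdist x y;
  embedding_pred : forall (P : pred_symb L) (a : 'I_(pred_arity P) -> A),
    pred_int B P (fun i => f (a i)) = pred_int A P a;
  embedding_fun : forall (F : fun_symb L) (a : 'I_(fun_arity F) -> A),
    fun_int B F (fun i => f (a i)) = f (fun_int A F a) }.

Definition embeds A B : Prop := exists f : A -> B, embedding f.

Definition isomorphism A B (f : A -> B) : Prop := embedding f /\ bijective f.

Definition isomorphic A B : Prop := exists f : A -> B, isomorphism f.

Definition automorphism A (f : A -> A) : Prop := isomorphism f.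

Definition substructure_set A (S : set A) : Prop :=
  closed S /\
  forall (F : fun_symb L) (a : 'I_(fun_arity F) -> A),
    (forall i, S (a i)) -> S (fun_int A F a).

Definition generated A (A0 : set A) : set A :=
  smallest (@substructure_set A) A0.

End Structures.

Section SubspaceMetric.
Context {R : realType} {X : metricType R} (S : set X).

Let sub_dist (x y : S) : R := mdist (val x) (val y).

Let sub_dist_ge0 x y : 0 <= sub_dist x y.
Proof. exact: mdist_ge0. Qed.

Let sub_dist_positivity x y : sub_dist x y = 0 -> x = y.
Proof. by move=> /mdist_positivity/val_inj. Qed.

Let ballE_sub_dist (x : S) d : ball x d = [set y | sub_dist x y < d].
Proof.
have -> : ball x d = [set y | ball (val x) d (val y)] by [].
by rewrite ballEmdist.
Qed.

HB.instance Definition _ := PseudoMetric_isMetric.Build R (set_type S)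
  sub_dist_ge0 sub_dist_positivity ballE_sub_dist.

End SubspaceMetric.


Lemma ptws_cvgP (I : Type) (Y : topologicalType) (F : set_system {ptws I -> Y})
    (f : {ptws I -> Y}) : Filter F ->
  F --> f <-> forall i, (fun g : {ptws I -> Y} => g i) @ F --> f i.
Proof.
move=> FF; split.
  move=> /cvg_sup Ff i U; rewrite nbhsE => -[V [oV Vfi] VU].
  apply: filterS (Ff i (fun g => V (g i)) _); first by move=> g /VU.
  by apply: open_nbhs_nbhs; split => //; exists V.
move=> Ff; apply/cvg_sup => i U; rewrite (@nbhsE (initial_topology _)).
move=> -[_ [[V oV <-] Vfi] VU]; apply: filterS VU _.
by apply: (Ff i); apply: open_nbhs_nbhs.
Qed.

Section Substructure.
Context {R : realType} {L : language} (A : structure R L) (S : set A).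

Lemma generated_substructure : substructure_set (generated S).
Proof.
split.
  by apply: closed_bigI => B [[cB _] _].
move=> F a ha B [sB SB]; apply: sB.2 => i; exact: (ha i B (conj sB SB)).
Qed.

Hypothesis subS : substructure_set S.

Lemma sub_complete : complete_metric (set_type S).
Proof.
move=> u cu.
have cv : cauchy ((fun k => val (u k)) @ \oo).
  apply/cauchyP => e e0; move/cauchyP: cu => /(_ e e0)[x hx].
  by exists (val x).
have [l hl] := carrier_complete cv.
have Sl : S l.
  have uS : \forall k \near \oo, S (val (u k)).
    by apply: nearW => k; exact: set_mem (valP (u k)).
  exact: (@closed_cvg _ _ _ _ (fun k => val (u k)) S subS.1 uS l hl).
exists (exist _ l (mem_set Sl)).
apply/(@metricType_numDomainType.cvgrPdist_lt R (set_type S)) => e e0.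
by move/(@metricType_numDomainType.cvgrPdist_lt R A) : hl; apply.
Qed.

Lemma sub_val_continuous n :
  continuous (fun a : {ptws 'I_n -> set_type S} =>
    (fun i => val (a i)) : {ptws 'I_n -> A}).
Proof.
move=> a; apply/(ptws_cvgP _ (fmap_filter _ (nbhs_filter a))) => i.
have /(ptws_cvgP _ (nbhs_filter a))/(_ i) ai : nbhs a --> a by apply: cvg_id.
apply: cvg_trans (initial_continuous (f := val) (x := a i)).
exact: (cvg_app val ai).
Qed.

Definition sub_pred (P : pred_symb L)
    (a : {ptws 'I_(pred_arity P) -> set_type S}) : R :=
  pred_int A P (fun i => val (a i)).

Lemma sub_pred_continuous P : continuous (@sub_pred P).
Proof.
move=> a; apply: continuous_comp; first exact: sub_val_continuous.
exact: pred_int_continuous.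
Qed.

Definition sub_fun (F : fun_symb L)
    (a : {ptws 'I_(fun_arity F) -> set_type S}) : set_type S :=
  exist _ (fun_int A F (fun i => val (a i)))
    (mem_set (subS.2 F _ (fun i => set_mem (valP (a i))))).

Lemma sub_fun_continuous F : continuous (@sub_fun F).
Proof.
move=> a.
have h := @continuous_comp _ _ _ _ (fun_int A F) a
  (@sub_val_continuous _ a) (@fun_int_continuous _ _ A F _).
apply/(@metricType_numDomainType.cvgrPdist_lt R (set_type S) _ _ (nbhs_filter a)) => e e0.
by move/(@metricType_numDomainType.cvgrPdist_lt R A _ _ (nbhs_filter a)) : h; apply.
Qed.

Definition substructure : structure R L :=
  Structure sub_complete sub_pred_continuous sub_fun_continuous.

End Substructure.

Section Age.
Context {R : realType} {L : language}.
Implicit Types A B C M : structure R L.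
Implicit Types K : structure R L -> Prop.

Definition generated_structure A (A0 : set A) : structure R L :=
  substructure (generated_substructure A0).

Definition generated_incl A (A0 : set A) (a : A0) : generated_structure A0 :=
  exist _ (val a) (mem_set (@sub_gen_smallest _ _ A0 _ (set_mem (valP a)))).

Record finite_partial_iso A B := FinitePartialIso {
  fpi_dom : set A;
  fpi_map :> fpi_dom -> B;
  fpi_finite : finite_set fpi_dom;
  fpi_extends : exists2 g : generated_structure fpi_dom -> B,
    embedding g & forall a : fpi_dom, g (generated_incl a) = fpi_map a }.

Definition finitely_generated A : Prop :=
  exists A0 : set A, finite_set A0 /\ generated A0 = setT.

(* Classes of structures are bare predicates: the library's [set] lives in a
   universe too small to contain [structure R L]. *)
Definition age A : structure R L -> Prop :=
  fun B => finitely_generated B /\ embeds B A.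

(* To be used together with [separable_structure]. *)
Definition approximately_ultrahomogeneous M : Prop :=
  forall (phi : finite_partial_iso M M) (e : R), 0 < e ->
    exists2 f : M -> M, automorphism f &
      forall a : fpi_dom phi, mdist (phi a) (f (val a)) < e.

Definition K_structure K A : Prop := forall B, age A B -> K B.

Definition HP K : Prop := forall A, K A -> K_structure K A.

Definition JEP K : Prop :=
  forall A B, K A -> K B -> exists C, [/\ K C, embeds A C & embeds B C].

Definition NAP K : Prop :=
  forall A B, K A -> K B ->
  forall (f : finite_partial_iso A B) (e : R), 0 < e ->
  exists C, K C /\
  exists (g : A -> C) (h : B -> C), [/\ embedding g, embedding h &
    forall a : fpi_dom f, mdist (g (val a)) (h (f a)) <= e].

Definition Apx1 A B : set {ptws A * B -> \bar R} :=
  [set psi | exists f : finite_partial_iso A B, psi = apx_of_map f].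

Definition Apx2 K A B : set {ptws A * B -> \bar R} :=
  [set psi | exists C, K C /\
     exists (g : {ptws A * C -> \bar R}) (f : {ptws C * B -> \bar R}),
       [/\ Apx1 g, Apx1 f & psi = apx_comp f g]].

(* The closure is taken in the subspace [Apx A B] of metric approximate
   isometries. *)
Definition ApxK K A B : set {ptws A * B -> \bar R} :=
  closure (apx_up (@Apx2 K A B)) `&` @Apx R A B.

Definition Stx K A B : set {ptws A * B -> \bar R} :=
  [set psi | ApxK K psi /\ exists2 phi, ApxK K phi & Apx_lt psi phi].

Record generated_tuple K (n : nat) := GeneratedTuple {
  gt_struct : structure R L;
  gt_in : K gt_struct;
  gt_tuple : 'I_n -> gt_struct;
  gt_generates : generated (range gt_tuple) = setT }.

Definition dK K n (a b : generated_tuple K n) : \bar R :=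
  ereal_inf [set (\big[maxe/0]_(i < n) psi (gt_tuple a i, gt_tuple b i))%E
            | psi in @ApxK K (gt_struct a) (gt_struct b)].

Definition gt_pred K (P : pred_symb L)
    (a : generated_tuple K (pred_arity P)) : R :=
  pred_int (gt_struct a) P (gt_tuple a).

Definition gt_dist K (a : generated_tuple K 2) : R :=
  mdist (gt_tuple a ord0) (gt_tuple a ord_max).

Definition ext_tuple A (F : fun_symb L) m (c : 'I_(fun_arity F + m) -> A) :
    'I_(fun_arity F + m + 1) -> A :=
  fun i => match fintype.split i with
           | inl j => c j
           | inr _ => fun_int A F (fun k => c (lshift m k))
           end.

Lemma ext_tuple_generates A (F : fun_symb L) m
    (c : 'I_(fun_arity F + m) -> A) :
  generated (range c) = setT -> generated (range (ext_tuple c)) = setT.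
Proof.
move=> gc; apply/seteqP; split=> // x _.
have : generated (range c) x by rewrite gc.
apply: sub_smallest2r; first exact: generated_substructure.
move=> _ [j _ <-]; exists (lshift 1 j) => //.
by rewrite /ext_tuple (unsplitK (inl j)).
Qed.

Definition gt_ext K (F : fun_symb L) m
    (c : generated_tuple K (fun_arity F + m)%N) :
    generated_tuple K (fun_arity F + m + 1)%N :=
  GeneratedTuple (gt_in c) (ext_tuple_generates (gt_generates c)).

(* The countable dense subset is the range of a sequence with values in
   [option T], so that it may be empty. *)
Definition pdist_separable (T : Type) (d : T -> T -> \bar R) : Prop :=
  exists s : nat -> option T,
    forall x (e : R), 0 < e ->
      exists n y, s n = Some y /\ (d x y < e%:E)%E.

Definition pdist_complete (T : Type) (d : T -> T -> \bar R) : Prop :=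
  forall u : nat -> T,
    (forall e : R, 0 < e -> exists N, forall m n,
       (N <= m)%N -> (N <= n)%N -> (d (u m) (u n) < e%:E)%E) ->
    exists l, forall e : R, 0 < e -> exists N, forall n,
      (N <= n)%N -> (d (u n) l < e%:E)%E.

Definition pdist_continuous (T U : Type) (dT : T -> T -> \bar R)
    (dU : U -> U -> \bar R) (f : T -> U) : Prop :=
  forall x (e : R), 0 < e -> exists2 r : R, 0 < r &
    forall y, (dT x y < r%:E)%E -> (dU (f x) (f y) < e%:E)%E.

Definition dR (x y : R) : \bar R := `|x - y|%:E.

Definition PP K : Prop :=
  forall n, pdist_separable (@dK K n) /\ pdist_complete (@dK K n).

Definition CP K : Prop :=
  [/\ pdist_continuous (@dK K 2) dR (@gt_dist K),
      forall P, pdist_continuous (@dK K (pred_arity P)) dR (@gt_pred K P)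
    & forall F m, pdist_continuous (@dK K (fun_arity F + m)%N)
        (@dK K (fun_arity F + m + 1)%N) (@gt_ext K F m)].

Definition fraisse_class K : Prop := [/\ HP K, JEP K, NAP K, PP K & CP K].

Definition is_limit K M : Prop :=
  [/\ separable_structure M, K_structure K M &
    forall A, K_structure K A -> forall A0 : set A, finite_set A0 ->
    forall psi : {ptws A * M -> \bar R}, Stx K psi ->
    forall e : R, 0 < e ->
    exists phi : {ptws A * M -> \bar R},
      [/\ Stx K phi, Apx_lt psi phi & r_total e A0 phi]].

End Age.

(* Main.v *)
Require Import Defs.
From HB Require Import structures.
From mathcomp Require Import all_boot all_order all_algebra.
From mathcomp Require Import all_classical all_reals all_analysis.
From mathcomp Require Import lra zify.

(** Why the theorem is true.

The proof works with types of tuples.  [teq a b] says that two tuples give the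
same values to all distances and predicates of terms.  The values of the terms
at a tuple are dense in the structure that it generates, so tuples of the same
type are carried to each other by embeddings ([embedding_extend]), and finite
partial isomorphisms are the same thing as pairs of finite tuples of the same
type.  Unlike a partial isomorphism, a type passes to pointwise limits ([teq_limit]),
so a construction that corrects errors infinitely often still has a limit.

[near K r a b] says that the types of [a] and [b] are realized within [r] of
each other in a member of [K].  NAP makes this relation satisfy the triangle
inequality ([near_triangle]) and lets a witness of it be glued to any other
tuple ([near_amalgam]).  Approximate isomorphisms enter only through two facts.
Restricted to finite sets, each of them is witnessed up to [e] by embeddings
into a member of [K] ([ApxK_joint_embedding]); conversely such embeddings give
an element of [Apx2] ([Apx2_tuple]).  It follows that [near] is [dK < r].

The centre of the proof is the extension property of a structure [M]: if [a]
and a tuple [b] of [M] have the same type and [a, c] is a longer tuple, then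
[M] contains a tuple of the type of [a, c] whose first part is as close to [b]
as desired.  An approximately ultra-homogeneous structure into which the
members of [K] embed has it ([ultrahomogeneous_extension]).  Conversely, the
extension property gives all that is claimed about [M]: separability and
completeness of [dK] and the continuity of the symbols ([extension_PP],
[extension_CP]), the limit property ([extension_property_limit]), universality
and, by going back and forth, uniqueness and approximate ultra-homogeneity
([universality], [approximate_isomorphism], [extension_ultrahomogeneous]).

There remains to build, from a Fraisse class, a separable [K]-structure with the
extension property.  A sequence of points is generated in a chain of members of
[K].  At each stage a block is appended to it that realizes, together with an
initial segment, one of countably many types that are dense for [dK].  The
terms in this sequence form a structure without topology, which is then
completed.  The symbols are only continuous, so their extension to the
completion needs an argument: by PP every tuple of the completion has a limit
type in [K], and by CP the symbols are uniformly continuous around the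
realizations of a given type ([uc_fun]).  In the completion the sequence is
dense, and the blocks realize all types over its initial segments approximately
([generic_sequence]); correcting the errors infinitely often yields the
extension property ([generic_extension_property]). *)

Set Implicit Arguments.
Unset Strict Implicit.
Unset Printing Implicit Defensive.

Import Order.TTheory GRing.Theory Num.Theory.
Import numFieldNormedType.Exports.

Local Open Scope classical_set_scope.
Local Open Scope ring_scope.

(** * Metric spaces and finite tuples *)

Lemma lt_minl (R : realType) (x a b : R) : x < Num.min a b -> x < a.
Proof. by rewrite lt_min => /andP[]. Qed.

Lemma lt_minr (R : realType) (x a b : R) : x < Num.min a b -> x < b.
Proof. by rewrite lt_min => /andP[]. Qed.

Section MetricTuples.
Context {R : realType}.
Implicit Types X Y : metricType R.

Definition box_continuous n X Y (f : ('I_n -> X) -> Y) : Prop :=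
  forall a (e : R), 0 < e -> exists2 d : R, 0 < d &
    forall b, (forall j, mdist (a j) (b j) < d) -> mdist (f a) (f b) < e.

(** Boxes around a tuple form a filter that converges to the tuple coordinate by
coordinate, hence is finer than the neighbourhoods in the product topology;
the arity being finite, boxes are themselves neighbourhoods. *)
Lemma box_continuousP n X Y (f : {ptws 'I_n -> X} -> Y) :
  continuous f <-> box_continuous f.
Proof.
split=> [cf|bf a].
- move=> a0 e e0; pose a : {ptws 'I_n -> X} := a0; rewrite -/a.
  pose G : set_system {ptws 'I_n -> X} := filter_from [set d : R | 0 < d]
    (fun d => [set b | forall j, mdist (a j) (b j) < d]).
  have FG : Filter G.
    apply: filter_from_filter; first by exists 1 => /=.
    move=> d1 d2 /= d10 d20; exists (Num.min d1 d2); first by rewrite lt_min d10.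
    by move=> b /= bd; split=> j; have := bd j; rewrite lt_min => /andP[].
  have Ga : G --> (a : {ptws 'I_n -> X}).
    apply/ptws_cvgP => j.
    apply/metricType_numDomainType.cvgrPdist_lt => d d0.
    by exists d => //= b; apply.
  have fG : f @ G --> f a by apply: cvg_trans (cvg_app f Ga) (cf a).
  have [d d0 db] := (metricType_numDomainType.cvgrPdist_lt f (f a)).1 fG e e0.
  by exists d.
- apply/(@metricType_numDomainType.cvgrPdist_lt R Y _ _ (nbhs_filter a)) => e e0.
  have [d d0 db] := bf a e e0.
  have : \forall b \near a, forall j : 'I_n, mdist (a j) (b j) < d.
    apply: (@filter_forall _ _ _ _ (nbhs_filter a)) => j.
    have /(ptws_cvgP _ (nbhs_filter a))/(_ j) aj : nbhs a --> a by apply: cvg_id.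
    exact: ((@metricType_numDomainType.cvgrPdist_lt R X _ _ (nbhs_filter a) _ _).1 aj).
  by apply: (@filterS _ _ (nbhs_filter a)) => b /db.
Qed.


Lemma complete_cauchy X (u : nat -> X) : complete_metric X ->
  (forall e : R, 0 < e -> exists N, forall m n, (N <= m)%N -> (N <= n)%N ->
     mdist (u m) (u n) < e) ->
  exists l, forall e : R, 0 < e -> exists N, forall n, (N <= n)%N ->
     mdist (u n) l < e.
Proof.
move=> cX cu; have /cX [l ul] : cauchy (u @ \oo).
  apply/cauchyP => e e0; have [N uN] := cu e e0; exists (u N); exists N => //.
  by move=> n /= Nn; rewrite ballEmdist/=; exact: uN.
exists l => e e0.
have [N _ uN] := (metricType_numDomainType.cvgrPdist_lt u l).1 ul e e0.
by exists N => n Nn; rewrite metric_sym; exact: uN.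
Qed.

Lemma half_expr_lt (e : R) : 0 < e -> exists k, 2^-1 ^+ k < e.
Proof.
move=> e0; have h : `|2^-1 : R| < 1.
  by rewrite ger0_norm ?invr_ge0// invf_lt1 ?ltr1n.
have [N _ hN] := (cvgrPdist_lt _ _).1 (cvg_expr h) e e0.
exists N; have := hN N (leqnn N); by rewrite /= sub0r normrN ger0_norm.
Qed.

Lemma half_expr_gt0 k : 0 < 2^-1 ^+ k :> R.
Proof. by rewrite exprn_gt0 ?invr_gt0. Qed.

Lemma complete_geometric X (u : nat -> X) (c : R) : complete_metric X -> 0 <= c ->
  (forall k, mdist (u k) (u k.+1) <= c * 2^-1 ^+ k) ->
  exists l, forall k, mdist (u k) l <= 2 * c * 2^-1 ^+ k.
Proof.
move=> cX c0 cu.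
have h k j : mdist (u k) (u (k + j)%N) <= 2 * c * 2^-1 ^+ k - 2 * c * 2^-1 ^+ (k + j).
  elim: j => [|j IH]; first by rewrite addn0 mdistxx subrr.
  apply: le_trans (metric_triangle _ (u (k + j)%N) _) _.
  have := cu (k + j)%N; rewrite addnS exprS (mulrC 2 c) -!mulrA mulVKf ?pnatr_eq0//.
  move: IH; rewrite (mulrC 2 c) -!mulrA.
  set x := _ ^+ k; set y := _ ^+ _; move=> IH. rewrite -/y. lra.
have hle k j : (k <= j)%N -> mdist (u k) (u j) <= 2 * c * 2^-1 ^+ k.
  move=> kj; rewrite -(subnKC kj); apply: le_trans (h _ _) _.
  by rewrite lerBlDr lerDl !mulr_ge0// ltW// half_expr_gt0.
have [|l hl] := complete_cauchy cX (u := u).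
  move=> e e0; have [k ke] : exists k, 2^-1 ^+ k < e / (4 * (c + 1)).
    by apply: half_expr_lt; rewrite divr_gt0//; lra.
  have {}ke : c * 2^-1 ^+ k < e / 4.
    rewrite invfM mulrA ltr_pdivlMr in ke; last by lra.
    by apply: le_lt_trans ke; rewrite mulrC ler_wpM2l ?lerDl// ltW// half_expr_gt0.
  exists k => m n km kn; apply: le_lt_trans (metric_triangle _ (u k) _) _.
  rewrite metric_sym; have := hle _ _ km; have := hle _ _ kn.
  rewrite -!mulrA; move: (c * _) ke => z; lra.
exists l => k; apply/ler_addgt0Pr => e e0; have [N hN] := hl e e0.
apply: le_trans (metric_triangle _ (u (maxn k N)) _) _.
by apply: lerD; [apply: hle; exact: leq_maxl|apply/ltW/hN/leq_maxr].
Qed.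

Lemma separable_dense_seq X : separable_space X -> X ->
  exists s : nat -> X, forall x (e : R), 0 < e -> exists n, mdist x (s n) < e.
Proof.
move=> [S [cS dS]] x0.
have S0 : S !=set0.
  by have [||x []] := dS setT; [exists x0|exact: openT|exists x].
have [s sS] : exists s : nat -> X, forall x, S x -> exists n, s n = x.
  have /countable_injP [f finj] := cS.
  have [x1 Sx1] := S0.
  pose s n := if pselect (exists x, S x /\ f x = n) is left h then projT1 (cid h) else x1.
  exists s => x Sx; exists (f x); rewrite /s; case: pselect => [h|]; last by case; exists x.
  by case: (cid h) => y /= [Sy fy]; apply: finj => //; exact: mem_set.
exists s => x e e0.
have [y [xy Sy]] : ((ball x e)° `&` S) !=set0.
  apply: dS; last exact: open_interior.
  by exists x; exact: (nbhsx_ballx x e e0).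
have [n sn] := sS y Sy; exists n; rewrite sn.
by have := interior_subset xy; rewrite ballEmdist.
Qed.

Lemma dense_seq_separable X (s : nat -> X) :
  (forall x (e : R), 0 < e -> exists n, mdist x (s n) < e) -> separable_space X.
Proof.
move=> ds; exists (range s); split; first exact: card_image_le.
move=> O [x Ox] oO; have : nbhs x O by apply: open_nbhs_nbhs.
rewrite -metricType_numDomainType.filter_from_mdist_nbhs => -[e /= e0 eO].
by have [n xn] := ds x e e0; exists (s n); split; [exact: eO|exists n].
Qed.

End MetricTuples.

(** * Extension by density, and completion *)

Section Extension.
Context {R : realType}.
Implicit Types X Y : metricType R.

Definition dense_map (T : Type) X (i : T -> X) : Prop :=
  forall x (e : R), 0 < e -> exists t, mdist x (i t) < e.

Lemma box_continuous_eq n (T : Type) X Y (i : T -> X) (f g : ('I_n -> X) -> Y) :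
  dense_map i -> box_continuous f -> box_continuous g ->
  (forall t : 'I_n -> T, f (fun j => i (t j)) = g (fun j => i (t j))) -> f =1 g.
Proof.
move=> di cf cg fg c; apply: mdist_positivity; apply/le_anti; rewrite mdist_ge0 andbT.
apply/ler_addgt0Pr => e e0.
have e2 : 0 < e / 2 by lra.
have [d1 d10 h1] := cf c _ e2; have [d2 d20 h2] := cg c _ e2.
have d0 : 0 < Num.min d1 d2 by rewrite lt_min d10.
have [t ht] := choice (fun j => di (c j) _ d0).
have /= {}h1 := h1 (fun j => i (t j)) (fun j => lt_minl (ht j)).
have /= {}h2 := h2 (fun j => i (t j)) (fun j => lt_minr (ht j)).
have := metric_triangle (f c) (f (fun j => i (t j))) (g c).
rewrite fg in h1 *; have := metric_sym (g c) (g (fun j => i (t j))); lra.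
Qed.

(** The hypothesis on [h] is weaker than uniform continuity: for each point [c]
of the larger space, [h] varies little on the tuples that are close enough to
[c].  The value at [c] is then the limit of [h] along any approximation. *)
Lemma extend_continuous n (T : Type) X Y (i : T -> X) (h : ('I_n -> T) -> Y) :
  complete_metric Y -> dense_map i ->
  (forall (c : 'I_n -> X) (e : R), 0 < e -> exists2 d : R, 0 < d &
     forall s t, (forall j, mdist (c j) (i (s j)) < d) ->
       (forall j, mdist (c j) (i (t j)) < d) -> mdist (h s) (h t) < e) ->
  exists f : ('I_n -> X) -> Y, box_continuous f /\
    forall t, f (fun j => i (t j)) = h t.
Proof.
move=> cY di ch.
have [app happ] : exists app : X -> nat -> T,
    forall x k, mdist x (i (app x k)) < 2^-1 ^+ k.
  have [app happ] := choice (fun p : X * nat => di p.1 _ (half_expr_gt0 p.2)).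
  by exists (fun x k => app (x, k)) => x k; exact: (happ (x, k)).
have /choice[f hf] (c : 'I_n -> X) : exists y : Y, forall e : R, 0 < e ->
    exists2 d : R, 0 < d &
      forall t, (forall j, mdist (c j) (i (t j)) < d) -> mdist (h t) y < e.
  pose u k := h (fun j => app (c j) k).
  have near_u (d : R) : 0 < d -> exists N, forall k, (N <= k)%N -> forall j,
      mdist (c j) (i (app (c j) k)) < d.
    move=> d0; have [N hN] := half_expr_lt d0; exists N => k Nk j.
    apply: lt_le_trans (happ _ _) _; apply: le_trans (ltW hN).
    by apply: ler_wiXn2l => //; lra.
  have [|l hl] := complete_cauchy cY (u := u).
    move=> e e0; have [d d0 hd] := ch c e e0; have [N hN] := near_u d d0.
    by exists N => m k Nm Nk; apply: hd; exact: hN.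
  exists l => e e0; have e2 : 0 < e / 2 by lra.
  have [d d0 hd] := ch c _ e2; exists d => // t ht.
  have [N1 hN1] := near_u d d0; have [N2 hN2] := hl _ e2.
  have := metric_triangle (h t) (u (maxn N1 N2)) l.
  have := hN2 _ (leq_maxr N1 N2).
  have := hd t (fun j => app (c j) (maxn N1 N2)) ht (hN1 _ (leq_maxl N1 N2)).
  rewrite -/(u _); lra.
exists f; split.
  move=> c e e0; have e2 : 0 < e / 2 by lra.
  have [d d0 hd] := hf c _ e2; have d2 : 0 < d / 2 by lra.
  exists (d / 2) => // c' cc'; have [d' d'0 hd'] := hf c' _ e2.
  have m0 : 0 < Num.min d' (d / 2) by rewrite lt_min d'0.
  have [t ht] := choice (fun j => di (c' j) _ m0).
  have h1 : mdist (h t) (f c') < e / 2.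
    by apply: hd' => j; have := ht j; rewrite lt_min => /andP[].
  have h2 : mdist (h t) (f c) < e / 2.
    apply: hd => j; have := ht j; rewrite lt_min => /andP[_].
    have := metric_triangle (c j) (c' j) (i (t j)); have := cc' j; lra.
  have := metric_triangle (f c) (h t) (f c').
  have := metric_sym (f c) (h t); lra.
move=> t; apply/esym/mdist_positivity; apply/le_anti; rewrite mdist_ge0 andbT.
apply/ler_addgt0Pr => e e0; have [d d0 hd] := hf (fun j => i (t j)) e e0.
by rewrite add0r ltW//; apply: hd => j; rewrite mdistxx.
Qed.

End Extension.

Section Completion.
Context {R : realType} {T : Type} (D : T -> T -> R).
Hypotheses (Dxx : forall x, D x x = 0) (Dsym : forall x y, D x y = D y x)
  (Dtri : forall y x z, D x z <= D x y + D y z).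

(** A point is encoded, as in the Kuratowski embedding, by its distances to the
elements of [T]; the completion is the uniform closure of these functions.
Elements of [T] at distance zero give the same function, so this also takes the
metric quotient. *)
Record completion := Completion {
  kur :> T -> R;
  kurP : forall e : R, 0 < e -> exists t, forall s, `|kur s - D t s| <= e }.

HB.instance Definition _ := gen_eqMixin completion.
HB.instance Definition _ := gen_choiceMixin completion.

Lemma kur_inj (p q : completion) : kur p =1 kur q -> p = q.
Proof.
case: p q => p hp [q hq] /= /funext pq; subst q; congr Completion.
exact: Prop_irrelevance.
Qed.

Let cdist (p q : completion) : R := sup (range (fun s => `|p s - q s|)).

Let cdist_ub (p q : completion) : has_ubound (range (fun s => `|p s - q s|)).
Proof.
have [t1 h1] := kurP p ltr01; have [t2 h2] := kurP q ltr01.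
exists (2 + D t1 t2) => _ [s _ <-].
have := h1 s; have := h2 s.
have h : `|D t1 s - D t2 s| <= D t1 t2.
  rewrite ler_norml; have := Dtri t2 t1 s; have := Dtri t1 t2 s.
  rewrite (Dsym t2 t1); lra.
move: h; rewrite !ler_norml; lra.
Qed.

Let cdist_ge (p q : completion) s : `|p s - q s| <= cdist p q.
Proof. by apply: ub_le_sup; [exact: cdist_ub|exists s]. Qed.

Let cdist_le (p q : completion) (e : R) :
  (forall s, `|p s - q s| <= e) -> cdist p q <= e.
Proof.
move=> h; have [t _] := kurP p ltr01; apply: ge_sup.
  by exists `|p t - q t|, t.
by move=> _ [s _ <-].
Qed.

Let cdistxx p : cdist p p = 0.
Proof.
apply/le_anti/andP; split; first by apply: cdist_le => s; rewrite subrr normr0.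
have [t _] := kurP p ltr01; exact: le_trans (cdist_ge p p t).
Qed.

Let cdist_pos p q : cdist p q = 0 -> p = q.
Proof.
move=> pq; apply: kur_inj => s; apply/eqP; rewrite -subr_eq0 -normr_le0 -pq.
exact: cdist_ge.
Qed.

Let cdist_sym p q : cdist p q = cdist q p.
Proof. by apply/le_anti/andP; split; apply: cdist_le => s; rewrite distrC. Qed.

Let cdist_tri q p r : cdist p r <= cdist p q + cdist q r.
Proof.
apply: cdist_le => s; apply: le_trans (ler_distD (q s) _ _) _.
by apply: lerD; exact: cdist_ge.
Qed.

HB.instance Definition _ :=
  isMetric.Build R completion cdistxx cdist_pos cdist_sym cdist_tri.

Lemma cmdist_ge (p q : completion) s : `|p s - q s| <= mdist p q.
Proof. exact: cdist_ge. Qed.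

Lemma cmdist_le (p q : completion) (e : R) :
  (forall s, `|p s - q s| <= e) -> mdist p q <= e.
Proof. exact: cdist_le. Qed.

Definition to_completion (t : T) : completion.
Proof.
by exists (D t) => e e0; exists t => s; rewrite subrr normr0 ltW.
Defined.

Lemma to_completion_dist s t :
  mdist (to_completion s) (to_completion t) = D s t.
Proof.
apply/le_anti/andP; split.
  apply: cmdist_le => r /=; rewrite ler_norml.
  have := Dtri t s r; have := Dtri s t r; rewrite (Dsym t s); lra.
have := cmdist_ge (to_completion s) (to_completion t) t.
by rewrite /= Dxx subr0; exact: le_trans (ler_norm _).
Qed.

Lemma to_completion_dense : dense_map to_completion.
Proof.
move=> p e e0; have [|t ht] := kurP p (e := e / 2); first by lra.
exists t; apply: (@le_lt_trans _ _ (e / 2)); last by lra.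
exact: cmdist_le.
Qed.

Lemma completion_complete : complete_metric completion.
Proof.
move=> u /cauchyP cu.
have cu' (e : R) : 0 < e -> exists N, forall m n, (N <= m)%N -> (N <= n)%N ->
    forall s, `|u m s - u n s| <= e.
  move=> e0; have [|x [N _ hN]] := cu (e / 2); first by lra.
  exists N => m n Nm Nn s; have := hN m Nm; have := hN n Nn.
  rewrite /= !ballEmdist /= => h1 h2.
  have := cmdist_ge x (u n) s; have := cmdist_ge x (u m) s.
  have := ler_distD (x s) (u m s) (u n s); rewrite (distrC (u m s) (x s)); lra.
have /choice[l hl] (s : T) : exists y : R, forall e : R, 0 < e ->
    exists N, forall n, (N <= n)%N -> `|u n s - y| < e.
  have cs : cauchy ((fun n => u n s : R) @ \oo).
    apply/cauchyP => e e0; have [|N hN] := cu' (e / 2); first by lra.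
    exists (u N s); exists N => // n /= Nn; rewrite /ball /=.
    have := hN N n (leqnn N) Nn s; lra.
  have cl := R_complete (fmap_proper_filter _ eventually_filter) cs; exists (lim ((fun n => u n s : R) @ \oo)) => e e0.
  have [N _ hN] := (cvgrPdist_lt _ _).1 cl e e0; exists N => n Nn.
  by rewrite distrC; exact: hN.
have hl' (e : R) : 0 < e -> exists N, forall n, (N <= n)%N -> forall s, `|u n s - l s| <= e.
  move=> e0; have [N hN] := cu' e e0; exists N => n Nn s.
  apply/ler_addgt0Pr => e' e'0; have [N' hN'] := hl s e' e'0.
  have := hN n (maxn N N') Nn (leq_maxl _ _) s.
  have := hN' _ (leq_maxr N N').
  have := ler_distD (u (maxn N N') s) (u n s) (l s); lra.
have lP (e : R) : 0 < e -> exists t, forall s, `|l s - D t s| <= e.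
  move=> e0; have e2 : 0 < e / 2 by lra.
  have [N hN] := hl' _ e2; have [t ht] := kurP (u N) e2; exists t => s.
  have := hN N (leqnn N) s; have := ht s.
  have := ler_distD (u N s) (l s) (D t s); have := distrC (l s) (u N s); lra.
exists (Completion lP).
apply/metricType_numDomainType.cvgrPdist_lt => e e0.
have [|N hN] := hl' (e / 2); first by lra.
exists N => // n /= Nn; apply: (@le_lt_trans _ _ (e / 2)); last by lra.
by apply: cmdist_le => s; rewrite distrC; exact: hN.
Qed.

Lemma exists_completion : exists (X : metricType R) (i : T -> X),
  [/\ complete_metric X, forall s t, mdist (i s) (i t) = D s t & dense_map i].
Proof.
exists completion, to_completion; split.
- exact: completion_complete.
- exact: to_completion_dist.
- exact: to_completion_dense.
Qed.

End Completion.

(** * Terms and types of tuples *)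

Section Terms.
Context {R : realType} {L : language}.

(** A structure without topology.  Structures are instances by [pre]; the other
one is the algebra of terms in [chain_limit], on which the distance is only a
pseudo-distance before it is completed. *)
Record prestructure := PreStructure {
  pcar :> Type;
  pdist : pcar -> pcar -> R;
  ppred : forall P : pred_symb L, ('I_(pred_arity P) -> pcar) -> R;
  pfun : forall F : fun_symb L, ('I_(fun_arity F) -> pcar) -> pcar }.

Definition pre (A : structure R L) : prestructure :=
  @PreStructure A (fun x y => mdist x y) (pred_int A) (fun_int A).
Canonical pre.

Implicit Types T U V : prestructure.

Inductive term (I : Type) : Type :=
| Var of I
| App (F : fun_symb L) of 'I_(fun_arity F) -> term I.

Fixpoint teval T (I : Type) (a : I -> T) (t : term I) : T :=
  match t with
  | Var i => a i
  | App F ts => @pfun T F (fun j => teval a (ts j))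
  end.

Fixpoint tsubst (I J : Type) (f : I -> term J) (t : term I) : term J :=
  match t with
  | Var i => f i
  | App F ts => App (fun j => tsubst f (ts j))
  end.

Lemma teval_tsubst T (I J : Type) (a : J -> T) (f : I -> term J) t :
  teval a (tsubst f t) = teval (fun i => teval a (f i)) t.
Proof. by elim: t => //= F ts IH; congr pfun; apply/funext => j. Qed.

(** Equality of quantifier-free types; the index type is infinite for the
sequences of the back-and-forth and chain constructions. *)
Definition teq T U (I : Type) (a : I -> T) (b : I -> U) : Prop :=
  (forall s t, pdist (teval a s) (teval a t) = pdist (teval b s) (teval b t)) /\
  (forall P (ts : 'I_(pred_arity P) -> term I),
     @ppred T P (fun j => teval a (ts j)) = @ppred U P (fun j => teval b (ts j))).

Lemma teq_refl T (I : Type) (a : I -> T) : teq a a.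
Proof. by []. Qed.

Lemma teq_sym T U (I : Type) (a : I -> T) (b : I -> U) : teq a b -> teq b a.
Proof. by move=> [h1 h2]; split=> *; rewrite ?h1 ?h2. Qed.

Lemma teq_trans U T V (I : Type) (a : I -> T) (b : I -> U) (c : I -> V) :
  teq a b -> teq b c -> teq a c.
Proof. by move=> [h1 h2] [h3 h4]; split=> *; rewrite ?h1 ?h2. Qed.

Lemma teq_terms T U (I J : Type) (a : I -> T) (b : I -> U) (f : J -> term I) :
  teq a b -> teq (fun j => teval a (f j)) (fun j => teval b (f j)).
Proof.
move=> [h1 h2]; split=> [s t|P ts]; first by rewrite -!teval_tsubst h1.
have := h2 P (fun j => tsubst f (ts j)).
by under eq_fun do rewrite teval_tsubst; under [in RHS]eq_fun do rewrite teval_tsubst.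
Qed.

Lemma teq_reindex T U (I J : Type) (a : I -> T) (b : I -> U) (f : J -> I) :
  teq a b -> teq (fun j => a (f j)) (fun j => b (f j)).
Proof. exact: (teq_terms (fun j => Var (f j))). Qed.

Lemma teq_dist T U (I : Type) (a : I -> T) (b : I -> U) i j :
  teq a b -> pdist (a i) (a j) = pdist (b i) (b j).
Proof. by move=> [/(_ (Var i) (Var j))]. Qed.

Record pembedding T U (f : T -> U) : Prop := PEmbedding {
  pembedding_dist : forall x y, pdist (f x) (f y) = pdist x y;
  pembedding_pred : forall P (a : 'I_(pred_arity P) -> T),
    @ppred U P (fun i => f (a i)) = @ppred T P a;
  pembedding_fun : forall F (a : 'I_(fun_arity F) -> T),
    @pfun U F (fun i => f (a i)) = f (@pfun T F a) }.

Lemma teval_pembedding T U (f : T -> U) (I : Type) (a : I -> T) t :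
  pembedding f -> teval (fun i => f (a i)) t = f (teval a t).
Proof.
move=> ef; elim: t => //= F ts IH.
rewrite -(pembedding_fun ef); congr pfun; exact/funext.
Qed.

Lemma teq_pembedding T U (f : T -> U) (I : Type) (a : I -> T) :
  pembedding f -> teq (fun i => f (a i)) a.
Proof.
move=> ef; split=> [s t|P ts].
  by rewrite !(teval_pembedding _ _ ef) pembedding_dist.
rewrite -(pembedding_pred ef); congr ppred; apply/funext => j.
exact: teval_pembedding.
Qed.

Implicit Types A B C M N : structure R L.

Lemma embeddingP A B (f : A -> B) :
  embedding f <-> @pembedding (pre A) (pre B) f.
Proof. by split=> -[h1 h2 h3]; split. Qed.

Lemma teq_embedding A B (f : A -> B) (I : Type) (a : I -> A) :
  embedding f -> teq (fun i => f (a i)) a.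
Proof. by move=> /embeddingP; exact: (@teq_pembedding (pre A) (pre B)). Qed.

Lemma fun_box A (F : fun_symb L) : box_continuous (@pfun (pre A) F).
Proof. exact/box_continuousP/fun_int_continuous. Qed.

Lemma pred_box A (P : pred_symb L) :
  @box_continuous R _ A R^o (@ppred (pre A) P).
Proof. exact/box_continuousP/pred_int_continuous. Qed.

Definition tdense A (I : Type) (a : I -> A) : Prop :=
  dense_map (teval (T := pre A) a).

Lemma mdistRE (x y : R) : @mdist R R^o x y = `|x - y|.
Proof. by rewrite distrC. Qed.

Lemma isometry_box A B (f : A -> B) n (Y : metricType R) (g : ('I_n -> B) -> Y) :
  (forall x y, mdist (f x) (f y) = mdist x y) ->
  box_continuous g ->
  box_continuous (fun a : 'I_n -> A => g (fun j => f (a j))).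
Proof.
move=> df ch a e e0; have [d d0 hd] := ch (fun j => f (a j)) e e0.
by exists d => // b ab; apply: hd => j; rewrite df.
Qed.

(** Sending the value of a term at [a] to its value at [b] is a well-defined
isometry because of [teq], and its domain is dense.  It extends to [A] by
completeness of [B]; the extension commutes with the symbols because both sides
are continuous and agree on values of terms. *)
Lemma embedding_extend A B (I : Type) (a : I -> A) (b : I -> B) :
  teq a b -> tdense a -> exists2 f : A -> B, embedding f & forall i, f (a i) = b i.
Proof.
move=> ab da.
have [|f1 [cf1 hf1]] := @extend_continuous R 1 (term I) A B (teval (T := pre A) a)
    (fun t => teval (T := pre B) b (t ord0)) (@carrier_complete _ _ B) da.
  move=> c e e0; exists (e / 2); first by lra.
  move=> s t cs ct; have /= <- := ab.1 (s ord0) (t ord0).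
  have := metric_triangle (teval (T := pre A) a (s ord0)) (c ord0) (teval (T := pre A) a (t ord0)).
  have := cs ord0; have := ct ord0; have := metric_sym (teval (T := pre A) a (s ord0)) (c ord0); lra.
pose f x := f1 (fun=> x).
have fE t : f (teval (T := pre A) a t) = teval (T := pre B) b t by exact: (hf1 (fun=> t)).
have cf (x : A) (e : R) : 0 < e -> exists2 d : R, 0 < d & forall y, mdist x y < d -> mdist (f x) (f y) < e.
  move=> e0; have [d d0 hd] := cf1 (fun=> x) e e0; exists d => // y xy.
  exact: hd.
have df x y : mdist (f x) (f y) = mdist x y.
  have h (e : R) : 0 < e -> `|mdist (f x) (f y) - mdist x y| <= e.
    move=> e0; have e4 : 0 < e / 4 by lra.
    have [d1 d10 h1] := cf x _ e4; have [d2 d20 h2] := cf y _ e4.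
    have [|s hs] := da x (Num.min d1 (e / 4)); first by rewrite lt_min d10.
    have [|t ht] := da y (Num.min d2 (e / 4)); first by rewrite lt_min d20.
    have := h1 _ (lt_minl hs); have := h2 _ (lt_minl ht).
    have := lt_minr hs; have := lt_minr ht; rewrite !fE; have /= := ab.1 s t.
    move: (teval _ s) (teval _ t) (teval _ s) (teval _ t) => /= v1 v2 u1 u2 uv.
    have := metric_triangle u1 x u2; have := metric_triangle x y u2.
    have := metric_triangle x u1 y; have := metric_triangle u1 u2 y.
    have := metric_triangle v1 (f x) v2; have := metric_triangle (f x) (f y) v2.
    have := metric_triangle (f x) v1 (f y); have := metric_triangle v1 v2 (f y).
    have := metric_sym x u1; have := metric_sym y u2; have := metric_sym (f x) v1.
    have := metric_sym (f y) v2; rewrite ler_norml; lra.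
  apply/eqP; rewrite -subr_eq0 -normr_le0; apply/ler_addgt0Pr => e e0.
  by rewrite add0r h.
exists f; last by move=> i; exact: (fE (Var i)).
split=> //.
- move=> P; apply: (@box_continuous_eq R _ _ A R^o _
    (fun c => ppred (fun j => f (c j))) (@ppred (pre A) P) da).
  + exact: (isometry_box df (@pred_box B P)).
  + exact: (@pred_box A P).
  + by move=> ts /=; under eq_fun do rewrite fE; exact/esym/ab.2.
- move=> F; apply: (@box_continuous_eq R _ _ A B _
    (fun c => pfun (fun j => f (c j))) (fun c => f (@pfun (pre A) F c)) da).
  + exact: (isometry_box df (@fun_box B F)).
  + move=> c e e0; have [d d0 hd] := @fun_box A F c e e0.
    by exists d => // c' cc'; rewrite df; exact: hd.
  + by move=> ts /=; under eq_fun do rewrite fE; exact/esym/(fE (App ts)).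
Qed.

End Terms.

(** * Limits of types, generation, finite partial isomorphisms *)

Section Limits.
Context {R : realType} {L : language}.
Implicit Types A B C : structure R L.

Definition tends_to (X : metricType R) (u : nat -> X) (l : X) : Prop :=
  forall e : R, 0 < e -> exists N, forall n, (N <= n)%N -> mdist (u n) l < e.

Lemma tends_to_all (X : metricType R) m (u : nat -> 'I_m -> X) (l : 'I_m -> X) :
  (forall j, tends_to (fun n => u n j) (l j)) ->
  forall e : R, 0 < e -> exists N, forall n, (N <= n)%N ->
    forall j, mdist (l j) (u n j) < e.
Proof.
move=> ul e e0; have [N hN] := choice (fun j => ul j e e0).
exists (\max_j N j)%N => n Nn j; rewrite metric_sym; apply: hN.
exact: leq_trans (leq_bigmax j) Nn.
Qed.

Lemma tends_to_box (X Y : metricType R) m (f : ('I_m -> X) -> Y)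
    (u : nat -> 'I_m -> X) (l : 'I_m -> X) : box_continuous f ->
  (forall j, tends_to (fun n => u n j) (l j)) ->
  tends_to (fun n => f (u n)) (f l).
Proof.
move=> cf ul e e0; have [d d0 hd] := cf l e e0.
have [N hN] := tends_to_all ul d0; exists N => n Nn.
by rewrite metric_sym; apply: hd; exact: hN.
Qed.

Lemma tends_to_unique (X : metricType R) (u : nat -> X) (l l' : X) :
  tends_to u l -> tends_to u l' -> l = l'.
Proof.
move=> h h'; apply: mdist_positivity; apply/le_anti; rewrite mdist_ge0 andbT.
apply/ler_addgt0Pr => e e0; have e2 : 0 < e / 2 by lra.
have [N hN] := h _ e2; have [N' hN'] := h' _ e2.
have := hN _ (leq_maxl N N'); have := hN' _ (leq_maxr N N').
have := metric_triangle l (u (maxn N N')) l'.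
have := metric_sym l (u (maxn N N')); lra.
Qed.

Lemma tends_to_dist (X : metricType R) (u v : nat -> X) (l k : X) :
  tends_to u l -> tends_to v k ->
  @tends_to R^o (fun n => mdist (u n) (v n)) (mdist l k).
Proof.
move=> ul vk e e0; have e2 : 0 < e / 2 by lra.
have [N hN] := ul _ e2; have [N' hN'] := vk _ e2.
exists (maxn N N') => n; rewrite geq_max => /andP[/hN h1 /hN' h2].
rewrite mdistRE ltr_norml.
have := metric_triangle (u n) l (v n); have := metric_triangle l k (v n).
have := metric_triangle l (u n) k; have := metric_triangle (u n) (v n) k.
have := metric_sym l (u n); have := metric_sym k (v n); lra.
Qed.

Lemma tends_to_eval A (I : Type) (u : nat -> I -> A) (a : I -> A) (t : term I) :
  (forall i, tends_to (fun n => u n i) (a i)) ->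
  tends_to (fun n => teval (T := pre A) (u n) t) (teval (T := pre A) a t).
Proof.
move=> ua; elim: t => [i|F ts IH] /=; first exact: ua.
exact: (tends_to_box (@fun_box _ _ A F) IH).
Qed.

(** Values of terms depend continuously on the tuple, whence types are closed
under pointwise limits. *)
Lemma teq_limit A B (I : Type) (u : nat -> I -> A) (v : nat -> I -> B) a b :
  (forall i, tends_to (fun n => u n i) (a i)) ->
  (forall i, tends_to (fun n => v n i) (b i)) ->
  (forall n, teq (u n) (v n)) -> teq a b.
Proof.
move=> ua vb uv; split=> [s t|P ts].
- have h := tends_to_dist (tends_to_eval s ua) (tends_to_eval t ua).
  apply: (tends_to_unique h).
  have := tends_to_dist (tends_to_eval s vb) (tends_to_eval t vb).
  by congr tends_to; apply/funext => n; exact/esym/(uv n).1.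
- have h := tends_to_box (@pred_box _ _ A P) (fun j => tends_to_eval (ts j) ua).
  apply: (tends_to_unique h).
  have := tends_to_box (@pred_box _ _ B P) (fun j => tends_to_eval (ts j) vb).
  by congr tends_to; apply/funext => n; exact/esym/(uv n).2.
Qed.

Lemma closed_near (X : metricType R) (S : set X) x : closed S ->
  (forall e : R, 0 < e -> exists2 y, S y & mdist x y < e) -> S x.
Proof.
move=> cS h; apply: cS => U.
rewrite -metricType_numDomainType.filter_from_mdist_nbhs => -[e /= e0 eU].
by have [y Sy xy] := h e e0; exists y; split => //; exact: eU.
Qed.

Lemma near_closed (X : metricType R) (S : set X) :
  (forall x, (forall e : R, 0 < e -> exists2 y, S y & mdist x y < e) -> S x) ->
  closed S.
Proof.
move=> h x cx; apply: h => e e0.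
by have [y [Sy]] := cx _ (nbhsx_ballx x e e0); rewrite ballEmdist => xy; exists y.
Qed.

(** The points approximated by values of terms, which contain the substructure
generated by [a]: they are closed under the function symbols because these are
continuous. *)
Lemma near_terms_substructure A (I : Type) (a : I -> A) :
  substructure_set [set x | forall e : R, 0 < e ->
    exists t, mdist x (teval (T := pre A) a t) < e].
Proof.
split.
  apply: near_closed => x h e e0; have [|y /= hy xy] := h (e / 2); first by lra.
  have [|t yt] := hy (e / 2); first by lra.
  exists t; have := metric_triangle x y (teval (T := pre A) a t); lra.
move=> F b /= hb e e0; have [d d0 hd] := @fun_box _ _ A F b e e0.
have [ts hts] := choice (fun j => hb j d d0).
exists (App ts); exact: hd.
Qed.

Lemma generated_near A (I : Type) (a : I -> A) x : generated (range a) x ->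
  forall e : R, 0 < e -> exists t, mdist x (teval (T := pre A) a t) < e.
Proof.
move=> gx; apply: (gx [set x | forall e : R, 0 < e ->
    exists t, mdist x (teval (T := pre A) a t) < e]).
split; first exact: near_terms_substructure.
by move=> _ [i _ <-] e e0; exists (Var i); rewrite /= mdistxx.
Qed.

Lemma tdenseP A (I : Type) (a : I -> A) :
  tdense a <-> generated (range a) = setT.
Proof.
split=> [da|ga x]; last by apply: generated_near; rewrite ga.
apply/seteqP; split=> // x _; apply: closed_near.
  exact: (generated_substructure _).1.
move=> e e0; have [t xt] := da x e e0; exists (teval (T := pre A) a t) => //.
elim: t {xt} => [i|F ts IH] /=; last exact: (generated_substructure _).2.
by apply: sub_gen_smallest; exists i.
Qed.

Lemma tdense_comp A (I J : Type) (a : I -> A) (f : J -> I) :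
  tdense (fun j => a (f j)) -> tdense a.
Proof.
move=> d x e e0; have [t xt] := d x e e0.
by exists (tsubst (fun j => Var (f j)) t); rewrite teval_tsubst.
Qed.

Lemma finitely_generatedP A :
  finitely_generated A <-> exists n (a : 'I_n -> A), tdense a.
Proof.
split=> [[A0 [/finite_seqP [s ->] gs]]|[n [a /tdenseP ga]]].
  exists (size s), (tnth (in_tuple s)); apply/tdenseP; rewrite -[RHS]gs.
  congr generated; apply/seteqP; split=> [_ [i _ <-]|x /= xs] /=.
    by rewrite mem_tnth.
  by have /tnthP [i ->] : x \in in_tuple s by []; exists i.
by exists (range a); split=> //; exact: finite_image.
Qed.

Lemma tuple_structure A (I : Type) (a : I -> A) :
  exists (G : structure R L) (g : I -> G),
    [/\ tdense g, embeds G A & teq g a].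
Proof.
pose G := generated_structure (range a).
pose g i : G := generated_incl (exist _ (a i) (mem_set (imageT a i))).
have ev : embedding (val : G -> A) by split.
have ga : teq g a by apply: teq_sym; exact: (teq_embedding g ev).
exists G, g; split=> //; last by exists val.
move=> x e e0; have [t xt] := generated_near (set_mem (valP x)) e0.
by exists t; move: xt; have /= -> := teval_pembedding g t ((embeddingP _).1 ev).
Qed.

(** With [teq_of_finite_partial_iso], this identifies finite partial isomorphisms
with pairs of finite tuples of the same type. *)
Lemma finite_partial_iso_of_teq A B (I : finType) (a : I -> A) (b : I -> B) :
  teq a b -> exists f : finite_partial_iso A B,
    (forall x : fpi_dom f, exists2 i, val x = a i & f x = b i) /\
    (forall i, exists2 x : fpi_dom f, val x = a i & f x = b i).
Proof.
move=> ab; pose G := generated_structure (range a).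
pose g i : G := generated_incl (exist _ (a i) (mem_set (imageT a i))).
have ev : embedding (val : G -> A) by split.
have dg : tdense g.
  move=> x e e0; have [t xt] := generated_near (set_mem (valP x)) e0.
  by exists t; move: xt; have /= -> := teval_pembedding g t ((embeddingP _).1 ev).
have ga : teq g b by apply: teq_trans ab; apply: teq_sym; exact: (teq_embedding g ev).
have [h eh hg] := embedding_extend ga dg.
exists (@FinitePartialIso _ _ _ _ (range a) (fun x => h (generated_incl x))
  (finite_image _ finite_finset) (ex_intro2 _ _ h eh (fun=> erefl))).
split=> /= [x|i].
  have [i _ ix] := set_mem (valP x); exists i => //.
  by rewrite -hg; congr h; apply: val_inj.
by exists (exist _ (a i) (mem_set (imageT a i))) => //; exact: hg.
Qed.

Lemma teq_of_finite_partial_iso A B (f : finite_partial_iso A B) :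
  exists n (a : 'I_n -> A) (b : 'I_n -> B), teq a b /\
    forall x : fpi_dom f, exists2 i, a i = val x & b i = f x.
Proof.
case: f => D f fD [g eg gf] /=.
have /finite_seqP [s Ds] := fD.
have sD (i : 'I_(size s)) : tnth (in_tuple s) i \in D.
  by apply/mem_set; rewrite Ds /=; exact: mem_tnth.
pose d i : D := exist _ (tnth (in_tuple s) i) (sD i).
exists (size s), (fun i => val (d i)), (fun i => f (d i)); split.
  have ev : embedding (val : generated_structure D -> A) by split.
  have h1 := teq_embedding (fun i => generated_incl (d i)) ev.
  have h2 := teq_embedding (fun i => generated_incl (d i)) eg.
  have := teq_trans h1 (teq_sym h2).
  by congr teq; apply/funext => i; rewrite gf.
move=> x; have : val x \in in_tuple s by have := set_mem (valP x); rewrite {1}Ds.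
move=> /tnthP [i xi]; have dx : d i = x by apply: val_inj; rewrite xi.
by exists i; rewrite dx.
Qed.

End Limits.

(** * Amalgamation and the distance of types *)

Definition tsum (I J T : Type) (a : I -> T) (b : J -> T) (s : I + J) : T :=
  match s with inl i => a i | inr j => b j end.

Section Classes.
Context {R : realType} {L : language}.
Implicit Types (A B C : structure R L) (T U V : @prestructure R L).
Variable K : structure R L -> Prop.

(** The notion of [K]-structure for prestructures; see [K_structure_Kpre] and
[Kpre_K_structure]. *)
Definition Kpre T : Prop := forall n (a : 'I_n -> T),
  exists C, K C /\ exists c : 'I_n -> C, teq c a.

Lemma Kpre_fin T (I : finType) (a : I -> T) : Kpre T ->
  exists C, K C /\ exists c : I -> C, teq c a.
Proof.
move=> kT; have [C [KC [c ca]]] := kT _ (fun j : 'I_#|I| => a (enum_val j)).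
exists C; split=> //; exists (fun i => c (enum_rank i)).
have := teq_reindex (fun i : I => enum_rank i) ca.
by congr teq; apply/funext => i; rewrite enum_rankK.
Qed.

Lemma K_structure_Kpre A : K_structure K A -> Kpre (pre A).
Proof.
move=> kA n a; have [G [g [dg GA ga]]] := tuple_structure a.
exists G; split; last by exists g.
by apply: kA; split=> //; apply/finitely_generatedP; exists n, g.
Qed.

Lemma K_embeds A B : HP K -> finitely_generated A -> embeds A B -> K B -> K A.
Proof. by move=> hp fA AB /hp; apply. Qed.

Hypothesis hp : HP K.

Lemma K_Kpre C : K C -> Kpre (pre C).
Proof. by move=> /hp; exact: K_structure_Kpre. Qed.

Lemma Kpre_K_structure A : Kpre (pre A) -> K_structure K A.
Proof.
move=> kA B [/finitely_generatedP [n [b db]] [f ef]].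
have [C [KC [c cb]]] := kA n (fun j => f (b j)).
have [g eg gb] := embedding_extend (teq_sym (teq_trans cb (teq_embedding b ef))) db.
apply: (K_embeds hp _ _ KC); last by exists g.
by apply/finitely_generatedP; exists n, b.
Qed.

(** This is about closed terms and predicates without arguments: by JEP they have
the same values in all members of [K]. *)
Lemma teq_void T U (I : finType) (a : I -> T) (b : I -> U) :
  JEP K -> Kpre T -> Kpre U -> (I -> False) -> teq a b.
Proof.
move=> jep kT kU I0.
have [C [KC [c ca]]] := Kpre_fin a kT; have [D [KD [d db]]] := Kpre_fin b kU.
have [E [KE [f ef] [g eg]]] := jep _ _ KC KD.
have fg : (fun i => f (c i)) = (fun i => g (d i)).
  by apply/funext => i; have := I0 i.
apply: teq_trans (teq_sym ca) (teq_trans (teq_sym (teq_embedding c ef)) _).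
by rewrite fg; exact: teq_trans (teq_embedding d eg) db.
Qed.

(** The relation [dK a b < r] between the types of [a] and [b]; see [dK_near]. *)
Definition near r T U (I : Type) (a : I -> T) (b : I -> U) : Prop :=
  exists C, K C /\ exists a' b' : I -> C,
    [/\ teq a' a, teq b' b & forall i, mdist (a' i) (b' i) < r].

Lemma near_sym r T U (I : Type) (a : I -> T) (b : I -> U) :
  near r a b -> near r b a.
Proof.
move=> [C [KC [a' [b' [aa bb ab]]]]]; exists C; split=> //; exists b', a'.
by split=> // i; rewrite metric_sym.
Qed.

Lemma near_le r s T U (I : Type) (a : I -> T) (b : I -> U) :
  r <= s -> near r a b -> near s a b.
Proof.
move=> rs [C [KC [a' [b' [aa bb ab]]]]]; exists C; split=> //; exists a', b'.
by split=> // i; exact: lt_le_trans rs.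
Qed.

Lemma near_reindex r T U (I J : Type) (f : J -> I) (a : I -> T) (b : I -> U) :
  near r a b -> near r (fun j => a (f j)) (fun j => b (f j)).
Proof.
move=> [C [KC [a' [b' [aa bb ab]]]]]; exists C; split=> //.
exists (fun j => a' (f j)), (fun j => b' (f j)).
by split=> //; exact: teq_reindex.
Qed.

Lemma near_teq r T T' U U' (I : Type) (a : I -> T) (a' : I -> T') (b : I -> U)
    (b' : I -> U') :
  teq a a' -> teq b b' -> near r a b -> near r a' b'.
Proof.
move=> aa bb [C [KC [x [y [xa yb xy]]]]]; exists C; split=> //; exists x, y.
by split=> //; [exact: teq_trans aa|exact: teq_trans bb].
Qed.

Lemma near_same r T (I : finType) (a b : I -> T) : Kpre T ->
  (forall i, pdist (a i) (b i) < r) -> near r a b.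
Proof.
move=> kT ab; have [C [KC [c ca]]] := Kpre_fin (tsum a b) kT.
exists C; split=> //; exists (fun i => c (inl i)), (fun i => c (inr i)); split.
- exact: (teq_reindex inl ca).
- exact: (teq_reindex inr ca).
- by move=> i; have /= -> := teq_dist (inl i) (inr i) ca.
Qed.

Hypothesis nap : NAP K.

(** NAP in terms of tuples: if the subtuples [a \o f] and [b \o g] have the same
type, then [a] and [b] are realized together with these subtuples close to each
other. *)
Lemma amalgam T U (I J1 J2 : finType) (a : J1 -> T) (b : J2 -> U)
    (f : I -> J1) (g : I -> J2) (e : R) :
  Kpre T -> Kpre U -> teq (fun i => a (f i)) (fun i => b (g i)) -> 0 < e ->
  exists C, K C /\ exists (a' : J1 -> C) (b' : J2 -> C),
    [/\ teq a' a, teq b' b & forall i, mdist (a' (f i)) (b' (g i)) <= e].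
Proof.
move=> kT kU ab e0.
have [A [KA [x xa]]] := Kpre_fin a kT; have [B [KB [y yb]]] := Kpre_fin b kU.
have xy : teq (fun i => x (f i)) (fun i => y (g i)).
  apply: teq_trans (teq_reindex f xa) (teq_trans ab _).
  exact/teq_sym/(teq_reindex g yb).
have [phi [_ phiE]] := finite_partial_iso_of_teq xy.
have [C [KC [u [v [eu ev uv]]]]] := nap KA KB phi e0.
exists C; split=> //; exists (fun i => u (x i)), (fun i => v (y i)); split.
- exact: teq_trans (teq_embedding x eu) xa.
- exact: teq_trans (teq_embedding y ev) yb.
- by move=> i; have [z <- <-] := phiE i; exact: uv.
Qed.

(** A witness of [near] is a pair of tuples in a third member of [K].  Amalgamating
first [a] and then [b] with it puts [a] and [b] into one member of [K], at the
cost of two errors that are paid for by [s - r]. *)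
Lemma near_amalgam r s T U (I J1 J2 : finType) (a : J1 -> T) (b : J2 -> U)
    (f : I -> J1) (g : I -> J2) :
  Kpre T -> Kpre U -> near r (fun i => a (f i)) (fun i => b (g i)) -> r < s ->
  exists C, K C /\ exists (a' : J1 -> C) (b' : J2 -> C),
    [/\ teq a' a, teq b' b & forall i, mdist (a' (f i)) (b' (g i)) < s].
Proof.
move=> kT kU [C [KC [x [y [xa yb xy]]]]] rs.
have e0 : 0 < (s - r) / 2 by lra.
have [C1 [KC1 [a1 [c [a1a cxy a1c]]]]] := amalgam (a := a) (b := tsum x y)
  (g := inl) kT (K_Kpre KC) (teq_sym xa) e0.
have cb : teq (fun i => tsum a1 c (inr (inr i))) (fun i => b (g i)).
  exact: teq_trans (teq_reindex inr cxy) yb.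
have [C2 [KC2 [z [b2 [za b2b zb]]]]] := amalgam (a := tsum a1 c) (b := b)
  (f := inr \o inr) (K_Kpre KC1) kU cb e0.
exists C2; split=> //; exists (fun j => z (inl j)), b2; split=> //.
  exact: teq_trans (teq_reindex inl za) a1a.
move=> i; have /= h1 := teq_dist (inl (f i)) (inr (inl i)) za.
have /= h2 := teq_dist (inr (inl i)) (inr (inr i)) za.
have /= h3 := teq_dist (inl i) (inr i) cxy.
have := metric_triangle (z (inl (f i))) (z (inr (inl i))) (b2 (g i)).
have := metric_triangle (z (inr (inl i))) (z (inr (inr i))) (b2 (g i)).
have := zb i; have := a1c i; have := xy i; rewrite /= h1 h2 h3; lra.
Qed.

(** The witness of the second inequality is a member of [K] containing copies of
[b] and [c]; amalgamate [a] with it along its copy of [b]. *)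
Lemma near_triangle r s t T U V (I : finType) (a : I -> T) (b : I -> U)
    (c : I -> V) :
  Kpre T -> near r a b -> near s b c -> r + s < t -> near t a c.
Proof.
move=> kT ab [C [KC [x [y [xb yc xy]]]]] rst.
have ax : near r (fun i => a i) (fun i => tsum x y (inl i)).
  exact: near_teq (teq_refl a) (teq_sym xb) ab.
have [|D [KD [a' [z [a'a zxy a'z]]]]] :=
  near_amalgam (a := a) (b := tsum x y) (f := id) (s := t - s) kT (K_Kpre KC) ax.
  by lra.
exists D; split=> //; exists a', (fun i => z (inr i)); split=> //.
  exact: teq_trans (teq_reindex inr zxy) yc.
move=> i; have /= h := teq_dist (inl i) (inr i) zxy.
have := metric_triangle (a' i) (z (inl i)) (z (inr i)); have := xy i.
have := a'z i; rewrite /= h; lra.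
Qed.

End Classes.

(** * Constructions of approximate isometries *)

Section ApproximateIsometryConstructions.
Context {R : realType}.
Implicit Types X Y Z : metricType R.
Local Open Scope ereal_scope.

(** Positivity excludes the indeterminate sum of opposite infinities. *)
Lemma le_add_ereal_inf (c v : \bar R) (S : set (\bar R)) :
  0 <= v -> (forall w, S w -> 0 <= w) -> (forall w, S w -> c <= v + w) ->
  c <= v + ereal_inf S.
Proof.
move=> v0 S0 h; have I0 : 0 <= ereal_inf S by apply: le_ereal_inf_tmp.
case: v v0 h => [r r0 h|_ _|//]; last first.
  by rewrite addye ?leey// gt_eqF// (lt_le_trans _ I0).
rewrite -leeBlDl//; apply: le_ereal_inf_tmp => w Sw.
by rewrite leeBlDl//; exact: h.
Qed.

(** Both Katetov inequalities pass to an infimum, the second one because it is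
assumed between any two members of the family. *)
Lemma katetov_inf X (I : Type) (g : I -> X -> \bar R) :
  (forall i x, 0 <= g i x) ->
  (forall i x x', g i x <= (mdist x x')%:E + g i x') ->
  (forall i j x x', (mdist x x')%:E <= g i x + g j x') ->
  katetov (fun x => ereal_inf (range (fun i => g i x))).
Proof.
move=> g0 gl gk.
have r0 x w : range (fun i => g i x) w -> 0 <= w by move=> [i _ <-].
split=> [x|x x'|x x'].
- by apply: le_ereal_inf_tmp => w /r0.
- apply: le_add_ereal_inf; [by rewrite lee_fin mdist_ge0|exact: r0|].
  by move=> _ [i _ <-]; apply: le_trans (gl i x x'); apply: ereal_inf_lbound; exists i.
- apply: le_add_ereal_inf; [|exact: r0|].
    by apply: le_ereal_inf_tmp => w /r0.
  move=> _ [j _ <-]; rewrite addeC; apply: le_add_ereal_inf => //; first exact: r0.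
  by move=> _ [i _ <-]; rewrite addeC.
Qed.

(** The approximate isometry [psi_f] of a partial isometry [f] given by tuples,
[f (a i) = b i]. *)
Definition apx_family X Y (I : Type) (a : I -> X) (b : I -> Y) :
    {ptws X * Y -> \bar R} :=
  fun z => ereal_inf (range (fun i => (mdist z.1 (a i) + mdist (b i) z.2)%:E)).

Lemma apx_family_le X Y (I : Type) (a : I -> X) (b : I -> Y) i z :
  apx_family a b z <= (mdist z.1 (a i) + mdist (b i) z.2)%:E.
Proof. by apply: ereal_inf_lbound; exists i. Qed.

Lemma Apx_family X Y (I : Type) (a : I -> X) (b : I -> Y) :
  (forall i j, mdist (a i) (a j) = mdist (b i) (b j)) -> Apx (apx_family a b).
Proof.
move=> ab; split=> [y|x]; apply: katetov_inf => [i u|i u u'|i j u u'];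
  rewrite -?EFinD lee_fin.
- by rewrite addr_ge0// mdist_ge0.
- have := metric_triangle u u' (a i); rewrite /=; lra.
- rewrite /=; have := metric_triangle u (a i) u'; have := metric_triangle (a i) (a j) u'.
  have := metric_triangle (b i) y (b j); rewrite -ab.
  have := metric_sym u' (a j); have := metric_sym y (b j); lra.
- by rewrite addr_ge0// mdist_ge0.
- have := metric_triangle (b i) u' u; have := metric_sym u u'; rewrite /=; lra.
- rewrite /=; have := metric_triangle u (b i) u'; have := metric_triangle (b i) (b j) u'.
  have := metric_triangle (a i) x (a j); rewrite ab.
  have := metric_sym u (b i); have := metric_sym x (a i); lra.
Qed.

Lemma apx_triangle_l X Y (psi : {ptws X * Y -> \bar R}) x x' y :
  Apx psi -> psi (x, y) <= (mdist x x')%:E + psi (x', y).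
Proof. by move=> [/(_ y) [_ h _] _]; exact: h. Qed.

Lemma apx_triangle_r X Y (psi : {ptws X * Y -> \bar R}) x y y' :
  Apx psi -> psi (x, y) <= psi (x, y') + (mdist y' y)%:E.
Proof. by move=> [_ /(_ x) [_ h _]]; rewrite addeC metric_sym; exact: h. Qed.

Lemma apx_ge0 X Y (psi : {ptws X * Y -> \bar R}) z : Apx psi -> 0 <= psi z.
Proof. by case: z => x y [/(_ y) [h _ _] _]; exact: h. Qed.

(** An approximate isometry that is small along a partial isometry is bounded
everywhere, by the triangle inequalities on both sides. *)
Lemma apx_le_family X Y (I : Type) (a : I -> X) (b : I -> Y)
    (psi : {ptws X * Y -> \bar R}) (t : R) :
  Apx psi -> (forall i, psi (a i, b i) <= t%:E) ->
  forall z, psi z <= t%:E + apx_family a b z.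
Proof.
move=> Apsi h [x y].
rewrite addeC -leeBlDr//; apply: le_ereal_inf_tmp => _ [i _ <-].
rewrite leeBlDr// EFinD /=.
apply: le_trans (apx_triangle_l x (a i) y Apsi) _.
rewrite -addeA; apply: leeD => //; rewrite addeC.
apply: le_trans (apx_triangle_r (a i) y (b i) Apsi) _.
exact: leeD.
Qed.

Lemma katetov_comp X Y (psi : {ptws X * Y -> \bar R}) (c : Y -> \bar R) :
  Apx psi -> katetov c ->
  katetov (fun x => ereal_inf (range (fun y => psi (x, y) + c y))).
Proof.
move=> Apsi [c0 cl ck]; apply: katetov_inf => [y u|y u u'|y y' u u'] /=.
- by rewrite adde_ge0// apx_ge0.
- by rewrite addeA; apply: leeD => //; exact: apx_triangle_l.
- apply: le_trans (_ : psi (u, y) + ((mdist y y')%:E + psi (u', y')) <= _).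
    have [/(_ y) [_ _ h] _] := Apsi; apply: le_trans (h u u') _.
    apply: leeD => //; rewrite addeC metric_sym; exact: apx_triangle_r.
  rewrite -addeA; apply: leeD => //.
  by rewrite (addeC _ (c y')) addeA; apply: leeD.
Qed.

Lemma Apx_comp X Y Z (phi : {ptws Y * Z -> \bar R}) (psi : {ptws X * Y -> \bar R}) :
  Apx phi -> Apx psi -> Apx (apx_comp phi psi).
Proof.
move=> [phi1 phi2] Apsi; split=> [z|x]; first exact: (katetov_comp Apsi (phi1 z)).
have Aphi' : Apx ((fun p => phi (p.2, p.1)) : {ptws Z * Y -> \bar R}) by split.
have E z : (fun y => phi (y, z) + psi (x, y)) = (fun y => psi (x, y) + phi (y, z)).
  by apply/funext => y; rewrite addeC.
have := katetov_comp Aphi' (Apsi.2 x); rewrite /apx_comp /=.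
by under eq_fun do rewrite E.
Qed.

Lemma Apx_addr X Y (psi : {ptws X * Y -> \bar R}) (t : R) :
  (0 <= t)%R -> Apx psi -> Apx ((fun z => t%:E + psi z) : {ptws X * Y -> \bar R}).
Proof.
have H Z (c : Z -> \bar R) : (0 <= t)%R -> katetov c -> katetov (fun z => t%:E + c z).
  move=> t0 [c0 cl ck]; split=> [x|x y|x y].
  - by rewrite adde_ge0.
  - by rewrite addeCA; apply: leeD.
  - apply: le_trans (ck x y) _; apply: leeD; by rewrite leeDr// lee_fin.
by move=> t0 [h1 h2]; split=> [y|x]; apply: H.
Qed.

Lemma Apx_max X Y (phi psi : {ptws X * Y -> \bar R}) :
  Apx phi -> Apx psi -> Apx ((fun z => maxe (phi z) (psi z)) : {ptws X * Y -> \bar R}).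
Proof.
have H Z (c d : Z -> \bar R) : katetov c -> katetov d ->
    katetov (fun z => maxe (c z) (d z)).
  move=> [c0 cl ck] [d0 dl dk]; split=> [x|x y|x y].
  - by rewrite le_max c0.
  - by rewrite ge_max; apply/andP; split; [apply: le_trans (cl x y) _|
      apply: le_trans (dl x y) _]; apply: leeD => //; rewrite le_max lexx ?orbT.
  - by apply: le_trans (ck x y) _; apply: leeD; rewrite le_max lexx.
by move=> [h1 h2] [h3 h4]; split=> [y|x]; apply: H.
Qed.

Lemma ptws_nbhs X Y (phi : {ptws X * Y -> \bar R}) (I : finType) (p : I -> X * Y)
    (W : I -> set (\bar R)) :
  (forall i, nbhs (phi (p i)) (W i)) ->
  nbhs phi [set chi : {ptws X * Y -> \bar R} | forall i, W i (chi (p i))].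
Proof.
move=> h.
apply: (@filter_forall _ _ (fun i (chi : {ptws X * Y -> \bar R}) => W i (chi (p i)))
  _ (nbhs_filter phi)) => i.
have /(ptws_cvgP _ (nbhs_filter phi))/(_ (p i)) := @cvg_id _ (nbhs phi).
by apply; exact: h.
Qed.

(** A basic neighbourhood of [phi] restricts finitely many values.  Where [phi] is
finite an upper bound is enough, since [chi] is above [phi]; where [phi] is
infinite so is [chi]. *)
Lemma ptws_nbhs_upward X Y (phi : {ptws X * Y -> \bar R})
    (U : set {ptws X * Y -> \bar R}) :
  (forall z, 0 <= phi z) -> nbhs phi U ->
  exists m (p : 'I_m -> X * Y) (eta : R), (0 < eta)%R /\
    forall chi : {ptws X * Y -> \bar R},
      (forall z, phi z <= chi z) ->
      (forall i, chi (p i) <= phi (p i) + eta%:E) -> U chi.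
Proof.
move=> phi0.
pose G : set_system {ptws X * Y -> \bar R} :=
  [set V | exists (ps : seq (X * Y)) (eta : R), (0 < eta)%R /\
    forall chi : {ptws X * Y -> \bar R},
      (forall z, phi z <= chi z) ->
      (forall p, p \in ps -> chi p <= phi p + eta%:E) -> V chi].
have FG : Filter G.
  split.
  - by exists [::], 1%R.
  - move=> P Q [ps [d [d0 hP]]] [qs [e [e0 hQ]]].
    exists (ps ++ qs), (Num.min d e); split; first by rewrite lt_min d0.
    move=> chi phichi h; split; [apply: hP => //|apply: hQ => //] => p pp.
      apply: le_trans (h p _) _; first by rewrite mem_cat pp.
      by apply: leeD => //; rewrite lee_fin ge_min lexx.
    apply: le_trans (h p _) _; first by rewrite mem_cat pp orbT.
    by apply: leeD => //; rewrite lee_fin ge_min lexx orbT.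
  - move=> P Q PQ [ps [d [d0 hP]]]; exists ps, d; split=> // chi h1 h2.
    by apply: PQ; exact: hP.
have Gphi : G --> phi.
  apply/ptws_cvgP => z W; have := phi0 z; case zr: (phi z) => [r| |//] _.
    move=> /nbhs_EFin /(@nbhs_ballP _ R^o) [d /= d0 dW].
    exists [:: z], (d / 2)%R; split; first by rewrite divr_gt0.
    move=> chi h1 h2 /=; have := h1 z; have := h2 z (mem_head _ _).
    rewrite zr; case: (chi z) => [s| |//]; rewrite ?lee_fin ?leye_eq//.
    move=> s1 s2; apply: dW; rewrite /ball /= ltr_norml; lra.
  move=> /nbhs_singleton W0; exists [::], 1%R; split=> // chi h1 _ /=.
  by have := h1 z; rewrite zr leye_eq => /eqP ->.
move=> /Gphi [ps [eta [eta0 h]]].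
exists (size ps), (tnth (in_tuple ps)), eta; split=> // chi h1 h2.
apply: h => // p pp; have /tnthP [i ->] : p \in in_tuple ps by [].
exact: h2.
Qed.

End ApproximateIsometryConstructions.

(** * Approximate isomorphisms and joint embeddings *)

Section ApproximateIsomorphisms.
Context {R : realType} {L : language}.
Implicit Types (A B C : structure R L) (T U V : @prestructure R L).
Variable K : structure R L -> Prop.

Lemma finite_partial_iso_dist A B (f : finite_partial_iso A B) (x y : fpi_dom f) :
  mdist (f x) (f y) = mdist (val x) (val y).
Proof.
by have [g eg gf] := fpi_extends f; rewrite -!gf (embedding_dist eg).
Qed.

Lemma Apx1_Apx A B : @Apx1 R L A B `<=` @Apx R A B.
Proof.
move=> _ [f ->]; apply: (@Apx_family R A B (fpi_dom f) (fun z => val z) (fun z => f z)) => x y.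
by rewrite finite_partial_iso_dist.
Qed.

Lemma Apx2_Apx A B : @Apx2 R L K A B `<=` @Apx R A B.
Proof.
by move=> _ [C [_ [g [f [/Apx1_Apx Ag /Apx1_Apx Af ->]]]]]; exact: Apx_comp.
Qed.

Lemma ApxK_of_Apx2 A B (phi psi : {ptws A * B -> \bar R}) :
  @Apx2 R L K A B phi -> Apx psi -> apx_le phi psi -> @ApxK R L K A B psi.
Proof.
move=> h1 h2 h3; split=> //; apply: subset_closure; split=> //.
by exists phi.
Qed.

(** Compose the partial isomorphisms [a i |-> a' i] and [b' j |-> b j], and pass
through the point [a' i] in the infimum that defines the composition. *)
Lemma Apx2_tuple A B C (I J : finType) (a : I -> A) (a' : I -> C) (b : J -> B)
    (b' : J -> C) : K C -> teq a a' -> teq b b' ->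
  exists2 psi, @Apx2 R L K A B psi & forall i j x y,
    (psi (x, y) <= (mdist x (a i) + mdist (a' i) (b' j) + mdist (b j) y)%:E)%E.
Proof.
move=> KC aa bb.
have [f [_ fE]] := finite_partial_iso_of_teq aa.
have [g [_ gE]] := finite_partial_iso_of_teq (teq_sym bb).
exists (apx_comp (apx_of_map g) (apx_of_map f)).
  by exists C; split=> //; exists (apx_of_map f), (apx_of_map g); split=> //; [exists f|exists g].
move=> i j x y; have [u uE fu] := fE i; have [v vE gv] := gE j.
apply: (@le_trans _ _ (apx_of_map f (x, a' i) + apx_of_map g (a' i, y))%E).
  by apply: ereal_inf_lbound; exists (a' i).
have h1 := apx_family_le (fun z : fpi_dom f => val z) (fun z => f z) u (x, a' i).
have h2 := apx_family_le (fun z : fpi_dom g => val z) (fun z => g z) v (a' i, y).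
apply: le_trans (leeD h1 h2) _; rewrite /= fu gv uE vE mdistxx addr0 -EFinD lee_fin.
by rewrite addrA.
Qed.

Hypotheses (hp : HP K) (nap : NAP K).

(** By definition of the closure, [phi] can be replaced, up to [e / 2] and at the
finitely many pairs in question, by the composition of finite partial
isomorphisms [a |-> c] and [c' |-> b] through some [C] in [K].  Amalgamating
first with [A] over [c] and then with [B] over [c'] realizes [x], [a], [c],
[c'], [b] and [y] in one member of [K]; the value of the composition is an
infimum of lengths of paths from [x i] to [y j] through these points, so it
bounds the distance from above up to the errors. *)
Lemma ApxK_joint_embedding A B (phi : {ptws A * B -> \bar R}) (I J : finType)
    (x : I -> A) (y : J -> B) (e : R) :
  @ApxK R L K A B phi -> Kpre K (pre A) -> Kpre K (pre B) -> 0 < e ->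
  exists D, K D /\ exists (x' : I -> D) (y' : J -> D), [/\ teq x' x, teq y' y &
    forall i j, ((mdist (x' i) (y' j))%:E <= phi (x i, y j) + e%:E)%E].
Proof.
move=> [cphi Aphi] kA kB e0; have e2 : 0 < e / 2 by lra.
pose W (p : I * J) := [set v : \bar R | phi (x p.1, y p.2) = +oo%E \/
  (v < phi (x p.1, y p.2) + (e / 2)%:E)%E].
have nW : nbhs phi [set chi : {ptws A * B -> \bar R} |
    forall p, W p (chi (x p.1, y p.2))].
  apply: (@ptws_nbhs _ _ _ phi (I * J)%type (fun p => (x p.1, y p.2))) => -[i j].
  rewrite /W /=; have := apx_ge0 (x i, y j) Aphi.
  case phiE: (phi (x i, y j)) => [r| |//] _; last first.
    by apply: (@filterS _ _ (nbhs_filter (+oo%E : \bar R)) setT) => [v _|]; [left|exact: filterT].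
  have : nbhs r%:E [set v : \bar R | (v < (r + e / 2)%:E)%E].
    by apply: (@nbhs_open_ereal_lt _ r (fun r => r + e / 2)); rewrite ltrDl.
  by apply: (@filterS _ _ (nbhs_filter (r%:E : \bar R))) => v; right.
have [chi [[Achi [psi [C [KC [_ [_ [[f ->] [g ->] ->]]]]] psichi]] Wchi]] := cphi _ nW.
have [n [a [c [ac fE]]]] := teq_of_finite_partial_iso f.
have [m [c' [b [cb gE]]]] := teq_of_finite_partial_iso g.
have e4 : 0 < e / 4 by lra.
have [D1 [KD1 [u [v [ux vc uv]]]]] := amalgam (a := tsum x a) (b := tsum c c')
  (f := inr) (g := inl) nap kA (K_Kpre hp KC) ac e4.
have cb' : teq (fun k => tsum u v (inr (inr k))) b.
  exact: teq_trans (teq_reindex inr vc) cb.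
have [D [KD [s [t [su ty st]]]]] := amalgam (a := tsum u v) (b := tsum b y)
  (f := inr \o inr) (g := inl) nap (K_Kpre hp KD1) kB cb' e4.
exists D; split=> //.
exists (fun i => s (inl (inl i))), (fun j => t (inr j)); split.
- exact: teq_trans (teq_reindex (inl \o inl) su) (teq_reindex inl ux).
- exact: teq_reindex inr ty.
move=> i j; have := Wchi (i, j); rewrite /W /=; have := apx_ge0 (x i, y j) Aphi.
case phiE: (phi (x i, y j)) => [r| |//] _ [//|]; rewrite ?addye ?leey// => hchi.
have /ereal_inf_lt [_ [w _ <-]] := le_lt_trans (psichi _) hchi.
move=> /= h; set d := mdist _ _.
suff hd : ((d - e / 2)%:E <= apx_of_map f (x i, w) + apx_of_map g (w, y j))%E.
  have := le_lt_trans hd h; rewrite -!EFinD lte_fin lee_fin; lra.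
apply: le_add_ereal_inf => [|_ [q _ <-]|_ [q _ <-]].
- by apply: apx_ge0; apply: Apx1_Apx; exists f.
- by rewrite lee_fin addr_ge0// mdist_ge0.
rewrite addeC; apply: le_add_ereal_inf => [|_ [p _ <-]|_ [p _ <-]].
- by rewrite lee_fin addr_ge0// mdist_ge0.
- by rewrite lee_fin addr_ge0// mdist_ge0.
rewrite -EFinD lee_fin /= /d.
have [k <- <-] := fE p; have [l <- <-] := gE q.
have /= h1 := teq_dist (inl (inl i)) (inl (inr k)) su.
have /= h2 := teq_dist (inl i) (inr k) ux.
have /= h3 := teq_dist (inr (inl k)) (inr (inr l)) su.
have /= h4 := teq_dist (inl k) (inr l) vc.
have /= h5 := teq_dist (inl (inr k)) (inr (inl k)) su.
have /= h6 := teq_dist (inl l) (inr j) ty.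
have := metric_triangle (s (inl (inl i))) (s (inl (inr k))) (t (inr j)).
have := metric_triangle (s (inl (inr k))) (s (inr (inl k))) (t (inr j)).
have := metric_triangle (s (inr (inl k))) (s (inr (inr l))) (t (inr j)).
have := metric_triangle (s (inr (inr l))) (t (inl l)) (t (inr j)).
have := st l; have := uv k; have := metric_triangle (c k) w (c' l); rewrite /=.
rewrite h1 h2 h3 h4 h5 h6; lra.
Qed.

Lemma dK_near n (a b : generated_tuple K n) (r : R) : 0 < r ->
  (dK a b < r%:E)%E <-> near K r (gt_tuple a) (gt_tuple b).
Proof.
move=> r0; split=> [/ereal_inf_lt [_ [psi hpsi <-]]|].
  set m := \big[_/_]_(i < n) _ => mr.
  have m0 : (0 <= m)%E by exact: bigmax_ge_id.
  have hm i : (psi (gt_tuple a i, gt_tuple b i) <= m)%E.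
    by rewrite /m; exact: (le_bigmax _ (fun i => psi (gt_tuple a i, gt_tuple b i))).
  case: m m0 mr hm => [m| |//] m0; rewrite ?lte_fin// => mr hm.
  have e0 : 0 < (r - m) / 2 by lra.
  have [D [KD [x [y [xa yb xy]]]]] := ApxK_joint_embedding (gt_tuple a) (gt_tuple b)
    hpsi (K_Kpre hp (gt_in a)) (K_Kpre hp (gt_in b)) e0.
  exists D; split=> //; exists x, y; split=> // i.
  have := le_trans (xy i i) (leeD (hm i) (lexx _)).
  rewrite -EFinD lee_fin; lra.
move=> [C [KC [x [y [xa yb xy]]]]].
have [psi hpsi psixy] := Apx2_tuple KC (teq_sym xa) (teq_sym yb).
apply/ereal_inf_ltP; exists (\big[maxe/0%E]_(i < n) psi (gt_tuple a i, gt_tuple b i)).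
  exists psi => //; exact: (ApxK_of_Apx2 hpsi (Apx2_Apx hpsi)).
apply: bigmax_lt => // i _; apply: le_lt_trans (psixy i i _ _) _.
by rewrite !mdistxx add0r addr0 lte_fin.
Qed.

End ApproximateIsomorphisms.

(** * The extension property and the limit property *)

Section ExtensionProperty.
Context {R : realType} {L : language}.
Implicit Types (A B C M : structure R L) (T U V : @prestructure R L).
Variable K : structure R L -> Prop.

(** As in NAP, the tuple [b] may have to be moved slightly: [M] need not contain an
exact realization of the longer type over [b] itself. *)
Definition extension_property M : Prop :=
  forall (I J : finType) T (a : I -> T) (c : J -> T) (b : I -> M) (e : R),
    Kpre K T -> teq a b -> 0 < e ->
    exists (b' : I -> M) (c' : J -> M),
      teq (tsum b' c') (tsum a c) /\ forall i, mdist (b' i) (b i) < e.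

(** Realize the longer tuple in a member of [K], hence in [M]; its first part has
the type of [b], and an automorphism moves it close to [b]. *)
Lemma ultrahomogeneous_extension M : approximately_ultrahomogeneous M ->
  (forall C, K C -> embeds C M) -> extension_property M.
Proof.
move=> auh KM I J T a c b e kT ab e0.
have [C [KC [z za]]] := Kpre_fin (tsum a c) kT; have [k ek] := KM _ KC.
have zb : teq (fun i => k (z (inl i))) b.
  apply: teq_trans (teq_embedding (fun i => z (inl i)) ek) _.
  exact: teq_trans (teq_reindex inl za) ab.
have [phi [_ phiE]] := finite_partial_iso_of_teq zb.
have [F [eF _] hF] := auh phi e e0.
exists (fun i => F (k (z (inl i)))), (fun j => F (k (z (inr j)))); split.
  apply: teq_trans za; apply: teq_trans (teq_embedding z ek).
  apply: teq_trans (teq_embedding (fun i => k (z i)) eF).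
  rewrite [X in teq X _](_ : _ = (fun i => F (k (z i))))//.
  by apply/funext => -[].
by move=> i; have [x <- <-] := phiE i; rewrite metric_sym.
Qed.

Hypotheses (hp : HP K) (nap : NAP K).

(** Since [phi0] is in the interior below [psi], any approximate isometry that is
at most [phi0 + eta] at finitely many points is below [psi] ([hle]; taking the
maximum with [phi0] brings it into the open set).  The extension property
converts the joint embedding given by [phi0] into a tuple [c] of [M] of the
type of the tuple [xa] formed by these points and [A0].  The approximate
isometry of the map [xa |-> c], plus a small constant, is the required [phi]:
it is total on [A0] because [c] contains the image of [A0]. *)
Lemma extension_property_limit M : separable_structure M -> K_structure K M ->
  extension_property M -> is_limit K M.
Proof.
move=> sM kM ext; split=> // A kA A0 fA0 psi [hpsi [phi0 hphi0]].
move=> [Aphi0 [U [oU Uphi0 UA]]] e e0.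
have nU : nbhs phi0 U by apply: open_nbhs_nbhs.
have [m [p [eta [eta0 hU]]]] := ptws_nbhs_upward (fun z => apx_ge0 z Aphi0) nU.
have hle (chi : {ptws A * M -> \bar R}) : Apx chi ->
    (forall i, (chi (p i) <= phi0 (p i) + eta%:E)%E) -> apx_le chi psi.
  move=> Achi h z.
  have Amax := Apx_max Achi Aphi0.
  have Umax : U (fun z => maxe (chi z) (phi0 z)).
    apply: hU => [u|i]; first by rewrite le_max lexx orbT.
    by rewrite ge_max h leeDl// lee_fin ltW.
  have [_ /(_ z)] := UA _ (conj Umax Amax).
  by rewrite ge_max => /andP[].
have /finite_seqP [s sE] := fA0.
pose xa : 'I_m + 'I_(size s) -> A := tsum (fun i => (p i).1) (tnth (in_tuple s)).
pose y : 'I_m -> M := fun i => (p i).2.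
have eta4 : 0 < eta / 4 by lra.
have kpA := K_structure_Kpre kA; have kpM := K_structure_Kpre kM.
have [D [KD [x' [y' [xx yy xy]]]]] := ApxK_joint_embedding hp nap xa y hphi0 kpA kpM eta4.
have [b [c [bcE by_]]] := ext _ _ _ y' x' y _ (K_Kpre hp KD) yy eta4.
have xc : teq xa c.
  exact: teq_trans (teq_sym xx) (teq_sym (teq_reindex inr bcE)).
(* [phi] is a bound plus [2 * del], tested against [3 * del]; two further errors
   of [eta / 4] come from the joint embedding and from the extension property *)
pose del := Num.min (eta / 12) (e / 2).
have del0 : 0 < del by rewrite lt_min; apply/andP; split; lra.
have del1 : del <= eta / 12 by rewrite ge_min lexx.
have del2 : del <= e / 2 by rewrite ge_min lexx orbT.
pose theta : {ptws A * M -> \bar R} := apx_family xa c.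
have Atheta : Apx theta by apply: Apx_family => i j; exact: (teq_dist i j xc).
have thetaE i : (theta (xa i, c i) <= 0)%E.
  by apply: le_trans (apx_family_le xa c i _) _; rewrite /= !mdistxx addr0.
pose phi : {ptws A * M -> \bar R} := fun z => ((2 * del)%:E + theta z)%E.
have Aphi : Apx phi by apply: Apx_addr => //; lra.
have theta_phi : apx_le theta phi by move=> z; rewrite leeDr// lee_fin; lra.
have [psi2 hpsi2 psi2E] := Apx2_tuple KD (teq_sym xx) (teq_reindex inr bcE).
have psi2_theta : apx_le psi2 theta.
  move=> [u v]; apply: le_ereal_inf_tmp => _ [i _ <-].
  by apply: le_trans (psi2E i i u v) _; rewrite mdistxx addr0.
have ball_nbhs (t : R) (chi : {ptws A * M -> \bar R}) :
    (forall i, (chi (xa i, c i) < t%:E)%E) -> exists V : set {ptws A * M -> \bar R},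
    [/\ open V, V chi & forall chi', V chi' -> Apx chi' ->
      forall z, (chi' z <= t%:E + theta z)%E].
  move=> h.
  have : nbhs chi [set chi' : {ptws A * M -> \bar R} | forall i, (chi' (xa i, c i) < t%:E)%E].
    apply: (@ptws_nbhs _ _ _ chi _ (fun i => (xa i, c i)) (fun=> [set v | (v < t%:E)%E])) => i.
    apply: open_nbhs_nbhs; split; [exact: open_ereal_lt_ereal|exact: h].
  rewrite nbhsE => -[V [oV Vchi] VW]; exists V; split=> // chi' /VW /= h' A'.
  by apply: apx_le_family => // i; exact/ltW.
exists phi; split.
- split; first exact: (ApxK_of_Apx2 hpsi2 Aphi (fun z => le_trans (psi2_theta z) (theta_phi z))).
  exists theta; first exact: (ApxK_of_Apx2 hpsi2 Atheta psi2_theta).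
  have [|V [oV Vtheta hV]] := ball_nbhs (2 * del) theta.
    by move=> i; apply: le_lt_trans (thetaE i) _; rewrite lte_fin; lra.
  split=> //; exists V; split=> // chi [Vchi Achi]; split=> // z.
  exact: hV.
- have [|V [oV Vphi hV]] := ball_nbhs (3 * del) phi.
    move=> i; apply: (@le_lt_trans _ _ ((2 * del)%:E + 0)%E); first exact: leeD.
    by rewrite adde0 lte_fin; lra.
  split=> //; exists V; split=> // chi [Vchi Achi]; split=> //; apply: hle => // i.
  apply: le_trans (hV chi Vchi Achi _) _.
  have h1 := apx_family_le xa c (inl i) (p i).
  apply: le_trans (leeD (lexx _) h1) _; rewrite /= mdistxx add0r.
  have h2 := xy (inl i) i; have h3 := by_ i.
  have /= h4 := teq_dist (inl i) (inr (inl i)) bcE.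
  rewrite -EFinD; move: h2; rewrite /xa /y /= -surjective_pairing.
  case: (phi0 (p i)) => [r| |]; rewrite ?leey// -!EFinD !lee_fin => h2.
  have := metric_triangle (c (inl i)) (b i) (p i).2.
  have := metric_sym (c (inl i)) (b i); have := metric_sym (x' (inl i)) (y' i).
  rewrite /y in h3; lra.
- move=> x; rewrite sE /= => xs r er.
  have /tnthP [i xi] : x \in in_tuple s by [].
  exists (c (inr i)); apply: (@le_lt_trans _ _ ((2 * del)%:E + 0)%E).
    by apply: leeD => //; have := thetaE (inr i); rewrite /= -xi.
  by rewrite adde0 lte_fin; lra.
Qed.

End ExtensionProperty.

(** * Back and forth *)

Section BackAndForth.
Context {R : realType} {L : language}.
Implicit Types (A B M : structure R L) (T U : @prestructure R L).

Definition teqn n T U (a : nat -> T) (b : nat -> U) : Prop :=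
  teq (fun i : 'I_n => a i) (fun i : 'I_n => b i).

Lemma teqn_le m n T U (a : nat -> T) (b : nat -> U) :
  (m <= n)%N -> teqn n a b -> teqn m a b.
Proof. by move=> mn /(teq_reindex (widen_ord mn)). Qed.

(** All variables of the term are smaller than [n]. *)
Definition bounded n (t : term (L := L) nat) : Prop :=
  exists t' : term 'I_n, t = tsubst (fun i : 'I_n => Var (i : nat)) t'.

Lemma tsubst_comp (I J J' : Type) (f : I -> term (L := L) J) (g : J -> term J') t :
  tsubst g (tsubst f t) = tsubst (fun i => tsubst g (f i)) t.
Proof. by elim: t => //= F ts IH; congr App; apply/funext. Qed.

Lemma bounded_le m n t : (m <= n)%N -> bounded m t -> bounded n t.
Proof.
move=> mn [t' ->]; exists (tsubst (fun i => Var (widen_ord mn i)) t').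
by rewrite tsubst_comp.
Qed.

Lemma bounded_tsubst (I : Type) n (ts : I -> term nat) t :
  (forall i, bounded n (ts i)) -> bounded n (tsubst ts t).
Proof.
move=> /choice [ts' hts]; exists (tsubst ts' t); rewrite tsubst_comp.
by congr tsubst; apply/funext.
Qed.

Lemma common_bound (I : finType) (ts : I -> term nat) :
  (forall i, exists n, bounded n (ts i)) -> exists n, forall i, bounded n (ts i).
Proof.
move=> /choice [N hN]; exists (\max_i N i)%N => i.
by apply: bounded_le (hN i); exact: leq_bigmax.
Qed.

Lemma term_bound (t : term (L := L) nat) : exists n, bounded n t.
Proof.
elim: t => [i|F ts /common_bound [n hn]].
  by exists i.+1, (Var (Ordinal (ltnSn i))).
exists n; have [ts' hts] := choice hn.
by exists (App ts'); rewrite /=; congr App; apply/funext.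
Qed.

Lemma bounded_max (I : finType) (ts : I -> term nat) :
  exists n, forall i, bounded n (ts i).
Proof. by apply: common_bound => i; exact: term_bound. Qed.

Lemma teqn_dist n T U (a : nat -> T) (b : nat -> U) s t : teqn n a b ->
  bounded n s -> bounded n t ->
  pdist (teval a s) (teval a t) = pdist (teval b s) (teval b t).
Proof. by move=> ab [s' ->] [t' ->]; rewrite !teval_tsubst; exact: ab.1. Qed.

Lemma teqn_pred n T U (a : nat -> T) (b : nat -> U) P
    (ts : 'I_(pred_arity P) -> term nat) :
  teqn n a b -> (forall j, bounded n (ts j)) ->
  @ppred _ _ T P (fun j => teval a (ts j)) = @ppred _ _ U P (fun j => teval b (ts j)).
Proof.
move=> ab /choice [ts' hts].
have E (V : @prestructure R L) (c : nat -> V) : (fun j => teval c (ts j)) =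
    (fun j => teval (fun i : 'I_n => c i) (ts' j)).
  by apply/funext => j; rewrite hts teval_tsubst.
by rewrite !E; exact: ab.2.
Qed.

(** Each equality in [teq] concerns finitely many variables. *)
Lemma teq_nat T U (a : nat -> T) (b : nat -> U) :
  (forall n, teqn n a b) -> teq a b.
Proof.
move=> ab; split=> [s t|P ts].
- have [m bs] := term_bound s; have [n bt] := term_bound t.
  apply: (teqn_dist (ab (maxn m n))).
    by apply: bounded_le bs; exact: leq_maxl.
  by apply: bounded_le bt; exact: leq_maxr.
- by have [n bts] := bounded_max ts; exact: (teqn_pred (ab n)).
Qed.

Lemma injective_unbounded (f : nat -> nat) N : injective f -> exists j, (N <= f j)%N.
Proof.
move=> fi; apply: contrapT => /forallNP h.
have : (size (map f (iota 0 N.+1)) <= size (iota 0 N))%N.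
  apply: uniq_leq_size; first by rewrite map_inj_uniq// iota_uniq.
  move=> _ /mapP [j _ ->]; rewrite mem_iota /= add0n.
  by have /negP := h j; rewrite -ltnNge.
by rewrite size_map !size_iota ltnn.
Qed.

Definition task_done A B (x : A + B) (a : A) (b : B) (e : R) : Prop :=
  match x with inl x => mdist a x <= e | inr y => mdist b y <= e end.

(** At each step one point is added to both sequences, which thereby move a little
on the initial segment.  The moves are summable, so the two sequences converge,
and the limits have the same type.  The point added at step [k] is exactly as
required by [task k]; afterwards it moves by at most [2^-1 ^+ k]. *)
Lemma back_and_forth A B n0 (a0 : nat -> A) (b0 : nat -> B)
    (task : nat -> A + B) (e : R) : 0 < e -> teqn n0 a0 b0 ->
  (forall k (a : nat -> A) (b : nat -> B) (d : R), 0 < d -> teqn (n0 + k) a b ->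
    exists (a' : nat -> A) (b' : nat -> B), [/\ teqn (n0 + k).+1 a' b',
      forall i, (i < n0 + k)%N -> mdist (a' i) (a i) < d /\ mdist (b' i) (b i) < d
      & task_done (task k) (a' (n0 + k)%N) (b' (n0 + k)%N) 0]) ->
  exists (a : nat -> A) (b : nat -> B), [/\ teq a b,
    forall i, (i < n0)%N -> mdist (a i) (a0 i) < e /\ mdist (b i) (b0 i) < e
    & forall k, task_done (task k) (a (n0 + k)%N) (b (n0 + k)%N) (2^-1 ^+ k)].
Proof.
move=> e0 ab0 step.
pose c := Num.min 1 (e / 4).
have c0 : 0 < c by rewrite lt_min ltr01; lra.
have c1 : c <= 1 by rewrite ge_min lexx.
have ce : c <= e / 4 by rewrite ge_min lexx orbT.
have d0 k : 0 < c * 2^-1 ^+ k by rewrite mulr_gt0// half_expr_gt0.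
have [nxt hnxt] : exists nxt : nat -> (nat -> A) * (nat -> B) -> (nat -> A) * (nat -> B),
    forall k p, teqn (n0 + k) p.1 p.2 -> [/\ teqn (n0 + k).+1 (nxt k p).1 (nxt k p).2,
      forall i, (i < n0 + k)%N -> mdist ((nxt k p).1 i) (p.1 i) < c * 2^-1 ^+ k /\
                                  mdist ((nxt k p).2 i) (p.2 i) < c * 2^-1 ^+ k
      & task_done (task k) ((nxt k p).1 (n0 + k)%N) ((nxt k p).2 (n0 + k)%N) 0].
  have [f hf] : exists f : nat * ((nat -> A) * (nat -> B)) -> (nat -> A) * (nat -> B),
    forall q, teqn (n0 + q.1) q.2.1 q.2.2 -> [/\ teqn (n0 + q.1).+1 (f q).1 (f q).2,
      forall i, (i < n0 + q.1)%N -> mdist ((f q).1 i) (q.2.1 i) < c * 2^-1 ^+ q.1 /\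
                                  mdist ((f q).2 i) (q.2.2 i) < c * 2^-1 ^+ q.1
      & task_done (task q.1) ((f q).1 (n0 + q.1)%N) ((f q).2 (n0 + q.1)%N) 0].
    suff /choice [f hf] : forall q : nat * ((nat -> A) * (nat -> B)),
      exists r : (nat -> A) * (nat -> B), teqn (n0 + q.1) q.2.1 q.2.2 ->
      [/\ teqn (n0 + q.1).+1 r.1 r.2,
      forall i, (i < n0 + q.1)%N -> mdist (r.1 i) (q.2.1 i) < c * 2^-1 ^+ q.1 /\
                                  mdist (r.2 i) (q.2.2 i) < c * 2^-1 ^+ q.1
      & task_done (task q.1) (r.1 (n0 + q.1)%N) (r.2 (n0 + q.1)%N) 0].
      by exists f.
    move=> [k [a b]]; have [ab|nab] := pselect (teqn (n0 + k) a b).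
      by have [a' [b' h]] := step k a b _ (d0 k) ab; exists (a', b').
    by exists (a, b).
  by exists (fun k p => f (k, p)) => k p; exact: (hf (k, p)).
pose st := fix st k := if k is k'.+1 then nxt k' (st k') else (a0, b0).
have stE k : teqn (n0 + k) (st k).1 (st k).2.
  elim: k => [|k /hnxt [h _ _]]; first by rewrite addn0.
  by rewrite addnS.
have lim_exists (X : metricType R) (u : nat -> nat -> X) : complete_metric X ->
    (forall k i, (i < n0 + k)%N -> mdist (u k.+1 i) (u k i) < c * 2^-1 ^+ k) ->
    exists l : nat -> X, forall i k, (i < n0 + k)%N -> mdist (u k i) (l i) <= 2 * c * 2^-1 ^+ k.
  move=> cX hu; suff /choice [l hl] : forall i, exists l,
    forall k, (i < n0 + k)%N -> mdist (u k i) l <= 2 * c * 2^-1 ^+ k by exists l.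
  move=> i.
  (* the first step after which the entry [i] belongs to the segment *)
  pose k0 := (i.+1 - n0)%N.
  have [||l hl] := complete_geometric (u := fun j => u (k0 + j)%N i) (c := c * 2^-1 ^+ k0) cX.
  - exact/ltW.
  - move=> k; rewrite metric_sym addnS -mulrA -exprD; apply/ltW/hu.
    by rewrite /k0; lia.
  exists l => k ik; have kk : (k0 <= k)%N by rewrite leq_subLR.
  by have := hl (k - k0)%N; rewrite subnKC// mulrA -[X in _ <= X]mulrA -exprD subnKC.
have [a ha] := lim_exists A (fun k i => (st k).1 i) (@carrier_complete _ _ A)
  (fun k i ik => let: And3 _ h _ := hnxt k _ (stE k) in (h i ik).1).
have [b hb] := lim_exists B (fun k i => (st k).2 i) (@carrier_complete _ _ B)
  (fun k i ik => let: And3 _ h _ := hnxt k _ (stE k) in (h i ik).2).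
exists a, b; split.
- apply: teq_nat => n.
  have tt (X : metricType R) (u : nat -> nat -> X) (l : nat -> X) : (forall i k, (i < n0 + k)%N ->
      mdist (u k i) (l i) <= 2 * c * 2^-1 ^+ k) ->
      forall i : 'I_n, tends_to (fun k => u (n + k)%N i) (l i).
    move=> hu i d dd0.
    have [N hN] : exists k, 2^-1 ^+ k < d / 2 by apply: half_expr_lt; lra.
    exists N => k Nk.
    have ik : (i < n0 + (n + k))%N by have := ltn_ord i; lia.
    apply: le_lt_trans (hu _ _ ik) _.
    have h1 : 2^-1 ^+ (n + k) <= 2^-1 ^+ N :> R by apply: ler_wiXn2l; [lra|lra|lia].
    have h2 : c * 2^-1 ^+ (n + k) <= 2^-1 ^+ (n + k) :> R.
      by rewrite ler_piMl// ltW// half_expr_gt0.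
    rewrite -mulrA; lra.
  apply: (teq_limit (tt _ _ _ ha) (tt _ _ _ hb)) => k.
  by apply: teqn_le (stE (n + k)%N); lia.
- move=> i i0; have i0' : (i < n0 + 0)%N by rewrite addn0.
  have := ha i 0%N i0'; have := hb i 0%N i0'; rewrite expr0 mulr1 /=.
  by rewrite metric_sym (metric_sym (a0 i)) => h1 h2; split; lra.
- move=> k; have [_ _] := hnxt k _ (stE k).
  have ik : (n0 + k < n0 + k.+1)%N by lia.
  have := ha _ _ ik; have := hb _ _ ik; rewrite exprS mulrA -[2 * c * _]mulrA mulrCA.
  rewrite mulfV ?pnatr_eq0// mulr1.
  have h : c * 2^-1 ^+ k <= 2^-1 ^+ k :> R by rewrite ler_piMl// ltW// half_expr_gt0.
  rewrite /task_done /=; case: (task k) => z.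
    have := metric_triangle (a (n0 + k)%N) ((st k.+1).1 (n0 + k)%N) z.
    have := metric_sym (a (n0 + k)%N) ((st k.+1).1 (n0 + k)%N); rewrite /=; lra.
  have := metric_triangle (b (n0 + k)%N) ((st k.+1).2 (n0 + k)%N) z.
  have := metric_sym (b (n0 + k)%N) ((st k.+1).2 (n0 + k)%N); rewrite /=; lra.
Qed.

End BackAndForth.

(** * Homogeneity and universality *)

Section Homogeneity.
Context {R : realType} {L : language}.
Implicit Types (A B M : structure R L) (T U : @prestructure R L).
Variable K : structure R L -> Prop.

(** The embeddings obtained in both directions are inverse to each other on the
values of terms, which are dense. *)
Lemma isomorphism_of_teq A B (I : Type) (a : I -> A) (b : I -> B) :
  teq a b -> tdense a -> tdense b ->
  exists2 f : A -> B, isomorphism f & forall i, f (a i) = b i.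
Proof.
move=> ab da db; have [f ef fab] := embedding_extend ab da.
have [g eg gba] := embedding_extend (teq_sym ab) db.
have cancel_dense A' B' (u : A' -> B') (v : B' -> A') (c : I -> A') : embedding u ->
    embedding v -> (forall i, v (u (c i)) = c i) -> tdense c -> cancel u v.
  move=> eu ev vu dc x; apply: mdist_positivity; apply/le_anti; rewrite mdist_ge0 andbT.
  apply/ler_addgt0Pr => e e0; have [|t xt] := dc x (e / 2); first by lra.
  have vut : v (u (teval (T := pre A') c t)) = teval (T := pre A') c t.
    rewrite -(teval_pembedding _ _ ((embeddingP _).1 eu)).
    rewrite -(teval_pembedding _ _ ((embeddingP _).1 ev)).
    by congr teval; apply/funext.
  have := metric_triangle (v (u x)) (v (u (teval (T := pre A') c t))) x.
  rewrite (embedding_dist ev) (embedding_dist eu) vut.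
  have := metric_sym x (teval (T := pre A') c t); lra.
exists f => //; split=> //; exists g.
  by apply: (cancel_dense _ _ f g a) => // i; rewrite fab gba.
by apply: (cancel_dense _ _ g f b) => // i; rewrite gba fab.
Qed.

Lemma dense_tdense A (a : nat -> A) :
  (forall x (e : R), 0 < e -> exists n, mdist x (a n) < e) -> tdense a.
Proof. by move=> da x e e0; have [n xn] := da x e e0; exists (Var n). Qed.

Definition default_ext n (T : Type) (a : 'I_n -> T) (d : T) (i : nat) : T :=
  if insub i is Some j then a j else d.

Lemma default_ext_ord n (T : Type) (a : 'I_n -> T) (d : T) (i : 'I_n) :
  default_ext a d i = a i.
Proof. by rewrite /default_ext valK. Qed.

Lemma default_ext_ge n (T : Type) (a : 'I_n -> T) (d : T) i :
  (n <= i)%N -> default_ext a d i = d.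
Proof. by move=> ni; rewrite /default_ext insubF// ltnNge ni. Qed.

Lemma extension_step M T n (a : nat -> T) (b : nat -> M) (x : T) (e : R) :
  extension_property K M -> Kpre K T -> teqn n a b -> 0 < e ->
  exists b' : nat -> M,
    teqn n.+1 (default_ext (fun i : 'I_n => a i) x) b' /\
    forall i, (i < n)%N -> mdist (b' i) (b i) < e.
Proof.
move=> ext kT ab e0.
have [b' [c' [bc h]]] := ext _ 'I_1 T _ (fun=> x) _ e kT ab e0.
exists (default_ext b' (c' ord0)); split; last first.
  by move=> i i_n; rewrite -[i]/(val (Ordinal i_n)) default_ext_ord.
pose f (i : 'I_n.+1) : 'I_n + 'I_1 := if insub (val i) is Some j then inl j else inr ord0.
have := teq_sym (teq_reindex f bc).
congr teq; apply/funext => i; rewrite /f /default_ext;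
  by case: (insub (val i)).
Qed.

Lemma dense_task A B (s : nat -> A) (a : nat -> A) (b : nat -> B) n0
    (task : nat -> A + B) :
  (forall x (e : R), 0 < e -> exists n, mdist x (s n) < e) ->
  (forall i N, exists2 k, (N <= k)%N & task k = inl (s i)) ->
  (forall k, task_done (task k) (a (n0 + k)%N) (b (n0 + k)%N) (2^-1 ^+ k)) ->
  tdense a.
Proof.
move=> ds ht hd; apply: dense_tdense => x e e0.
have [|i xi] := ds x (e / 2); first by lra.
have [N hN] : exists k, 2^-1 ^+ k < e / 2 by apply: half_expr_lt; lra.
have [k Nk tk] := ht i N; exists (n0 + k)%N; have := hd k; rewrite tk /=.
have h1 : 2^-1 ^+ k <= 2^-1 ^+ N :> R by apply: ler_wiXn2l; [lra|lra|].
have := metric_triangle x (s i) (a (n0 + k)%N).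
have := metric_sym (s i) (a (n0 + k)%N); lra.
Qed.

(** An enumeration of the points of [s] and [t] with infinitely many repetitions:
the moves of the sequences only become small at late steps, so each point must
come back arbitrarily late. *)
Definition zigzag (A B : Type) (s : nat -> A) (t : nat -> B) (k : nat) : A + B :=
  match (unpickle k : option (nat * nat * bool)) with
  | Some (i, _, true) => inl (s i)
  | Some (i, _, false) => inr (t i)
  | None => inl (s 0%N)
  end.

Lemma zigzag_often (A B : Type) (s : nat -> A) (t : nat -> B) i N (c : bool) :
  exists2 k, (N <= k)%N & zigzag s t k = if c then inl (s i) else inr (t i).
Proof.
have [|j hj] := @injective_unbounded (fun j => pickle (i, j, c)) N.
  by move=> j j' /(pcan_inj pickleK) [].
by exists (pickle (i, j, c)) => //; rewrite /zigzag pickleK; case: c {hj}.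
Qed.

(** Going back and forth between dense sequences of [M] and [N]. *)
Lemma approximate_isomorphism M (N : structure R L) n (a0 : nat -> M) (b0 : nat -> N) (e : R) :
  separable_structure M -> separable_structure N ->
  extension_property K M -> extension_property K N ->
  Kpre K (pre M) -> Kpre K (pre N) -> teqn n a0 b0 -> 0 < e ->
  exists2 f : M -> N, isomorphism f & forall i, (i < n)%N -> mdist (f (a0 i)) (b0 i) < e.
Proof.
move=> sM sN extM extN kM kN ab0 e0.
have [s hs] := separable_dense_seq sM (a0 0%N).
have [t ht] := separable_dense_seq sN (b0 0%N).
have e2 : 0 < e / 2 by lra.
have [|a [b [ab hn hd]]] := back_and_forth (task := zigzag s t) e2 ab0.
  move=> k a b d d0 ab; case: (zigzag s t k) => x /=.
    have [b' [ab' h]] := extension_step x extN kM ab d0.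
    exists (default_ext (fun i : 'I_(n + k) => a i) x), b'; split=> //.
      move=> i ik; split; last exact: h.
      by rewrite -[i]/(val (Ordinal ik)) default_ext_ord mdistxx.
    by rewrite default_ext_ge// mdistxx.
  have [a' [ab' h]] := extension_step x extM kN (teq_sym ab) d0.
  exists a', (default_ext (fun i : 'I_(n + k) => b i) x); split.
  - exact: teq_sym.
  - move=> i ik; split; first exact: h.
    by rewrite -[i]/(val (Ordinal ik)) default_ext_ord mdistxx.
  - by rewrite default_ext_ge// mdistxx.
have da : tdense a.
  by apply: (dense_task hs _ hd) => i N'; exact: (zigzag_often s t i N' true).
have db : tdense b.
  apply: (@dense_task _ _ t b a n (fun k => match zigzag s t k with inl x => inr x | inr y => inl y end) ht).
    by move=> i N'; have [k Nk kE] := zigzag_often s t i N' false; exists k; rewrite ?kE.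
  by move=> k; have := hd k; case: (zigzag s t k).
have [f isof fab] := isomorphism_of_teq ab da db.
exists f => // i i_n; have [h1 h2] := hn i i_n.
have := metric_triangle (f (a0 i)) (f (a i)) (b0 i).
rewrite (embedding_dist isof.1) fab (metric_sym (a0 i)); lra.
Qed.

Hypothesis jep : JEP K.

(** The extension property over the empty tuple. *)
Lemma extension_realize M T (J : finType) (c : J -> T) :
  extension_property K M -> Kpre K (pre M) -> Kpre K T ->
  exists c' : J -> M, teq c' c.
Proof.
move=> ext kM kT.
have v : teq (of_void T) (of_void M) by apply: (teq_void _ _ jep kT kM) => -[].
have [b' [c' [bc _]]] := ext _ J T _ c _ 1 kT v ltr01.
by exists c'; exact: (teq_reindex inr bc).
Qed.

Lemma fg_embeds M A : extension_property K M -> Kpre K (pre M) ->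
  finitely_generated A -> Kpre K (pre A) -> embeds A M.
Proof.
move=> ext kM /finitely_generatedP [n [a da]] kA.
have [c ca] := extension_realize a ext kM kA.
by have [f ef _] := embedding_extend (teq_sym ca) da; exists f.
Qed.

(** Only the forth direction: all tasks are about [A]. *)
Lemma universality M A : extension_property K M -> K_structure K M ->
  separable_structure A -> K_structure K A -> embeds A M.
Proof.
move=> ext kM sA kA.
have kpA := K_structure_Kpre kA; have kpM := K_structure_Kpre kM.
have [[x0 _]|A0] := pselect (exists x : A, True); last first.
  apply: (fg_embeds ext kpM) => //; apply/finitely_generatedP.
  have a : 'I_0 -> A by case.
  by exists 0%N, a => x; case: A0; exists x.
have [c _] := extension_realize ((fun=> x0) : 'I_1 -> A) ext kpM kpA.
have v : teqn 0 (fun=> x0) (fun=> c ord0).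
  by apply: (teq_void _ _ jep kpA kpM) => -[].
have [s hs] := separable_dense_seq sA x0.
pose task k : A + M := match zigzag s s k with inl x => inl x | inr x => inl x end.
have [|a [b [ab hn hd]]] := back_and_forth (task := task) ltr01 v.
  move=> k a b d d0 ab; suff [x ->] : exists x, task k = inl x.
    have [b' [ab' h]] := extension_step x ext kpA ab d0.
    exists (default_ext (fun i : 'I_(0 + k) => a i) x), b'; split=> //=.
      move=> i ik; split; last exact: h.
      by rewrite -[i]/(val (Ordinal ik)) default_ext_ord mdistxx.
    by rewrite default_ext_ge// mdistxx.
  by rewrite /task; case: (zigzag s s k) => x; exists x.
have da : tdense a.
  apply: (dense_task hs _ hd) => i N'.
  by have [k Nk kE] := zigzag_often s s i N' true; exists k; rewrite // /task kE.
by have [f ef _] := embedding_extend ab da; exists f.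
Qed.

End Homogeneity.

(** * Ages of approximately ultra-homogeneous structures *)

Section ConvergingChoices.
Context {R : realType}.

(** Dependent choice in which the moves are summable, so that the chosen tuples
converge. *)
Lemma converging_choices (X : metricType R) (I : Type)
    (P : nat -> (I -> X) -> Prop) (t0 : I -> X) (c : R) :
  complete_metric X -> 0 <= c -> P 0%N t0 ->
  (forall k t, P k t -> exists t', P k.+1 t' /\
     forall i, mdist (t i) (t' i) <= c * 2^-1 ^+ k) ->
  exists (u : nat -> I -> X) (l : I -> X), [/\ u 0%N = t0, forall k, P k (u k) &
    forall k i, mdist (u k i) (l i) <= 2 * c * 2^-1 ^+ k].
Proof.
move=> cX c0 P0 step.
have [f hf] : {f : nat * (I -> X) -> (I -> X) | forall q, P q.1 q.2 ->
    P q.1.+1 (f q) /\ forall i, mdist (q.2 i) (f q i) <= c * 2^-1 ^+ q.1}.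
  apply: cid; suff /choice [f hf] : forall q : nat * (I -> X), exists t' : I -> X, P q.1 q.2 ->
      P q.1.+1 t' /\ forall i, mdist (q.2 i) (t' i) <= c * 2^-1 ^+ q.1 by exists f.
  move=> [k t]; have [Pt|nPt] := pselect (P k t); last by exists t.
  by have [t' h] := step k t Pt; exists t'.
pose u := fix u k := if k is k'.+1 then f (k', u k') else t0.
have Pu k : P k (u k) by elim: k => //= k IH; exact: (hf (k, u k) IH).1.
have [l hl] : {l : I -> X | forall i k, mdist (u k i) (l i) <= 2 * c * 2^-1 ^+ k}.
  apply: cid; suff /choice [l hl] : forall i, exists l, forall k, mdist (u k i) l <= 2 * c * 2^-1 ^+ k.
    by exists l.
  by move=> i; apply: complete_geometric => // k; exact: (hf (k, u k) (Pu k)).2.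
by exists u, l; split.
Qed.

End ConvergingChoices.

Section AgeOfHomogeneous.
Context {R : realType} {L : language}.
Implicit Types (A B C M : structure R L) (T U : @prestructure R L).

Lemma embedding_comp A B C (g : B -> C) (f : A -> B) :
  embedding g -> embedding f -> embedding (fun x => g (f x)).
Proof.
move=> eg ef; split=> *.
- by rewrite (embedding_dist eg) (embedding_dist ef).
- by rewrite -(embedding_pred ef) -(embedding_pred eg).
- by rewrite -(embedding_fun ef) -(embedding_fun eg).
Qed.

Lemma embedding_id A : embedding (fun x : A => x).
Proof. by []. Qed.

Lemma fg_of_tdense A (I : finType) (a : I -> A) : tdense a -> finitely_generated A.
Proof.
move=> da; apply/finitely_generatedP; exists #|I|, (fun j : 'I_#|I| => a (enum_val j)).
apply: (@tdense_comp _ _ _ _ _ _ (fun i : I => enum_rank i)).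
by under eq_fun do rewrite enum_rankK.
Qed.

Lemma extension_ultrahomogeneous K M : separable_structure M ->
  extension_property K M -> Kpre K (pre M) -> approximately_ultrahomogeneous M.
Proof.
move=> sM ext kM phi e e0.
have [[m0 _]|M0] := pselect (exists x : M, True); last first.
  exists (fun x => x); first by split; [exact: embedding_id|exists id].
  by move=> a; case: M0; exists (val a).
have [n [a [b [ab phiE]]]] := teq_of_finite_partial_iso phi.
have ab' : teqn n (default_ext a m0) (default_ext b m0).
  by move: ab; congr teq; apply/funext => i; rewrite default_ext_ord.
have [f isof hf] := approximate_isomorphism sM sM ext ext kM kM ab' e0.
exists f => // x; have [i <- <-] := phiE x; rewrite metric_sym.
by have := hf i (ltn_ord i); rewrite !default_ext_ord.
Qed.

Lemma generated_tuple_of K T n (t : 'I_n -> T) : HP K -> Kpre K T ->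
  exists g : generated_tuple K n, teq (gt_tuple g) t.
Proof.
move=> hp kT; have [C [KC [c ct]]] := kT _ t.
have [G [g [dg GC gc]]] := tuple_structure c.
have KG : K G by apply: K_embeds GC KC => //; exact: fg_of_tdense dg.
exists (GeneratedTuple KG ((tdenseP g).1 dg)); exact: teq_trans ct.
Qed.

Lemma age_HP M : HP (age M).
Proof.
move=> A [_ [f ef]] B [fB [g eg]]; split=> //.
by exists (fun x => f (g x)); exact: embedding_comp.
Qed.

Lemma age_structure M : K_structure (age M) M.
Proof. by []. Qed.

Lemma age_JEP M : JEP (age M).
Proof.
move=> A B [/finitely_generatedP [n [a da]] [f ef]] [/finitely_generatedP [m [b db]] [g eg]].
have [G [z [dz GM zt]]] := tuple_structure (tsum (fun i => f (a i)) (fun i => g (b i))).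
exists G; split; first by split=> //; exact: fg_of_tdense dz.
- have [|h eh _] := @embedding_extend _ _ _ G _ a (fun i => z (inl i)) _ da.
    exact: teq_trans (teq_sym (teq_embedding a ef)) (teq_sym (teq_reindex inl zt)).
  by exists h.
- have [|h eh _] := @embedding_extend _ _ _ G _ b (fun i => z (inr i)) _ db.
    exact: teq_trans (teq_sym (teq_embedding b eg)) (teq_sym (teq_reindex inr zt)).
  by exists h.
Qed.

(** Embed both structures in [M]; an automorphism of [M] then brings the images of
the domain and of the range of [phi] close to each other.  The subtuples [x] and
[y] are adjoined to the generators so that their distance is recorded in the
type of the generating tuple. *)
Lemma age_NAP M : approximately_ultrahomogeneous M -> NAP (age M).
Proof.
move=> auh A B [/finitely_generatedP [n [a da]] [f ef]] [/finitely_generatedP [m [b db]] [g eg]].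
move=> phi e e0; have [k [x [y [xy phiE]]]] := teq_of_finite_partial_iso phi.
have fgxy : teq (fun i => f (x i)) (fun i => g (y i)).
  apply: teq_trans (teq_embedding x ef) (teq_trans xy _).
  exact/teq_sym/(teq_embedding y eg).
have [psi [_ psiE]] := finite_partial_iso_of_teq fgxy.
have [F [eF _] hF] := auh psi e e0.
have [G [z [dz GM zt]]] := tuple_structure
  (tsum (fun s => F (f (tsum a x s))) (fun s => g (tsum b y s))).
exists G; split; first by split=> //; exact: fg_of_tdense dz.
have [||p ep pE] := @embedding_extend _ _ _ G _ (tsum a x) (fun i => z (inl i)).
- apply: teq_trans (teq_sym (teq_embedding (tsum a x) ef)) _.
  apply: teq_trans (teq_sym (teq_embedding (fun s => f (tsum a x s)) eF)) _.
  exact/teq_sym/(teq_reindex inl zt).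
- exact: (@tdense_comp _ _ _ _ _ (tsum a x) inl).
have [||q eq qE] := @embedding_extend _ _ _ G _ (tsum b y) (fun i => z (inr i)).
- apply: teq_trans (teq_sym (teq_embedding (tsum b y) eg)) _.
  exact/teq_sym/(teq_reindex inr zt).
- exact: (@tdense_comp _ _ _ _ _ (tsum b y) inl).
exists p, q; split=> // u; have [i <- <-] := phiE u.
have := pE (inr i); have := qE (inr i); rewrite /= => -> ->.
have /= -> := teq_dist (inl (inr i)) (inr (inr i)) zt.
by have [v vE gE] := psiE i; rewrite -vE -gE metric_sym; exact/ltW/hF.
Qed.

(** Distances of types are attained in [M] over any realization of the first
type. *)
Lemma near_realize K M T U (I : finType) (x : I -> T) (y : I -> U) (t : I -> M) (r s : R) :
  HP K -> extension_property K M -> near K r x y -> teq t x -> r < s ->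
  exists t' : I -> M, teq t' y /\ forall i, mdist (t' i) (t i) < s.
Proof.
move=> hp ext [C [KC [x' [y' [xx yy xy]]]]] tx rs.
have e0 : 0 < s - r by lra.
have [b [c [bc bt]]] := ext _ _ _ x' y' t _ (K_Kpre hp KC) (teq_trans xx (teq_sym tx)) e0.
exists c; split; first exact: teq_trans (teq_reindex inr bc) yy.
move=> i; have /= h := teq_dist (inl i) (inr i) bc.
have := bt i; have := xy i; have := metric_triangle (c i) (b i) (t i).
have := metric_sym (c i) (b i); lra.
Qed.

(** Types are realized in [M], so tuples of a dense sequence give a dense family.
A subsequence of a Cauchy sequence of types is realized by tuples that converge
in [M], by [near_realize], and the type of the limit is a limit of the types. *)
Lemma extension_PP K M : HP K -> JEP K -> NAP K -> separable_structure M ->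
  extension_property K M -> Kpre K (pre M) -> PP K.
Proof.
move=> hp jep nap sM ext kM n; split.
- have [[m0 _]|M0] := pselect (exists x : M, True); last first.
    have [[x0 _]|no] := pselect (exists x : generated_tuple K n, True); last first.
      by exists (fun=> None) => x; case: no; exists x.
    exists (fun=> Some x0) => x e e0; exists 0%N, x0; split=> //.
    apply/dK_near => //; have kx := K_Kpre hp (gt_in x).
    have h : near K e (gt_tuple x) (gt_tuple x).
      by apply: near_same => // i; rewrite /= mdistxx.
    apply: near_teq (teq_refl _) _ h.
    apply: (teq_void _ _ jep kx (K_Kpre hp (gt_in x0))) => i; apply: M0.
    by have [c _] := extension_realize jep (gt_tuple x) ext kM kx; exists (c i).
  have [s hs] := separable_dense_seq sM m0.
  have /choice [g hg] (w : seq nat) : exists g : generated_tuple K n,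
      teq (gt_tuple g) (fun i : 'I_n => s (nth 0%N w i)).
    exact: generated_tuple_of.
  exists (fun k => omap g (unpickle k)) => x e e0.
  have [t tx] := extension_realize jep (gt_tuple x) ext kM (K_Kpre hp (gt_in x)).
  have [w hw] := choice (fun i => hs (t i) e e0).
  pose w' := [tuple w i | i < n].
  exists (pickle (w' : seq nat)), (g w'); split; first by rewrite pickleK.
  apply/dK_near => //; apply: near_teq tx (teq_sym (hg w')) _.
  apply: near_same => // i.
  by have := hw i; rewrite -[w i](tnth_mktuple w) (tnth_nth 0%N).
- move=> u cu.
  have /choice [N hN] (k : nat) : exists N, forall m m', (N <= m)%N -> (N <= m')%N ->
      near K (2^-1 ^+ k) (gt_tuple (u m)) (gt_tuple (u m')).
    have [N hN] := cu _ (half_expr_gt0 k); exists N => m m' h1 h2.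
    by apply/dK_near => //; exact: hN.
  (* monotone, so that consecutive terms of the subsequence are comparable *)
  pose N' := fix N' k := if k is k'.+1 then maxn (N' k') (N k) else N 0%N.
  have NN' k : (N k <= N' k)%N by case: k => //= k; exact: leq_maxr.
  have NS k : (N' k <= N' k.+1)%N by exact: leq_maxl.
  have [t0 ht0] := extension_realize jep (gt_tuple (u (N' 0%N))) ext kM (K_Kpre hp (gt_in _)).
  have [||v [l [_ hv hl]]] := converging_choices (c := 2)
    (P := fun k t => teq (T := pre M) t (gt_tuple (u (N' k)))) (@carrier_complete _ _ M) _ ht0.
  + by [].
  + move=> k t tk; have h : near K (2^-1 ^+ k) (gt_tuple (u (N' k))) (gt_tuple (u (N' k.+1))).
      by apply: hN => //; exact: leq_trans (NS k).
    have [|t' [t'k tt']] := near_realize hp ext h tk (s := 2 * 2^-1 ^+ k).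
      by have := @half_expr_gt0 R k; lra.
    by exists t'; split=> // i; rewrite metric_sym; exact/ltW/tt'.
  have [g gl] := generated_tuple_of l hp kM.
  exists g => e e0; have [k hk] : exists k, 2^-1 ^+ k < e / 12 by apply: half_expr_lt; lra.
  exists (N k) => m Nm; apply/dK_near => //.
  apply: near_teq (teq_refl _) (teq_sym gl) _.
  apply: (@near_triangle _ _ K hp nap (2^-1 ^+ k) (6 * 2^-1 ^+ k) _ _ _ _ _ _ (gt_tuple (u (N' k)))).
  + exact: K_Kpre (gt_in _).
  + exact: hN.
  + apply: near_teq (hv k) (teq_refl _) _.
    apply: near_same => // i; apply: le_lt_trans (hl k i) _.
    have := @half_expr_gt0 R k; lra.
  + have := @half_expr_gt0 R k; lra.
Qed.

Definition ext_terms (F : fun_symb L) m (i : 'I_(fun_arity F + m + 1)) :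
    term (L := L) 'I_(fun_arity F + m) :=
  match fintype.split i with
  | inl j => Var j
  | inr _ => App (fun k => Var (lshift m k))
  end.

Lemma ext_tupleE A (F : fun_symb L) m (c : 'I_(fun_arity F + m) -> A) :
  ext_tuple c = (fun i => teval (T := pre A) c (ext_terms i)).
Proof. by apply/funext => i; rewrite /ext_tuple /ext_terms; case: (fintype.split i). Qed.

(** Types close to the type of [t] are realized by tuples close to [t], where the
interpretations in [M] are continuous. *)
Lemma extension_CP K M : HP K -> JEP K -> NAP K ->
  extension_property K M -> Kpre K (pre M) -> CP K.
Proof.
move=> hp jep nap ext kM.
have real n (x : generated_tuple K n) := extension_realize jep (gt_tuple x) ext kM (K_Kpre hp (gt_in x)).
split.
- move=> x e e0; exists (e / 2); first by lra.
  have e2 : 0 < e / 2 by lra.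
  move=> y /(dK_near hp nap x y e2) [C [KC [x' [y' [xx yy xy]]]]].
  rewrite /dR lte_fin /gt_dist.
  have /= <- := teq_dist ord0 ord_max xx; have /= <- := teq_dist ord0 ord_max yy.
  have := xy ord0; have := xy ord_max; rewrite ltr_norml.
  have := metric_triangle (x' ord0) (y' ord0) (x' ord_max).
  have := metric_triangle (y' ord0) (y' ord_max) (x' ord_max).
  have := metric_triangle (y' ord0) (x' ord0) (y' ord_max).
  have := metric_triangle (x' ord0) (x' ord_max) (y' ord_max).
  have := metric_sym (x' ord0) (y' ord0); have := metric_sym (x' ord_max) (y' ord_max); lra.
- move=> P x e e0; have [t tx] := real _ x.
  have [d d0 hd] := @pred_box _ _ M P t e e0.
  exists (d / 2); first by lra.
  have d2 : 0 < d / 2 by lra.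
  move=> y /(dK_near hp nap x y d2) xy.
  have [|t' [t'y tt']] := near_realize hp ext xy tx (s := d); first by lra.
  have := hd t' (fun i => _); rewrite mdistRE /dR lte_fin /gt_pred.
  have /= -> := tx.2 P (fun j => Var j); have /= -> := t'y.2 P (fun j => Var j).
  by apply=> i; rewrite metric_sym.
- move=> F m x e e0; have [t tx] := real _ x.
  have [d d0 hd] := @fun_box _ _ M F (fun k => t (lshift m k)) e e0.
  have r0 : 0 < Num.min d e by rewrite lt_min d0.
  exists (Num.min d e / 2); first by lra.
  have d2 : 0 < Num.min d e / 2 by lra.
  move=> y /(dK_near hp nap x y d2) xy.
  have [|t' [t'y tt']] := near_realize hp ext xy tx (s := Num.min d e); first by lra.
  apply/dK_near => //.
  apply: (near_teq (a := ext_tuple t) (b := ext_tuple t')).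
  + by rewrite /= !ext_tupleE; exact: teq_terms.
  + by rewrite /= !ext_tupleE; exact: teq_terms.
  + apply: near_same => // i; rewrite /= /ext_tuple; case: (fintype.split i) => [j|_].
      by rewrite metric_sym; exact: lt_minr (tt' j).
    by apply: hd => k; rewrite metric_sym; exact: lt_minl (tt' _).
Qed.

End AgeOfHomogeneous.

(** * Continuity of terms and completion in a Fraisse class *)

Section FraisseContinuity.
Context {R : realType} {L : language}.
Implicit Types (A B C M : structure R L) (T U : @prestructure R L).
Variable K : structure R L -> Prop.
Hypotheses (hp : HP K) (nap : NAP K) (hCP : CP K).

Lemma finite_min (I : finType) (f : I -> R) : (forall i, 0 < f i) ->
  exists2 d : R, 0 < d & forall i, d <= f i.
Proof.
move=> f0; exists (\big[Num.min/1]_i f i); last by move=> i; exact: bigmin_le.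
by apply: (big_ind (fun x => 0 < x)) => // x y x0 y0; rewrite lt_min x0.
Qed.

Definition snoc_tuple n (X : Type) (x : 'I_n -> X) (z : X) (j : 'I_(n + 1)) : X :=
  match fintype.split j with inl k => x k | inr _ => z end.

Lemma snoc_lshift n (X : Type) (x : 'I_n -> X) (z : X) k :
  snoc_tuple x z (lshift 1 k) = x k.
Proof. by rewrite /snoc_tuple (unsplitK (inl k)). Qed.

Lemma snoc_rshift n (X : Type) (x : 'I_n -> X) (z : X) k :
  snoc_tuple x z (rshift n k) = z.
Proof. by rewrite /snoc_tuple (unsplitK (inr k)). Qed.

Lemma complete_real : @complete_metric R R^o.
Proof.
move=> u cu; exists (lim (u @ \oo)).
exact: (R_complete (fmap_proper_filter _ eventually_filter) cu).
Qed.

(** CP says that the type of [(y, z, F y)] is close to the type of [(l, z0, F l)]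
when the type of [(y, z)] is close to that of [(l, z0)].  Taking [z0 = F l] and
[z = F x], where [x] is a realization of the type of [l] close to [y], the
distance from [F x] to [F y] is a distance of coordinates of the first triple,
hence close to the distance zero from [F l] to [F l].  The bound [d] depends
only on the type of [l]; it is not uniform in [l]. *)
Lemma uc_fun (F : fun_symb L) T (l : 'I_(fun_arity F) -> T) (e : R) :
  Kpre K T -> 0 < e -> exists2 d : R, 0 < d & forall C, K C ->
  forall x y : 'I_(fun_arity F) -> C, teq x l ->
    (forall i, mdist (x i) (y i) < d) ->
    mdist (@pfun _ _ (pre C) F x) (@pfun _ _ (pre C) F y) < e.
Proof.
move=> kT e0; have [_ _ cF] := hCP.
have snocE U (z : 'I_(fun_arity F) -> U) :
    snoc_tuple z (@pfun _ _ U F z) = fun j => teval z (snoc_tuple (@Var _ _) (App (@Var _ _)) j).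
  by apply/funext => j; rewrite /snoc_tuple; case: (fintype.split j).
have [g gl] := generated_tuple_of (snoc_tuple l (@pfun _ _ T F l)) hp kT.
have e2 : 0 < e / 2 by lra.
have [r r0 hr] := cF F 1%N g _ e2; exists r => // C KC x y xl xy.
have kC := K_Kpre hp KC.
have [g' gw] := generated_tuple_of (T := pre C) (snoc_tuple y (@pfun _ _ (pre C) F x)) hp kC.
have /hr /(dK_near hp nap _ _ e2) [D [KD [p [q [pg qg pq]]]]] : (dK g g' < r%:E)%E.
  apply/dK_near => //; apply: (@near_teq _ _ K r (pre C) _ (pre C) _ _ (snoc_tuple x (@pfun _ _ (pre C) F x))).
  - apply: teq_trans (teq_sym gl); rewrite !snocE; exact: teq_terms.
  - exact: (teq_sym gw).
  - apply: near_same => // j; rewrite /snoc_tuple; case: (fintype.split j) => [k|_]; first exact: xy.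
    by rewrite /= mdistxx.
(* the coordinates of the parameter [z] and of the value of [F] *)
pose par : 'I_(fun_arity F + 1 + 1) := lshift 1 (rshift (fun_arity F) ord0).
pose vl : 'I_(fun_arity F + 1 + 1) := rshift (fun_arity F + 1) ord0.
pose s : term (L := L) 'I_(fun_arity F + 1) := Var (rshift (fun_arity F) ord0).
pose t : term (L := L) 'I_(fun_arity F + 1) := App (fun k => Var (lshift 1 k)).
have extE (h : generated_tuple K (fun_arity F + 1)) U (c : 'I_(fun_arity F + 1) -> U)
    (E : structure R L) (w : 'I_(fun_arity F + 1 + 1) -> E) :
    teq (gt_tuple h) c -> teq w (gt_tuple (gt_ext h)) ->
    mdist (w par) (w vl) = pdist (teval c s) (teval c t).
  move=> hc wh; have /= -> := teq_dist par vl wh.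
  rewrite /ext_tuple /par /vl (unsplitK (inl _)) (unsplitK (inr _)).
  exact: (hc.1 s t).
have := extE _ _ _ _ _ gl pg; have := extE _ _ _ _ _ gw qg.
rewrite /= !snoc_rshift.
have fE U (z : 'I_(fun_arity F) -> U) v : (fun k => snoc_tuple z v (lshift 1 k)) = z.
  by apply/funext => k; rewrite snoc_lshift.
rewrite !fE => h1 h2; move: h1.
have h0 : pdist (@pfun _ _ T F l) (@pfun _ _ T F l) = 0.
  by have := xl.1 (App (@Var _ _)) (App (@Var _ _)); rewrite /= mdistxx.
rewrite h0 in h2; move=> <-; have := metric_triangle (q par) (p par) (q vl).
have := metric_triangle (p par) (p vl) (q vl).
have := pq par; have := pq vl; have := metric_sym (p par) (q par); lra.
Qed.

(** By induction from [uc_fun], applied at the type of the values of the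
subterms. *)
Lemma uc_term (I : Type) (t : term (L := L) I) T (l : I -> T) (e : R) :
  Kpre K T -> 0 < e -> exists2 d : R, 0 < d & forall C, K C ->
  forall x y : I -> C, teq x l -> (forall i, mdist (x i) (y i) < d) ->
    mdist (teval (T := pre C) x t) (teval (T := pre C) y t) < e.
Proof.
move=> kT; elim: t e => [i|F ts IH] e e0; first by exists e => // C _ x y _ xy; exact: xy.
have [d d0 hd] := uc_fun (fun j => teval l (ts j)) kT e0.
have /choice [f hf] j : exists dj : R, 0 < dj /\ forall C, K C ->
    forall x y : I -> C, teq x l -> (forall i, mdist (x i) (y i) < dj) ->
    mdist (teval (T := pre C) x (ts j)) (teval (T := pre C) y (ts j)) < d.
  by have [dj dj0 hdj] := IH j d d0; exists dj.
have [r r0 hr] := finite_min (fun j => (hf j).1).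
exists r => // C KC x y xl xy; apply: (hd C KC); first exact: teq_terms.
by move=> j; apply: (hf j).2 => // i; exact: lt_le_trans (xy i) (hr j).
Qed.

Lemma near_term_dist (I : finType) (s t : term (L := L) I) T (l : I -> T) (e : R) :
  Kpre K T -> 0 < e -> exists2 d : R, 0 < d & forall U (y : I -> U), near K d l y ->
    `|pdist (teval l s) (teval l t) - pdist (teval y s) (teval y t)| < e.
Proof.
move=> kT e0; have e2 : 0 < e / 2 by lra.
have [d1 d10 h1] := uc_term s l kT e2; have [d2 d20 h2] := uc_term t l kT e2.
exists (Num.min d1 d2); first by rewrite lt_min d10.
move=> U y [C [KC [x' [y' [xl yy xy]]]]].
have {}h1 := h1 C KC x' y' xl (fun i => lt_minl (xy i)).
have {}h2 := h2 C KC x' y' xl (fun i => lt_minr (xy i)).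
rewrite -(xl.1 s t) -(yy.1 s t) /=.
move: (teval x' s) (teval x' t) (teval y' s) (teval y' t) h1 h2 => a b c d h1 h2.
have := metric_triangle a c b; have := metric_triangle c d b.
have := metric_triangle c a d; have := metric_triangle a b d.
have := metric_sym a c; have := metric_sym b d; rewrite ltr_norml; lra.
Qed.

Lemma near_pred (I : finType) P (ts : 'I_(pred_arity P) -> term (L := L) I) T (l : I -> T) (e : R) :
  Kpre K T -> 0 < e -> exists2 d : R, 0 < d & forall U (y : I -> U), near K d l y ->
    `|@ppred _ _ T P (fun j => teval l (ts j)) - @ppred _ _ U P (fun j => teval y (ts j))| < e.
Proof.
move=> kT e0; have [_ cP _] := hCP.
have [g gl] := generated_tuple_of (fun j => teval l (ts j)) hp kT.
have [r r0 hr] := cP P g _ e0.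
have /choice [f hf] j : exists dj : R, 0 < dj /\ forall C, K C ->
    forall x y : I -> C, teq x l -> (forall i, mdist (x i) (y i) < dj) ->
    mdist (teval (T := pre C) x (ts j)) (teval (T := pre C) y (ts j)) < r.
  by have [dj dj0 hdj] := uc_term (ts j) l kT r0; exists dj.
have [d d0 hd] := finite_min (fun j => (hf j).1).
exists d => // U y [C [KC [x' [y' [xl yy xy]]]]].
have kC := K_Kpre hp KC.
have [g' gy] := generated_tuple_of (T := pre C) (fun j => teval (T := pre C) y' (ts j)) hp kC.
have /hr : (dK g g' < r%:E)%E.
  apply/dK_near => //.
  apply: (@near_teq _ _ K r (pre C) _ (pre C) _ _ (fun j => teval (T := pre C) x' (ts j))).
  - exact: teq_trans (teq_terms _ xl) (teq_sym gl).
  - exact: teq_sym gy.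
  - apply: near_same => // j; apply: (hf j).2 => // i; exact: lt_le_trans (xy i) (hd j).
rewrite /dR lte_fin /gt_pred.
have /= -> := gl.2 P (fun j => Var j); have /= -> := gy.2 P (fun j => Var j).
by have /= -> := yy.2 P ts.
Qed.

(** Types at distance zero are equal, since the values of terms depend
continuously on the type. *)
Lemma teq_of_near (I : finType) T U (a : I -> T) (b : I -> U) : Kpre K T ->
  (forall e : R, 0 < e -> near K e a b) -> teq a b.
Proof.
move=> kT ab; split=> [s t|P ts]; apply/eqP; rewrite -subr_eq0 -normr_le0;
  apply/ler_addgt0Pr => e e0; rewrite add0r.
- have [d d0 hd] := near_term_dist s t a kT e0; exact/ltW/hd/ab.
- have [d d0 hd] := near_pred ts a kT e0; exact/ltW/hd/ab.
Qed.

Lemma Kpre_distxx T (x : T) : Kpre K T -> pdist x x = 0.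
Proof.
move=> kT; have [C [_ [c cx]]] := kT 1%N (fun=> x).
by have /= <- := teq_dist ord0 ord0 cx; rewrite mdistxx.
Qed.

Lemma Kpre_dist_sym T (x y : T) : Kpre K T -> pdist x y = pdist y x.
Proof.
move=> kT; have [C [_ [c cx]]] := Kpre_fin (fun b : bool => if b then x else y) kT.
have /= <- := teq_dist true false cx; have /= <- := teq_dist false true cx.
exact: metric_sym.
Qed.

Lemma Kpre_dist_triangle T (y x z : T) : Kpre K T -> pdist x z <= pdist x y + pdist y z.
Proof.
move=> kT; have [C [_ [c cx]]] := Kpre_fin (fun o : option bool =>
  match o with Some true => x | Some false => y | None => z end) kT.
have /= <- := teq_dist (Some true) None cx; have /= <- := teq_dist (Some true) (Some false) cx.
have /= <- := teq_dist (Some false) None cx; exact: metric_triangle.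
Qed.

Hypothesis hPP : PP K.

(** Tuples of [T] that converge to [c] have a Cauchy sequence of types, to which
completeness of [dK] applies. *)
Lemma limit_type T (N : metricType R) (i : T -> N) n (c : 'I_n -> N) : Kpre K T ->
  (forall x y, mdist (i x) (i y) = pdist x y) -> dense_map i ->
  exists l : generated_tuple K n, forall r : R, 0 < r -> exists2 d : R, 0 < d &
    forall s : 'I_n -> T, (forall j, mdist (c j) (i (s j)) < d) -> near K r (gt_tuple l) s.
Proof.
move=> kT di dd.
have /choice [s hs] (k : nat) : exists s : 'I_n -> T, forall j, mdist (c j) (i (s j)) < 2^-1 ^+ k.
  have [s hs] := choice (fun j => dd (c j) _ (half_expr_gt0 k)); by exists s.
have /choice [u hu] k : exists u : generated_tuple K n, teq (gt_tuple u) (s k).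
  exact: generated_tuple_of.
have dist2 (t t' : 'I_n -> T) (d d' : R) j : mdist (c j) (i (t j)) < d ->
    mdist (c j) (i (t' j)) < d' -> pdist (t j) (t' j) < d + d'.
  rewrite -di => h1 h2; have := metric_triangle (i (t j)) (c j) (i (t' j)).
  have := metric_sym (i (t j)) (c j); lra.
have [_ complete] := hPP n.
have [|l hl] := complete u.
  move=> e e0; have [N' hN'] : exists k, 2^-1 ^+ k < e / 2 by apply: half_expr_lt; lra.
  exists N' => m m' h1 h2; apply/dK_near => //.
  apply: near_teq (teq_sym (hu m)) (teq_sym (hu m')) _; apply: near_same => // j.
  apply: lt_trans (dist2 _ _ _ _ _ (hs m j) (hs m' j)) _.
  have hh k : (N' <= k)%N -> 2^-1 ^+ k <= 2^-1 ^+ N' :> R by move=> ?; apply: ler_wiXn2l; [lra|lra|].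
  have := hh _ h1; have := hh _ h2; lra.
exists l => r r0; have r4 : 0 < r / 4 by lra.
have [N1 hN1] := hl _ r4; have [N2 hN2] := half_expr_lt r4.
exists (r / 4) => // t ht; pose k := maxn N1 N2.
have hk : 2^-1 ^+ k <= 2^-1 ^+ N2 :> R by apply: ler_wiXn2l; [lra|lra|exact: leq_maxr].
apply: (@near_triangle _ _ K hp nap (r / 4) (r / 2) _ _ _ _ _ _ (gt_tuple (u k))).
- exact: K_Kpre (gt_in l).
- by apply/near_sym/(dK_near hp nap _ _ r4)/hN1/leq_maxl.
- apply: near_teq (teq_sym (hu k)) (teq_refl _) _; apply: near_same => // j.
  apply: lt_trans (dist2 _ _ _ _ _ (hs k j) (ht j)) _; lra.
- lra.
Qed.

(** At a tuple [c] of the completion, take the limit type [l] of [c].  Two tuples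
of [T] close to [c] can be moved, together, into a member of [K] where both are
close to a realization of [l]; [uc_fun] then bounds the distance between the
values of the symbol.  This is the hypothesis of [extend_continuous].  Finally
[c] has type [l], which makes the completion a [K]-structure. *)
Lemma completion_structure T : Kpre K T -> exists (M : structure R L) (i : T -> M),
  [/\ pembedding (U := pre M) i, dense_map i & K_structure K M].
Proof.
move=> kT.
have Dxx x := @Kpre_distxx T x kT; have Dsym x y := @Kpre_dist_sym T x y kT.
have Dtri y x z := @Kpre_dist_triangle T y x z kT.
have [N [i [cN di dd]]] := exists_completion Dxx Dsym Dtri.
have near_split (n : nat) (l : generated_tuple K n) (r d : R) (s t : 'I_n -> T) :
    near K r (gt_tuple l) s -> (forall j, pdist (s j) (t j) < d) -> r < d ->
    exists C, K C /\ exists (l' : 'I_n -> C) (z : 'I_n + 'I_n -> C),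
      [/\ teq l' (gt_tuple l), teq z (tsum s t), forall j, mdist (l' j) (z (inl j)) < d
        & forall j, mdist (l' j) (z (inr j)) < 2 * d].
  move=> ls st rd.
  have [C [KC [l' [z [ll zst lz]]]]] := near_amalgam (a := gt_tuple l) (b := tsum s t)
    (f := id) (g := inl) hp nap (K_Kpre hp (gt_in l)) kT ls rd.
  exists C; split=> //; exists l', z; split=> // j.
  have /= h := teq_dist (inl j) (inr j) zst.
  have := metric_triangle (l' j) (z (inl j)) (z (inr j)); have := lz j; have := st j.
  rewrite /= h; lra.
have near_both (n : nat) (c : 'I_n -> N) (d : R) (s t : 'I_n -> T) :
    (forall j, mdist (c j) (i (s j)) < d) -> (forall j, mdist (c j) (i (t j)) < d) ->
    forall j, pdist (s j) (t j) < 2 * d.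
  move=> h1 h2 j; have := h1 j; have := h2 j; rewrite -di.
  have := metric_triangle (i (s j)) (c j) (i (t j)).
  have := metric_sym (i (s j)) (c j); lra.
have exF (F : fun_symb L) : exists f : ('I_(fun_arity F) -> N) -> N,
    box_continuous f /\ forall t, f (fun j => i (t j)) = i (@pfun _ _ T F t).
  apply: extend_continuous => // c e e0; have e2 : 0 < e / 2 by lra.
  have [l hl] := limit_type c kT di dd.
  have [d d0 hd] := uc_fun (gt_tuple l) (K_Kpre hp (gt_in l)) e2.
  have d4 : 0 < d / 4 by lra.
  have [r r0 hr] := hl _ d4.
  exists (Num.min r (d / 4)); first by rewrite lt_min r0.
  move=> s t hs ht; rewrite di.
  have [|||C [KC [l' [z [ll zst h1 h2]]]]] := @near_split _ l (d / 4) (d / 2) s t.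
  - by apply: hr => j; exact: lt_minl (hs j).
  - have := near_both _ c (d / 4) s t (fun j => lt_minr (hs j)) (fun j => lt_minr (ht j)).
    by move=> h j; apply: lt_le_trans (h j) _; lra.
  - lra.
  have dd2 : d / 2 < d by lra.
  have h3 := hd C KC l' (fun j => z (inl j)) ll (fun j => lt_trans (h1 j) dd2).
  have h4 : mdist (@pfun _ _ (pre C) F l') (@pfun _ _ (pre C) F (fun j => z (inr j))) < e / 2.
    by apply: hd => // j; apply: lt_le_trans (h2 j) _; lra.
  have /= <- := zst.1 (App (fun j => Var (inl j))) (App (fun j => Var (inr j))).
  have := metric_triangle (@pfun _ _ (pre C) F (fun j => z (inl j)))
    (@pfun _ _ (pre C) F l') (@pfun _ _ (pre C) F (fun j => z (inr j))).
  have := metric_sym (@pfun _ _ (pre C) F l') (@pfun _ _ (pre C) F (fun j => z (inl j))).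
  move: h3 h4 => /=; lra.
have exP (P : pred_symb L) : exists f : ('I_(pred_arity P) -> N) -> R^o,
    box_continuous f /\ forall t, f (fun j => i (t j)) = @ppred _ _ T P t.
  apply: extend_continuous => //; first exact: complete_real.
  move=> c e e0; have e2 : 0 < e / 2 by lra.
  have [l hl] := limit_type c kT di dd.
  have [d d0 hd] := near_pred (fun j => Var j) (gt_tuple l) (K_Kpre hp (gt_in l)) e2.
  have [r r0 hr] := hl _ d0; exists r => // s t hs ht; rewrite mdistRE.
  have h1 := hd _ _ (hr s hs); have h2 := hd _ _ (hr t ht).
  move: h1 h2; rewrite /= !ltr_norml; lra.
pose FI F : {ptws 'I_(fun_arity F) -> N} -> N := projT1 (cid (exF F)).
pose PI P : {ptws 'I_(pred_arity P) -> N} -> R := projT1 (cid (exP P)).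
have cF F : continuous (@FI F).
  by apply/box_continuousP; rewrite /FI; case: (cid (exF F)) => f [].
have cP P : continuous (@PI P).
  by apply/(@box_continuousP R _ N R^o); rewrite /PI; case: (cid (exP P)) => f [].
pose M := @Structure R L N cN PI cP FI cF.
exists M, i.
have ei : pembedding (U := pre M) i.
  split=> //.
  - by move=> P a; rewrite /= /PI; case: (cid (exP P)) => f [].
  - by move=> F a; rewrite /= /FI; case: (cid (exF F)) => f [].
split=> //; apply: Kpre_K_structure => // n c.
have [l hl] := @limit_type T N i n c kT di dd.
exists (gt_struct l); split; first exact: gt_in.
exists (gt_tuple l).
have /choice [s hs] (k : nat) : exists s : 'I_n -> T, forall j, mdist (c j) (i (s j)) < 2^-1 ^+ k.
  have [s hs] := choice (fun j => dd (c j) _ (half_expr_gt0 k)); by exists s.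
have sc j : tends_to (fun k => i (s k j)) (c j).
  move=> e e0; have [N' hN'] := half_expr_lt e0; exists N' => k Nk.
  rewrite metric_sym; apply: lt_trans (hs k j) _; apply: le_lt_trans hN'.
  by apply: ler_wiXn2l => //; lra.
have near_s (r : R) : 0 < r -> exists N', forall k, (N' <= k)%N -> near K r (gt_tuple l) (s k).
  move=> /hl [d d0 hd]; have [N' hN'] := half_expr_lt d0; exists N' => k Nk.
  apply: hd => j; apply: lt_trans (hs k j) _; apply: le_lt_trans hN'.
  by apply: ler_wiXn2l => //; lra.
have kl := K_Kpre hp (gt_in l).
have eE k t : i (teval (s k) t) = teval (T := pre M) (fun j => i (s k j)) t.
  exact/esym/(teval_pembedding (s k) t ei).
apply: teq_sym; split=> [t t'|P ts].
- have h := tends_to_dist (tends_to_eval (A := M) t sc) (tends_to_eval (A := M) t' sc).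
  apply: (tends_to_unique h) => e e0.
  have [d d0 hd] := near_term_dist t t' (gt_tuple l) kl e0.
  have [N' hN'] := near_s d d0; exists N' => k /hN' /hd.
  by rewrite mdistRE distrC -!eE -(pembedding_dist ei).
- have h := tends_to_box (@pred_box _ _ M P) (fun j => tends_to_eval (A := M) (ts j) sc).
  apply: (tends_to_unique h) => e e0.
  have [d d0 hd] := near_pred ts (gt_tuple l) kl e0.
  have [N' hN'] := near_s d d0; exists N' => k /hN' /hd.
  rewrite mdistRE distrC -(pembedding_pred ei).
  by congr (`|_ - _| < _); congr ppred; apply/funext => j; rewrite eE.
Qed.

End FraisseContinuity.

(** * The chain of stages *)

Section GenericChain.
Context {R : realType} {L : language}.
Variable K : structure R L -> Prop.
Hypotheses (hp : HP K) (nap : NAP K).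

(** Only the first [st_size] entries of the sequence count; the others are there
to make it total. *)
Record stage := Stage {
  st_struct : structure R L;
  st_tuple : nat -> st_struct;
  st_in : K st_struct;
  st_size : nat }.

Definition block n m (X : Type) (c : 'I_(n + m) -> X) (s : 'I_n + 'I_m) : X :=
  c (unsplit s).

(** Amalgamate the stage with the structure generated by [c].  The segment has
length [N.+1] and not [N], so that the new structure contains a point to fill
the sequence with. *)
Lemma stage_step (C : structure R L) (x : nat -> C) N n m (c : generated_tuple K (n + m)%N) (d : R) :
  K C -> (n <= N)%N -> 0 < d ->
  near K d (fun i : 'I_n => x i) (fun i => block (gt_tuple c) (inl i)) ->
  exists D, K D /\ exists y : nat -> D, teqn N.+1 y x /\
    near K (2 * d) (tsum (fun i : 'I_n => y i) (fun j : 'I_m => y (N.+1 + j)%N))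
      (block (gt_tuple c)).
Proof.
move=> KC nN d0 xc.
have nN' : (n <= N.+1)%N by exact: leqW.
have [|D [KD [a [b [ax bc ab]]]]] := near_amalgam (a := fun i : 'I_N.+1 => x i)
  (b := block (gt_tuple c)) (f := widen_ord nN') (g := inl) (s := 2 * d)
  hp nap (K_Kpre hp KC) (K_Kpre hp (gt_in c)) xc; first by lra.
exists D; split=> //.
pose y := default_ext (tsum a (fun j : 'I_m => b (inr j)) \o @fintype.split N.+1 m) (a ord0).
have yl (i : 'I_N.+1) : y i = a i.
  by rewrite /y -[X in default_ext _ _ X]/(val (lshift m i)) default_ext_ord /= (unsplitK (inl i)).
have yr (j : 'I_m) : y (N.+1 + j)%N = b (inr j).
  by rewrite /y -[X in default_ext _ _ X]/(val (rshift N.+1 j)) default_ext_ord /= (unsplitK (inr j)).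
exists y; split.
  by move: ax; congr teq; apply/funext => i; rewrite yl.
apply: (near_teq (teq_refl _) bc); apply: (near_same (T := pre D)).
  exact: K_Kpre.
move=> [i|j] /=; last by rewrite yr mdistxx; lra.
by have /= := ab i; rewrite -yl.
Qed.

(** Step [k] is coded by numbers [n, m, i, j, d]: extend the initial segment of
length [n] by [m] points, so as to realize approximately the [i]-th type of
length [n + m], if the first part of this type is [2^-1 ^+ j]-close to the
segment.  The number [d] makes each such requirement come back infinitely
often, in particular when the segment has become long enough. *)
Definition handled (dense : forall n, nat -> option (generated_tuple K n)) k (s s' : stage) : Prop :=
  [/\ teqn (st_size s).+1 (st_tuple s') (st_tuple s),
      (st_size s < st_size s')%N &
      forall n m i j (d : nat) c, unpickle k = Some (n, m, i, j, d) ->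
        dense (n + m)%N i = Some c -> (n <= st_size s)%N ->
        near K (2^-1 ^+ j) (fun i : 'I_n => st_tuple s i) (fun i => block (gt_tuple c) (inl i)) ->
        exists zeta : 'I_m -> nat, (forall j, (zeta j < (st_size s').+1)%N) /\
          near K (2 * 2^-1 ^+ j) (tsum (fun i : 'I_n => st_tuple s' i)
            (fun j => st_tuple s' (zeta j))) (block (gt_tuple c))].

Lemma exists_handled dense k s : exists s', handled dense k s s'.
Proof.
case: s => C x KC N.
have dflt : (forall n m i j (d : nat) c, unpickle k = Some (n, m, i, j, d) ->
        dense (n + m)%N i = Some c -> (n <= N)%N ->
        ~ near K (2^-1 ^+ j) (fun i : 'I_n => x i) (fun i => block (gt_tuple c) (inl i))) ->
   exists s', handled dense k (Stage x KC N) s'.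
  move=> h; exists (Stage x KC N.+1); split=> // n m i j d c h1 h2 h3 h4.
  by case: (h n m i j d c h1 h2 h3 h4).
case kE : (unpickle k : option (nat * nat * nat * nat * nat)) => [[[[[n m] i] j] d]|]; last first.
  by apply: dflt => n m i j d c; rewrite kE.
case cE : (dense (n + m)%N i) => [c|]; last first.
  apply: dflt => n' m' i' j' d' c' E; move: c'.
  by case: (Some_inj (etrans (esym kE) E)) => <- <- <- _ _ c'; rewrite cE.
have [[nN h]|no] := pselect ((n <= N)%N /\ near K (2^-1 ^+ j) (fun i : 'I_n => x i)
    (fun i => block (gt_tuple c) (inl i))); last first.
  apply: dflt => n' m' i' j' d' c' E; move: c'.
  case: (Some_inj (etrans (esym kE) E)) => <- <- <- <- _ c'.
  by rewrite cE => -[<-] h1 h2; apply: no.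
have [D [KD [y [yx hy]]]] := stage_step KC nN (half_expr_gt0 j) h.
exists (Stage y KD (N.+1 + m)%N); split=> //=; first by lia.
move=> n' m' i' j' d' c' E; move: c'.
case: (Some_inj (etrans (esym kE) E)) => <- <- <- <- _ c'.
rewrite cE => -[<-] _ _; exists (fun j => N.+1 + j)%N; split=> // l.
by have := ltn_ord l; lia.
Qed.

End GenericChain.

(** * The limit of a chain *)

Section ChainLimit.
Context {R : realType} {L : language}.
Variable K : structure R L -> Prop.
Variable st : nat -> stage K.
Hypothesis st_step : forall k, teqn (st_size (st k)).+1 (st_tuple (st k.+1)) (st_tuple (st k)).
Hypothesis st_grow : forall k, (st_size (st k) < st_size (st k.+1))%N.

Lemma st_size_ge k : (k <= st_size (st k))%N.
Proof. by elim: k => // k IH; exact: leq_ltn_trans IH (st_grow k). Qed.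

Lemma st_size_le k l : (k <= l)%N -> (st_size (st k) <= st_size (st l))%N.
Proof.
elim: l => [|l IH]; first by rewrite leqn0 => /eqP ->.
rewrite leq_eqVlt => /orP[/eqP -> //|]; rewrite ltnS => /IH h.
exact: leq_trans h (ltnW (st_grow l)).
Qed.

Lemma st_teqn k l : (k <= l)%N ->
  teqn (st_size (st k)).+1 (st_tuple (st l)) (st_tuple (st k)).
Proof.
elim: l => [|l IH]; first by rewrite leqn0 => /eqP ->; exact: teq_refl.
rewrite leq_eqVlt => /orP[/eqP -> //|]; rewrite ltnS => kl.
apply: teq_trans (IH kl); apply: teqn_le (st_step l).
by rewrite ltnS; exact: st_size_le.
Qed.

Let ev k (t : term (L := L) nat) : st_struct (st k) := teval (T := pre (st_struct (st k))) (st_tuple (st k)) t.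

Lemma ev_dist k l s t : bounded (st_size (st k)).+1 s -> bounded (st_size (st k)).+1 t -> (k <= l)%N ->
  mdist (ev l s) (ev l t) = mdist (ev k s) (ev k t).
Proof. by move=> bs bt kl; have /= := teqn_dist (st_teqn kl) bs bt. Qed.

Let bnd (t : term (L := L) nat) : nat := projT1 (cid (term_bound t)).

Let bndP t n : (bnd t <= n)%N -> bounded n t.
Proof. by rewrite /bnd; case: (cid _) => /= m bt mn; exact: bounded_le bt. Qed.

Let bounded_st n k (t : term (L := L) nat) : bounded n t -> (n <= k)%N -> bounded (st_size (st k)).+1 t.
Proof. by move=> bt nk; apply: bounded_le bt; have := st_size_ge k; lia. Qed.

(** The direct limit of the chain, presented by terms in the sequence of points: a
distance or a predicate is read off at any stage where the variables of the
terms have their final meaning. *)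
Definition chain_limit : @prestructure R L := @PreStructure R L (term nat)
  (fun s t => mdist (ev (maxn (bnd s) (bnd t)) s) (ev (maxn (bnd s) (bnd t)) t))
  (fun P ts => pred_int (st_struct (st (\max_j bnd (ts j)))) P (fun j => ev (\max_j bnd (ts j)) (ts j)))
  (fun F ts => App ts).

Lemma chain_limit_teval (I : Type) (ts : I -> chain_limit) t :
  teval ts t = tsubst ts t.
Proof. by elim: t => //= F us IH; congr App; apply/funext. Qed.

Lemma chain_limit_dist k (s t : chain_limit) : bounded (st_size (st k)).+1 s ->
  bounded (st_size (st k)).+1 t -> pdist s t = mdist (ev k s) (ev k t).
Proof.
move=> bs bt; rewrite /=; set l := maxn _ _.
have ls : bounded (st_size (st l)).+1 s.
  by apply: (bounded_st (bndP (leqnn _))); exact: leq_maxl.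
have lt : bounded (st_size (st l)).+1 t.
  by apply: (bounded_st (bndP (leqnn _))); exact: leq_maxr.
by rewrite -(ev_dist ls lt (leq_maxl l k)) -(ev_dist bs bt (leq_maxr l k)).
Qed.

Lemma chain_limit_pred k P (ts : 'I_(pred_arity P) -> chain_limit) :
  (forall j, bounded (st_size (st k)).+1 (ts j)) ->
  ppred ts = pred_int (st_struct (st k)) P (fun j => ev k (ts j)).
Proof.
move=> bts; rewrite /=; set l := (\max_j _)%N.
have ls j : bounded (st_size (st l)).+1 (ts j).
  by apply: (bounded_st (bndP (leqnn _))); exact: (leq_bigmax j).
have /= <- := teqn_pred (st_teqn (leq_maxl l k)) ls.
by have /= <- := teqn_pred (st_teqn (leq_maxr l k)) bts.
Qed.

Lemma chain_limit_teq (I : Type) (ts : I -> chain_limit) k :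
  (forall i, bounded (st_size (st k)).+1 (ts i)) ->
  teq (U := pre (st_struct (st k))) ts (fun i => ev k (ts i)).
Proof.
move=> bts; split=> [s t|P us].
- rewrite !chain_limit_teval (@chain_limit_dist k); try exact: bounded_tsubst.
  by rewrite /ev !teval_tsubst.
- under eq_fun do rewrite chain_limit_teval.
  rewrite (@chain_limit_pred k); last by move=> j; exact: bounded_tsubst.
  by congr pred_int; apply/funext => j; rewrite /ev teval_tsubst.
Qed.

Lemma chain_limit_Kpre : Kpre K chain_limit.
Proof.
move=> n ts; have [m hm] := bounded_max ts.
exists (st_struct (st m)); split; first exact: st_in.
exists (fun j => ev m (ts j)); apply/teq_sym/chain_limit_teq => i.
exact: bounded_st (hm i) _.
Qed.

Lemma chain_limit_tuple n k : (n <= (st_size (st k)).+1)%N ->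
  teqn n ((@Var _ _) : nat -> chain_limit) (st_tuple (st k)).
Proof.
move=> nk; apply: (chain_limit_teq (ts := fun i : 'I_n => (Var (i : nat) : chain_limit)) (k := k)).
by move=> i; exists (Var (Ordinal (leq_trans (ltn_ord i) nk))).
Qed.

End ChainLimit.

Section FraisseLimit.
Context {R : realType} {L : language}.
Implicit Types (A B C M : structure R L) (T U : @prestructure R L).
Variable K : structure R L -> Prop.
Hypotheses (hp : HP K) (nap : NAP K).

(** Every type over an initial segment of [a] is realized approximately by entries
of [a], with parameters in the segment. *)
Definition generic_sequence M (a : nat -> M) : Prop :=
  forall n (J : finType) T (y : 'I_n + J -> T) (e : R), Kpre K T ->
    teq (fun i : 'I_n => a i) (fun i => y (inl i)) -> 0 < e ->
    exists zeta : J -> nat, near K e (tsum (fun i : 'I_n => a i) (fun j => a (zeta j))) y.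

(** Approximate the type of [y] by one of the dense types [c].  The initial segment
of the sequence is then close to the first part of [c], so at the stage where
this requirement is handled points are appended that realize [c]
approximately. *)
Lemma chain_generic (st : nat -> stage K) (dense : forall n, nat -> option (generated_tuple K n))
    M (i : chain_limit st -> M) :
  (forall k, handled dense k (st k) (st k.+1)) ->
  (forall n (x : generated_tuple K n) (e : R), 0 < e ->
     exists k y, dense n k = Some y /\ (dK x y < e%:E)%E) ->
  pembedding (U := pre M) i -> K_structure K M ->
  generic_sequence (fun n => i (Var n)).
Proof.
move=> hst hdense ei kM; pose a n := i (Var n).
have st_step k : teqn (st_size (st k)).+1 (st_tuple (st k.+1)) (st_tuple (st k)).
  by have [] := hst k.
have st_grow k : (st_size (st k) < st_size (st k.+1))%N by have [] := hst k.
have ast n k : (n <= (st_size (st k)).+1)%N -> teqn n a (st_tuple (st k)).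
  move=> nk; apply: teq_trans (chain_limit_tuple st_step st_grow nk).
  exact: (teq_pembedding (fun i : 'I_n => (Var (i : nat) : chain_limit st)) ei).
have kpM := K_structure_Kpre kM.
have main n m T (y : 'I_n + 'I_m -> T) (e : R) : Kpre K T ->
    teq (fun i : 'I_n => a i) (fun i => y (inl i)) -> 0 < e ->
    exists zeta : 'I_m -> nat, near K e (tsum (fun i : 'I_n => a i) (fun j => a (zeta j))) y.
  move=> kT ay e0.
  have [g gy] := generated_tuple_of (fun j => y (fintype.split j)) hp kT.
  have [j hj] : exists j, 2^-1 ^+ j < e / 4 by apply: half_expr_lt; lra.
  have [p [c [pc gc]]] := hdense _ g _ (half_expr_gt0 j).
  have {}gc := (dK_near hp nap _ _ (half_expr_gt0 j)).1 gc.
  have yc : near K (2^-1 ^+ j) y (block (gt_tuple c)).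
    have := near_reindex (@unsplit n m) gc; apply: near_teq; last exact: teq_refl.
    have := teq_reindex (@unsplit n m) gy.
    by congr teq; apply/funext => s; rewrite unsplitK.
  have [|d hd] := @injective_unbounded (fun d => pickle (n, m, p, j, d)) n.
    by move=> d d' /(pcan_inj pickleK) [].
  set k := pickle _ in hd.
  have nk : (n <= st_size (st k))%N by exact: leq_trans hd (st_size_ge st_grow k).
  have [_ _ hk] := hst k.
  have [|zeta [zetak hz]] := hk n m p j d c (pickleK _) pc nk.
    apply: near_teq (near_reindex inl yc); last exact: teq_refl.
    exact: teq_trans (teq_sym ay) (ast _ _ (leqW nk)).
  exists zeta.
  apply: (@near_triangle _ _ K hp nap (2 * 2^-1 ^+ j) (2^-1 ^+ j) _ _ _ _ _ _ (block (gt_tuple c))).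
  - exact: kpM.
  - apply: near_teq hz; last exact: teq_refl.
    pose f (s : 'I_n + 'I_m) : 'I_(st_size (st k.+1)).+1 := match s with
      | inl i => widen_ord (leq_trans nk (leq_trans (ltnW (st_grow k)) (leqnSn _))) i
      | inr j => Ordinal (zetak j) end.
    have := teq_sym (teq_reindex f (ast _ k.+1 (leqnn _))).
    by congr teq; apply/funext => -[].
  - exact: near_sym yc.
  - lra.
move=> n J T y e kT ay e0.
have [|zeta hz] := main n #|J| T (fun s => match s with inl i => y (inl i) | inr j => y (inr (enum_val j)) end) e kT _ e0.
- exact: ay.
exists (fun j => zeta (enum_rank j)).
have := near_reindex (fun s : 'I_n + J => match s with inl i => inl i | inr j => inr (enum_rank j) end) hz.
congr near; apply/funext => -[i'|j] //=; by rewrite enum_rankK.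
Qed.

End FraisseLimit.

(** * Generic sequences *)

Section GenericSequences.
Context {R : realType} {L : language}.
Implicit Types (A B C M : structure R L) (T U : @prestructure R L).
Variable K : structure R L -> Prop.
Hypotheses (hp : HP K) (nap : NAP K) (hCP : CP K).
Variables (M : structure R L) (a : nat -> M).
Hypotheses (kM : Kpre K (pre M)) (ga : generic_sequence K a).

(** The value of a term at [a] is approximated by entries of [a] whose type over a
large enough initial segment is close to the type of that value: the distance
to the value of the term is part of the type, and [uc_term] controls the
term. *)
Lemma generic_dense : tdense a ->
  forall x (e : R), 0 < e -> exists n, mdist x (a n) < e.
Proof.
move=> da x e e0; have [|t xt] := da x (e / 2); first by lra.
have [n [t' tE]] := term_bound t.
have e4 : 0 < e / 4 by lra.
have [d d0 hd] := uc_term hp nap hCP t' (fun i : 'I_n => a i) kM e4.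
pose at' := teval (T := pre M) (fun i : 'I_n => a i) t'.
have atE : teval (T := pre M) a t = at' by rewrite tE teval_tsubst.
pose y := tsum (fun i : 'I_n => a i) (fun _ : 'I_1 => at').
have r0 : 0 < Num.min d (e / 8) by rewrite lt_min d0; lra.
have [zeta [C [KC [p [q [pa qy pq]]]]]] := ga (T := pre M) (y := y) kM (teq_refl _) r0.
have h1 := hd C KC (fun i => q (inl i)) (fun i => p (inl i)) (teq_reindex inl qy)
  (fun i => _).
have {}h1 : mdist (teval (T := pre C) (fun i => q (inl i)) t')
    (teval (T := pre C) (fun i => p (inl i)) t') < e / 4.
  by apply: h1 => i; rewrite metric_sym; exact: lt_minl (pq (inl i)).
have h2 : mdist (q (inr ord0)) (teval (T := pre C) (fun i => q (inl i)) t') = 0.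
  have := qy.1 (Var (inr ord0)) (tsubst (fun i => Var (inl i)) t').
  by rewrite !teval_tsubst /= => ->; rewrite mdistxx.
have h3 : mdist (p (inr ord0)) (teval (T := pre C) (fun i => p (inl i)) t') =
    mdist (a (zeta ord0)) at'.
  have := pa.1 (Var (inr ord0)) (tsubst (fun i => Var (inl i)) t').
  by rewrite !teval_tsubst.
exists (zeta ord0).
have := lt_minr (pq (inr ord0)); rewrite atE in xt.
have := metric_triangle x at' (a (zeta ord0)); rewrite (metric_sym at') -h3.
have := metric_triangle (p (inr ord0)) (q (inr ord0)) (teval (T := pre C) (fun i => p (inl i)) t').
have := metric_triangle (q (inr ord0)) (teval (T := pre C) (fun i => q (inl i)) t')
  (teval (T := pre C) (fun i => p (inl i)) t'); rewrite h2; lra.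
Qed.

Hypothesis da : forall x (e : R), 0 < e -> exists n, mdist x (a n) < e.

(** Replace [w] by entries of the dense sequence [a], realize the type of these and
[z] together in a member of [K], and use genericity over an initial segment
containing the chosen entries. *)
Lemma generic_approximation (I J : finType) T (w : I -> M) (z : I + J -> T) (r s eta : R) :
  Kpre K T -> near K r w (fun i => z (inl i)) -> r < s -> 0 < eta ->
  exists w' : I + J -> M, near K eta w' z /\ forall i, mdist (w' (inl i)) (w i) < s.
Proof.
move=> kT wz rs eta0.
pose e := Num.min eta ((s - r) / 8).
have e0 : 0 < e by rewrite lt_min eta0; lra.
have e1 : e <= eta by rewrite ge_min lexx.
have e2 : e <= (s - r) / 8 by rewrite ge_min lexx orbT.
have [iota hiota] := choice (fun i => da (w i) e0).
have az : near K (r + 2 * e) (fun i => a (iota i)) (fun i => z (inl i)).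
  apply: (@near_triangle _ _ K hp nap e r _ _ _ _ _ _ w) wz _ => //; last by lra.
  by apply: near_same => // i; rewrite /= metric_sym.
pose n := (\max_i iota i).+1.
have iota_n i : (iota i < n)%N by rewrite ltnS; exact: leq_bigmax.
have [|C [KC [p [q [pa qz pq]]]]] := near_amalgam (a := fun i : 'I_n => a i) (b := z)
  (f := fun i => Ordinal (iota_n i)) (g := inl) (s := r + 3 * e) hp nap kM kT az; first by lra.
have [zeta [D [KD [u [v [ua vpq uv]]]]]] := ga (T := pre C) (y := tsum p q)
  (K_Kpre hp KC) (teq_sym pa) e0.
exists (fun s => a (zeta s)); split.
  apply: (near_le e1); exists D; split=> //.
  exists (fun s => u (inr s)), (fun s => v (inr s)); split=> //.
  - exact: (teq_reindex inr ua).
  - exact: teq_trans (teq_reindex inr vpq) qz.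
move=> i; pose oi := Ordinal (iota_n i).
have /= h1 := teq_dist (inr (inl i)) (inl oi) ua.
have /= h2 := teq_dist (inr (inl i)) (inl oi) vpq.
have := metric_triangle (a (zeta (inl i))) (a (iota i)) (w i); rewrite -h1.
have := metric_triangle (u (inr (inl i))) (v (inr (inl i))) (u (inl oi)).
have := metric_triangle (v (inr (inl i))) (v (inl oi)) (u (inl oi)); rewrite h2.
have := pq i; have := uv (inr (inl i)); have := uv (inl oi); have := hiota i.
have := metric_sym (u (inl oi)) (v (inl oi)); have := metric_sym (w i) (a (iota i)).
have := metric_sym (p oi) (q (inl i)); rewrite -/oi; lra.
Qed.

(** [generic_approximation] provides a tuple whose type is close to the required
one; applied again to it, a tuple with a better type nearby.  The tuples
converge, and the type of the limit is at distance zero from the required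
one. *)
Lemma generic_extension_property : extension_property K M.
Proof.
move=> I J T a0 c b e kT ab e0.
have [C [KC [z za]]] := Kpre_fin (tsum a0 c) kT; have kC := K_Kpre hp KC.
have e8 : 0 < e / 8 by lra.
have bz : near K (e / 8) b (fun i => z (inl i)).
  have h : near K (e / 8) b b by apply: near_same => // i; rewrite /= mdistxx.
  apply: near_teq (teq_refl _) _ h.
  exact: teq_trans (teq_sym ab) (teq_sym (teq_reindex inl za)).
pose k0 := e / 16; have k00 : 0 < k0 by rewrite /k0; lra.
have [||w0 [w0z w0b]] := generic_approximation (s := e / 4) (eta := k0) kC bz; [lra|by []|].
have [|||u [l [u0 hu hl]]] := converging_choices (c := 2 * k0)
  (P := fun k (w : I + J -> M) => near K (k0 * 2^-1 ^+ k) (T := pre M) (U := pre C) w z)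
  (t0 := w0) (@carrier_complete _ _ M).
- by lra.
- by rewrite expr0 mulr1.
- move=> k w wz; have hk := @half_expr_gt0 R k.
  have kk : 0 < k0 * 2^-1 ^+ k by rewrite mulr_gt0.
  have [||w' [w'z w'w]] := generic_approximation (J := void) (s := 2 * (k0 * 2^-1 ^+ k))
    (z := tsum z (of_void C)) (eta := k0 * 2^-1 ^+ k.+1) kC wz.
  + lra.
  + by rewrite mulr_gt0// half_expr_gt0.
  exists (fun s => w' (inl s)); split; first exact: (near_reindex inl w'z).
  by move=> i; rewrite metric_sym -mulrA; exact/ltW/w'w.
have lz : teq (T := pre M) (U := pre C) l z.
  apply: (teq_of_near hp nap hCP kM) => d d0.
  have [k hk] : exists k, 2^-1 ^+ k < d / (16 * k0).
    by apply: half_expr_lt; rewrite divr_gt0// mulr_gt0.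
  have {}hk : k0 * 2^-1 ^+ k < d / 16.
    by move: hk; rewrite invfM mulrA ltr_pdivlMr// mulrC.
  apply: (@near_triangle _ _ K hp nap (5 * (k0 * 2^-1 ^+ k)) (k0 * 2^-1 ^+ k) _ _ _ _ _ _ (u k)) => //.
  - apply: near_same => // s; rewrite /= metric_sym; apply: le_lt_trans (hl k s) _.
    have := @half_expr_gt0 R k; have : 0 < k0 * 2^-1 ^+ k by rewrite mulr_gt0// half_expr_gt0.
    rewrite -!mulrA; lra.
  - lra.
exists (fun i => l (inl i)), (fun j => l (inr j)); split.
  have -> : tsum (fun i => l (inl i)) (fun j => l (inr j)) = l by apply/funext => -[].
  exact: teq_trans lz za.
move=> i; have := hl 0%N (inl i); rewrite u0 expr0 mulr1.
have := w0b i; have := metric_triangle (l (inl i)) (w0 (inl i)) (b i).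
have := metric_sym (l (inl i)) (w0 (inl i)); rewrite /k0; lra.
Qed.

End GenericSequences.

(** * The theorem *)

Section FraisseTheorem.
Context {R : realType} {L : language}.
Implicit Types (A B C M : structure R L) (T U : @prestructure R L).
Variable K : structure R L -> Prop.

Lemma age_of_limit M : HP K -> (forall A, K A -> finitely_generated A) ->
  K_structure K M -> (forall A, K A -> embeds A M) -> K = age M.
Proof.
move=> hp fg kM KM; apply/funext => A; apply/propext; split=> [KA|]; last exact: kM.
by split; [exact: fg|exact: KM].
Qed.

Lemma empty_structure_homogeneous A : (A -> False) ->
  separable_structure A /\ approximately_ultrahomogeneous A.
Proof.
move=> A0; split; first by exists set0; split; [exact: countable0|move=> O [x]; case: (A0 x)].
move=> phi e e0; exists (fun x => x); last by move=> x; case: (A0 (val x)).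
by split; [exact: embedding_id|exists id].
Qed.

Lemma empty_embeds A B : JEP K -> Kpre K (pre A) -> Kpre K (pre B) ->
  (A -> False) -> embeds A B.
Proof.
move=> jep kA kB A0.
have v : teq (T := pre A) (U := pre B) (of_void A) (of_void B).
  by apply: (teq_void _ _ jep kA kB) => -[].
have [|f ef _] := embedding_extend v; last by exists f.
by move=> x; case: (A0 x).
Qed.

(** The chain needs a point to start with, so a class all of whose members are
empty is treated apart: any member then is the limit. *)
Lemma fraisse_limit_exists : fraisse_class K -> (forall A, K A -> finitely_generated A) ->
  (exists A, K A) -> exists M,
    [/\ separable_structure M, approximately_ultrahomogeneous M & K = age M].
Proof.
move=> [hp jep nap hPP hCP] fg [A0 KA0].
have [[C0 [KC0 [x0 _]]]|noC] := pselect (exists C, K C /\ exists x : C, True); last first.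
  have nA0 : A0 -> False by move=> x; apply: noC; exists A0; split=> //; exists x.
  have [sA hA] := empty_structure_homogeneous nA0.
  exists A0; split=> //; apply: age_of_limit => //; first exact: hp.
  move=> B KB; apply: (empty_embeds jep (K_Kpre hp KB) (K_Kpre hp KA0)).
  by move=> x; apply: noC; exists B; split=> //; exists x.
have dns n : {dense : nat -> option (generated_tuple K n) |
    forall x (e : R), 0 < e -> exists k y, dense k = Some y /\ (dK x y < e%:E)%E}.
  by apply: cid; have [[s hs] _] := hPP n; exists s.
pose dense n := projT1 (dns n).
have [nxt hnxt] : {nxt : nat * stage K -> stage K |
    forall q, handled dense q.1 q.2 (nxt q)}.
  have /choice [f hf] : forall q : nat * stage K, exists s', handled dense q.1 q.2 s'.
    by move=> q; exact: exists_handled.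
  by exists f.
pose st := fix st k := if k is k'.+1 then nxt (k', st k') else Stage (fun=> x0) KC0 0.
have hst k : handled dense k (st k) (st k.+1) by exact: (hnxt (k, st k)).
have st_step k : teqn (st_size (st k)).+1 (st_tuple (st k.+1)) (st_tuple (st k)).
  by have [] := hst k.
have st_grow k : (st_size (st k) < st_size (st k.+1))%N by have [] := hst k.
have [M [i [ei di kM]]] := completion_structure hp nap hCP hPP (chain_limit_Kpre st_step st_grow).
have kpM := K_structure_Kpre kM.
pose a n := i (Var n).
have ga : generic_sequence K a.
  by apply: (chain_generic hp nap hst) => // n x e e0; exact: (projT2 (dns n)).
have da : tdense a.
  move=> x e e0; have [t xt] := di x e e0; exists t.
  have := teval_pembedding (fun n => (Var n : chain_limit st)) t ei.
  rewrite -[RHS]/(i _) chain_limit_teval => ->.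
  rewrite (_ : tsubst _ t = t)//; elim: t {xt} => //= F ts IH; congr App; exact/funext.
have da' := generic_dense hp nap hCP kpM ga da.
have ext := generic_extension_property hp nap hCP kpM ga da'.
have sM := dense_seq_separable da'.
exists M; split=> //; first exact: extension_ultrahomogeneous ext kpM.
apply: age_of_limit => // A KA.
exact: (fg_embeds jep ext kpM (fg _ KA) (K_Kpre hp KA)).
Qed.

End FraisseTheorem.

Theorem theorem2p21 (R : realType) (L : language) (K : structure R L -> Prop)
  (K_fg : forall A, K A -> finitely_generated A)
  (K_neq0 : exists A, K A) :
  (fraisse_class K <->
   exists M : structure R L, [/\ separable_structure M,
     approximately_ultrahomogeneous M & K = age M]) /\
  (forall M : structure R L, separable_structure M ->
   approximately_ultrahomogeneous M -> K = age M ->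
   [/\ is_limit K M,
       (forall N : structure R L, separable_structure N ->
        approximately_ultrahomogeneous N -> K = age N -> isomorphic M N)
     & (forall A : structure R L, separable_structure A -> K_structure K A ->
        embeds A M)]).
Proof.
have extM (M : structure R L) : approximately_ultrahomogeneous M -> K = age M ->
    [/\ HP K, JEP K, NAP K, K_structure K M & extension_property K M].
  move=> hM ->; split.
  - exact: age_HP.
  - exact: age_JEP.
  - exact: age_NAP.
  - exact: age_structure.
  - by apply: ultrahomogeneous_extension => // C [].
split.
- split=> [fK|[M [sM hM KM]]]; first exact: fraisse_limit_exists.
  have [hp jep nap kM ext] := extM M hM KM; have kpM := K_structure_Kpre kM.
  split=> //; first exact: extension_PP ext kpM.
  exact: extension_CP ext kpM.
move=> M sM hM KM; have [hp jep nap kM ext] := extM M hM KM.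
have kpM := K_structure_Kpre kM.
split.
- exact: extension_property_limit.
- move=> N sN hN KN; have [_ _ _ kN extN] := extM N hN KN.
  have kpN := K_structure_Kpre kN.
  have [[x0 _]|M0] := pselect (exists x : M, True); last first.
    have nM : M -> False by move=> x; apply: M0; exists x.
    have nN : N -> False.
      move=> y; have [c _] := extension_realize jep ((fun=> y) : 'I_1 -> N) ext kpM kpN.
      exact: nM (c ord0).
    have [f ef] := empty_embeds jep kpM kpN nM; have [g _] := empty_embeds jep kpN kpM nN.
    by exists f; split=> //; exists g => x; [case: (nM x)|case: (nN x)].
  have [y _] := extension_realize jep ((fun=> x0) : 'I_1 -> M) extN kpN kpM.
  have v : teqn 0 (fun=> x0) (fun=> y ord0).
    by apply: (teq_void _ _ jep kpM kpN) => -[].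
  have [f isof _] := approximate_isomorphism sM sN ext extN kpM kpN v ltr01.
  by exists f.
- by move=> A sA kA; exact: universality ext kM sA kA.
Qed.
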